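(* Let $n\ge2$ and let $\gamma:\mathbf{S}^1\cong\mathbf{R}/L\mathbf{Z}\to\mathbf{R}^n$ be a relatively extremal knot, parametrized by arclength, such that there exists $s_0\in\mathbf{S}^1$ with $\kappa\gamma(s_0)<\sup\kappa\gamma$. Then both of the following hold. (i) $i(\gamma(\mathbf{S}^1),\mathbf{R}^n)=R_O(\gamma(\mathbf{S}^1),\mathbf{R}^n)=\frac12 MDC(\gamma(\mathbf{S}^1))$. (ii) If $s_0\notin I_c(\gamma)$, i.e. $\gamma(s_0)$ is not a minimal double critical point, then there exist $c\le a<s_0<b\le d$ such that (a) $\gamma$ is a line segment over $[a,b]$, and (b) $\gamma|_{[c,a]}$ and $\gamma|_{[b,d]}$ are planar circular arcs of radius $F_k(\gamma)$ such that ($a-c\ge\pi F_k(\gamma)$ or $c\in I_c(\gamma)$) and ($d-b\ge\pi F_k(\gamma)$ or $d\in I_c(\gamma)$).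
   Context: Closed curves are maps on $\mathbf{S}^1\cong\mathbf{R}/L\mathbf{Z}$, regarded also as $L$-periodic maps on $\mathbf{R}$; interval notation describes subsets of $\mathbf{R}/L\mathbf{Z}$ (so in (ii) $s_0,a,b,c,d$ are real lifts). A simple $C^{1,1}$ closed curve is an injective $C^1$ map $\gamma:\mathbf{R}/L\mathbf{Z}\to\mathbf{R}^n$ with Lipschitz derivative and $\gamma'\ne0$. Put $K=\gamma(\mathbf{S}^1)$. $C^{1,1}$ also denotes the set of such curves. Curvature: $\kappa\gamma(s)=\limsup_{t\ne u,\;t,u\to s}\frac{\measuredangle(\gamma'(t),\gamma'(u))}{\ell_{tu}(\gamma)}$, where $\ell_{tu}(\gamma)$ is the length of $\gamma$ between nearby parameters $t$ and $u$. Analytic focal distance: $F_k(\gamma)=(\sup_s\kappa\gamma(s))^{-1}$. Thickness (normal injectivity radius): with $NK=\{(x,z):x=\gamma(s)\text{ for some }s,\ z\cdot\gamma'(s)=0\}$ and $\exp^N(x,z)=x+z$, $i(K,\mathbf{R}^n)=\sup(\{0\}\cup\{r>0:\exp^N\text{ is one-to-one on }\{(x,z)\in NK:\|z\|<r\}\})$. Ball radius: for $x\in K$, $r>0$ and $u$ a unit tangent vector to $K$ at $x$, let $O_x(r;K)=\{y\in\mathbf{R}^n:\exists z,\ u\cdot z=0,\ \|z\|=1,\ \|y-x-rz\|<r\}$, $O(r;K)=\bigcup_{x\in K}O_x(r;K)$, and $R_O(\gamma)=R_O(K)=R_O(K,\mathbf{R}^n)=\inf\{r>0:O(r;K)\cap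 K\ne\emptyset\}$. A pair of distinct points $x,y\in K$ is a double critical pair if the line segment joining $x$ and $y$ is normal to $K$ at both $x$ and $y$. $MDC(K)=MDC(\gamma)=\inf\{\|x-y\|:\{x,y\}\text{ is a double critical pair for }K\}$. $I_c=I_c(\gamma)=\{x\in\mathbf{S}^1:\exists y\in\mathbf{S}^1,\ \|\gamma(x)-\gamma(y)\|=MDC(\gamma),\ (\gamma(x)-\gamma(y))\cdot\gamma'(x)=(\gamma(x)-\gamma(y))\cdot\gamma'(y)=0\}$; the points of $\gamma(I_c)$ are the minimal double critical points. Ropelength: $\ell_e(\gamma)=\ell(\gamma)/R_O(\gamma)$, where $\ell(\gamma)$ is the length. A knot class $[\theta]$ is a free $C^0$-homotopy class of embeddings $\mathbf{S}^1\to\mathbf{R}^n$ (homotopy through embeddings). A simple $C^{1,1}$ closed curve $\gamma_0$ with knot class $[\theta]$ is called relatively extremal (a relatively extremal knot) if there is an open set $\mathcal{U}$ in the $C^1$ topology with $\gamma_0\in\mathcal{U}$ and $\ell_e(\gamma_0)\le\ell_e(\gamma)$ for all $\gamma\in\mathcal{U}\cap[\theta]\cap C^{1,1}$. *)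

(* Defs.v *)
From HB Require Import structures.
From mathcomp Require Import all_boot all_order all_algebra.
From mathcomp Require Import all_classical all_reals all_analysis.

Set Implicit Arguments.
Unset Strict Implicit.
Unset Printing Implicit Defensive.

Import Order.TTheory GRing.Theory Num.Theory.
Import numFieldNormedType.Exports.

Local Open Scope ring_scope.
Local Open Scope classical_set_scope.

(** A closed curve on S^1 = R/LZ is an [L]-periodic map [R -> 'rV[R]_n]; points
    of S^1 are represented by arbitrary real lifts. The library norm on ['rV_n]
    is the sup norm, so the Euclidean metric is introduced separately; the two
    norms induce the same topology, hence the library notions of continuity and
    derivative are the usual ones. *)

Section Euclidean.
Context {R : realType} {n : nat}.
Implicit Types u v : 'rV[R]_n.

Definition dotv u v : R := \sum_(i < n) u ord0 i * v ord0 i.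
Definition normv u : R := Num.sqrt (dotv u u).
Definition anglev u v : R := acos (dotv u v / (normv u * normv v)).

Definition segment u v : set 'rV[R]_n :=
  [set (1 - t) *: u + t *: v | t in `[0, 1]].

(** The circle of center [p] and radius [r] in the plane [p + span(u, v)], from
    angle 0 to angle [tau]. *)
Definition plane_arc (p u v : 'rV[R]_n) (r tau : R) : set 'rV[R]_n :=
  [set p + (r * cos t) *: u + (r * sin t) *: v | t in `[0, tau]].

(** [tau = 0] is allowed: a single point counts as a degenerate arc. *)
Definition is_circular_arc (A : set 'rV[R]_n) (r : R) : Prop :=
  exists p u v tau,
    [/\ dotv u u = 1, dotv v v = 1, dotv u v = 0, 0 <= tau <= 2 * pi &
        A = plane_arc p u v r tau].

End Euclidean.

Section ClosedCurves.
Context {R : realType} {n : nat} (L : R).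
Implicit Types gamma eta theta : R -> 'rV[R]_n.

Definition C1_closed gamma : Prop :=
  [/\ periodic gamma L, (forall s, derivable gamma s 1)
    & continuous (derive1 gamma)].

(** Injectivity on R/LZ. *)
Definition simple gamma : Prop :=
  forall s t, gamma s = gamma t -> exists k : int, t = s + k%:~R * L.

Definition simple_C11_closed gamma : Prop :=
  [/\ C1_closed gamma, simple gamma,
      (exists k, forall s t,
         normv (derive1 gamma s - derive1 gamma t) <= k * `|s - t|)
    & forall s, derive1 gamma s != 0].

Definition unit_speed gamma : Prop := forall s, normv (derive1 gamma s) = 1.

(** S^1 is compact, so an embedding is an injective continuous map. *)
Definition embedding gamma : Prop :=
  [/\ periodic gamma L, continuous gamma & simple gamma].

Definition knot_class theta : set (R -> 'rV[R]_n) :=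
  [set gamma | exists H : R * R -> 'rV[R]_n,
    [/\ {within `[0, 1] `*` [set: R], continuous H},
        (forall t, 0 <= t <= 1 -> embedding (fun s => H (t, s))),
        (forall s, H (0, s) = theta s)
      & (forall s, H (1, s) = gamma s)]].

(** Openness in the space of C^1 maps S^1 -> R^n with the C^1 norm. *)
Definition C1_open (U : set (R -> 'rV[R]_n)) : Prop :=
  U `<=` C1_closed /\
  forall gamma, U gamma -> exists2 e, 0 < e &
    forall eta, C1_closed eta ->
      (forall s, normv (eta s - gamma s) < e /\
                 normv (derive1 eta s - derive1 gamma s) < e) ->
      U eta.

End ClosedCurves.

Section Geometry.
Context {R : realType} {n : nat}.
Implicit Types gamma : R -> 'rV[R]_n.

Definition arclength gamma (a b : R) : R :=
  (\int[lebesgue_measure]_(s in `[a, b]) normv (derive1 gamma s))%R.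

Definition curvature gamma (s : R) : \bar R :=
  limf_esup
    (fun p : R * R =>
       (anglev (derive1 gamma p.1) (derive1 gamma p.2) /
        arclength gamma (Num.min p.1 p.2) (Num.max p.1 p.2))%:E)
    (within [set p : R * R | p.1 != p.2] (nbhs (s, s))).

Definition sup_curvature gamma : \bar R := ereal_sup (range (curvature gamma)).

Definition focal_distance gamma : \bar R := ((sup_curvature gamma)^-1)%E.

(** The quantities below are attached to the set [K = range gamma]. They are
    written in terms of [gamma] to have access to the tangent lines of [K]; for
    a simple regular curve they do not depend on the parametrization. *)

Definition unit_tangent gamma (x : 'rV[R]_n) : set 'rV[R]_n :=
  [set u | normv u = 1 /\
     exists s, gamma s = x /\ exists k, u = k *: derive1 gamma s].

Definition normal_bundle gamma : set ('rV[R]_n * 'rV[R]_n) :=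
  [set xz | exists s, xz.1 = gamma s /\ dotv xz.2 (derive1 gamma s) = 0].

Definition normal_exp (xz : 'rV[R]_n * 'rV[R]_n) : 'rV[R]_n := xz.1 + xz.2.

Definition injectivity_radius gamma : \bar R :=
  ereal_sup ([set 0%E] `|`
    [set r%:E | r in [set r : R | 0 < r /\
       set_inj (normal_bundle gamma `&` [set xz | normv xz.2 < r])
         normal_exp]]).

Definition ball_family_at gamma (x : 'rV[R]_n) (r : R) : set 'rV[R]_n :=
  [set y | exists u z, [/\ unit_tangent gamma x u, dotv u z = 0, normv z = 1 &
                           normv (y - x - r *: z) < r]].

Definition ball_family gamma (r : R) : set 'rV[R]_n :=
  \bigcup_(x in range gamma) ball_family_at gamma x r.

Definition ball_radius gamma : \bar R :=
  ereal_inf [set r%:E | r in [set r : R | 0 < r /\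
    ball_family gamma r `&` range gamma !=set0]].

Definition double_critical gamma (x y : 'rV[R]_n) : Prop :=
  [/\ x != y, normal_bundle gamma (x, y - x) &
      normal_bundle gamma (y, x - y)].

Definition MDC gamma : \bar R :=
  ereal_inf [set (normv (xy.1 - xy.2))%:E |
    xy in [set xy : 'rV[R]_n * 'rV[R]_n | double_critical gamma xy.1 xy.2]].

(** The set of all real lifts of the points of I_c. *)
Definition min_critical gamma : set R :=
  [set x | exists y,
    [/\ (normv (gamma x - gamma y))%:E = MDC gamma,
        dotv (gamma x - gamma y) (derive1 gamma x) = 0 &
        dotv (gamma x - gamma y) (derive1 gamma y) = 0]].

Definition ropelength (L : R) gamma : \bar R :=
  ((arclength gamma 0 L)%:E / ball_radius gamma)%E.

Definition relatively_extremal (L : R) (gamma0 : R -> 'rV[R]_n) : Prop :=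
  simple_C11_closed L gamma0 /\
  exists U, [/\ C1_open L U, U gamma0 &
    forall gamma, U gamma -> knot_class L gamma0 gamma ->
      simple_C11_closed L gamma ->
      (ropelength L gamma0 <= ropelength L gamma)%E].

End Geometry.

(* Main.v *)
Require Import Defs.
From HB Require Import structures.
From mathcomp Require Import all_boot all_order all_algebra.
From mathcomp Require Import all_classical all_reals all_analysis.
From mathcomp Require Import ring lra.

(** Let [T] be the derivative of the unit speed knot [gamma], of period [L], and [r] its
    ball radius. That the ball radius is at least [r] means that [gamma] avoids the open
    balls of radius [r] tangent to it. This makes [T] Lipschitz of constant [1 / r], so
    that arcs of length at most [pi r] are governed by Schur's comparison with the circle
    of radius [r], and it keeps points joined by no arc shorter than [pi r] at distance at
    least [2 r] ([far_apart]). Conversely these two properties imply that the ball radius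
    is at least [r] ([outside_tangent_balls_far]). A contact is a pair of points at
    distance exactly [2 r] whose chord is normal to [gamma] at both ends.

    An arc that meets no contact has room around it: a nearby arc with the same end points
    and end directions and with curvature at most [1 / r] can be substituted for it
    without lowering the ball radius or changing the knot class. Extremality of the
    ropelength then says that the arc is no longer than the substitute
    ([extremal_locally_shortest]). This is used for two first variations, both written in
    terms of the velocity.

    Where the curvature is below [1 / r], contracting [T] towards a mean value shortens
    the arc unless it is straight ([locally_shortest_straight]). As the curvature is at
    most [1 / r] everywhere, this applies near [s0], unless [s0] is a contact.

    At the end [b] of a straight piece of direction [e], [T] is compared on an interval
    [[b, v]] with the motion on the unit sphere that has the same end values, rests at [e]
    for a while and then follows a great circle at the maximal speed [1 / r]. This motion
    stays at least as close to [e] as [T] does. Mixing a small part of it into [T] and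
    compensating the change of displacement by shortening the straight piece yields the
    inequality [comparison_variation]. On a short interval it forces [T] to coincide with
    the comparison motion ([first_turn]); as [T] leaves [e] at once, there is no rest, and
    [gamma] is an arc of a circle of radius [r]. A circular arc of angle less than [pi]
    that meets no contact can be prolonged in the same way ([turn_further]), since a delay
    [D] of the comparison motion would gain a multiple of [D] and cost only [O(D eta)] for
    a prolongation by the angle [eta]. So the arc goes on until it is a half circle or
    ends at a contact ([segment_then_turn]); reversing the orientation gives the other side
    of [s0].

    A half circle of radius [r] joins points at distance [2 r], which again form a contact.
    So there is always a contact, and then the minimal double critical distance is [2 r],
    the minimal double critical points are the contacts, and the normal injectivity radius
    is [r]. A circular arc that is not reduced to a point has curvature [1 / r], so that
    [r] is the focal distance; if both arcs are reduced to points, any radius will do. *)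

Set Implicit Arguments.
Unset Strict Implicit.
Unset Printing Implicit Defensive.

Import Order.TTheory GRing.Theory Num.Theory.
Import numFieldNormedType.Exports.

Local Open Scope ring_scope.
Local Open Scope classical_set_scope.

(** * Euclidean geometry of row vectors *)

Section EuclideanAlgebra.
Context {R : realType} {n : nat}.
Implicit Types (u v w : 'rV[R]_n) (k : R).

Lemma dotvC u v : dotv u v = dotv v u.
Proof. by apply: eq_bigr => i _; rewrite mulrC. Qed.

Lemma dotvDl u v w : dotv (u + v) w = dotv u w + dotv v w.
Proof. by rewrite /dotv -big_split; apply: eq_bigr => i _; rewrite mxE mulrDl. Qed.

Lemma dotvZl k u v : dotv (k *: u) v = k * dotv u v.
Proof. by rewrite /dotv mulr_sumr; apply: eq_bigr => i _; rewrite mxE mulrA. Qed.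

Lemma dotvNl u v : dotv (- u) v = - dotv u v.
Proof. by rewrite -scaleN1r dotvZl mulN1r. Qed.

Lemma dotvDr u v w : dotv u (v + w) = dotv u v + dotv u w.
Proof. by rewrite dotvC dotvDl !(dotvC _ u). Qed.

Lemma dotvZr k u v : dotv u (k *: v) = k * dotv u v.
Proof. by rewrite dotvC dotvZl dotvC. Qed.

Lemma dotvNr u v : dotv u (- v) = - dotv u v.
Proof. by rewrite dotvC dotvNl dotvC. Qed.

Lemma dot0v u : dotv 0 u = 0.
Proof. by rewrite -(scale0r u) dotvZl mul0r. Qed.

Lemma dotv0 u : dotv u 0 = 0.
Proof. by rewrite dotvC dot0v. Qed.

Definition dotvE := (dotvDl, dotvDr, dotvNl, dotvNr, dotvZl, dotvZr).

Lemma dotv_ge0 u : 0 <= dotv u u.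
Proof. by apply: sumr_ge0 => i _; rewrite -expr2 sqr_ge0. Qed.

Lemma dotv_eq0 u : dotv u u = 0 -> u = 0.
Proof.
move=> /eqP; rewrite psumr_eq0 => [/allP h|i _]; last by rewrite -expr2 sqr_ge0.
apply/rowP => i; have /(_ (mem_index_enum i)) /= := h i.
by rewrite mulf_eq0 orbb => /eqP ->; rewrite mxE.
Qed.

Lemma dotv_delta u i : dotv u (delta_mx 0 i) = u ord0 i.
Proof.
rewrite /dotv (bigD1 i)//= big1 => [|j ji]; rewrite !mxE !eqxx/= ?mulr1 ?addr0//.
by rewrite (negbTE ji) mulr0.
Qed.

Lemma normv_ge0 u : 0 <= normv u.
Proof. exact: sqrtr_ge0. Qed.

Lemma sqr_normv u : normv u ^+ 2 = dotv u u.
Proof. by rewrite sqr_sqrtr// dotv_ge0. Qed.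

Lemma normv0 : normv (0 : 'rV[R]_n) = 0.
Proof. by rewrite /normv dot0v sqrtr0. Qed.

Lemma normv_eq0 u : normv u = 0 -> u = 0.
Proof. by move=> u0; apply: dotv_eq0; rewrite -sqr_normv u0 expr0n. Qed.

Lemma normvN u : normv (- u) = normv u.
Proof. by rewrite /normv !dotvE opprK. Qed.

Lemma normvZ k u : normv (k *: u) = `|k| * normv u.
Proof.
by rewrite /normv !dotvE mulrA -expr2 sqrtrM ?sqr_ge0// sqrtr_sqr.
Qed.

Lemma normv_le u k : 0 <= k -> dotv u u <= k ^+ 2 -> normv u <= k.
Proof. by move=> k0 uk; rewrite -(@ler_pXn2r _ 2)// ?nnegrE ?normv_ge0// sqr_normv. Qed.

Lemma normv_ge u k : k ^+ 2 <= dotv u u -> k <= normv u.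
Proof.
move=> uk; case: (leP 0 k) => [k0|/ltW k0]; last exact: le_trans (normv_ge0 _).
by rewrite -(@ler_pXn2r _ 2)// ?nnegrE ?normv_ge0// sqr_normv.
Qed.

Lemma normv_unit u : normv u = 1 <-> dotv u u = 1.
Proof.
split=> [u1|u1]; first by rewrite -sqr_normv u1 expr1n.
by rewrite /normv u1 sqrtr1.
Qed.

(** The vector [<v, v> u - <u, v> v] has a nonnegative square norm. *)
Lemma dotv_sqr_le u v : dotv u v ^+ 2 <= dotv u u * dotv v v.
Proof.
have [v0|v0] := eqVneq (dotv v v) 0; first by rewrite (dotv_eq0 v0) !dotv0 expr0n mulr0.
have vp : 0 < dotv v v by rewrite lt_def v0 dotv_ge0.
have := dotv_ge0 (dotv v v *: u - dotv u v *: v).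
rewrite !dotvE (dotvC v u) => h.
have {}h : 0 <= dotv v v * (dotv u u * dotv v v - dotv u v ^+ 2).
  by apply: le_trans h _; rewrite le_eqVlt; apply/orP; left; apply/eqP; ring.
by rewrite pmulr_rge0// subr_ge0 in h.
Qed.

Lemma dotv_le u v : dotv u v <= normv u * normv v.
Proof.
rewrite /normv -sqrtrM ?dotv_ge0//.
apply: le_trans (ler_norm _) _; rewrite -sqrtr_sqr ler_sqrt; last first.
  by rewrite mulr_ge0 ?dotv_ge0.
exact: dotv_sqr_le.
Qed.

Lemma dotv_ge u v : - (normv u * normv v) <= dotv u v.
Proof. by rewrite lerNl -dotvNl (le_trans (dotv_le _ _))// normvN. Qed.

Lemma normv_triangle u v : normv (u + v) <= normv u + normv v.
Proof.
apply: normv_le; first by rewrite addr_ge0 ?normv_ge0.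
rewrite !dotvE (dotvC v u) -!sqr_normv.
by have := dotv_le u v; nra.
Qed.

Lemma normv_triangleB u v : normv (u - v) <= normv u + normv v.
Proof. by rewrite -(normvN v) normv_triangle. Qed.

Lemma normv_dist u v w : normv (u - w) <= normv (u - v) + normv (v - w).
Proof. by rewrite (le_trans _ (normv_triangle _ _))// addrA subrK. Qed.

Lemma normv_sub u v : normv u - normv v <= normv (u - v).
Proof. by rewrite lerBlDr (le_trans _ (normv_triangle _ _))// subrK. Qed.

Lemma normvC u v : normv (u - v) = normv (v - u).
Proof. by rewrite -normvN opprB. Qed.

Lemma normv_coord u i : `|u ord0 i| <= normv u.
Proof.
rewrite -sqrtr_sqr /normv ler_sqrt ?dotv_ge0//.
rewrite /dotv (bigD1 i)//= -expr2 lerDl sumr_ge0// => j _.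
by rewrite -expr2 sqr_ge0.
Qed.

Lemma dotvB_unit u v : dotv u u = 1 -> dotv v v = 1 ->
  dotv (u - v) (u - v) = 2 - 2 * dotv u v.
Proof. by move=> u1 v1; rewrite !dotvE (dotvC v u) u1 v1; ring. Qed.

Lemma dotv_unit_le1 u v : dotv u u = 1 -> dotv v v = 1 -> dotv u v <= 1.
Proof.
by move=> u1 v1; have := dotv_ge0 (u - v); rewrite dotvB_unit//; lra.
Qed.

Lemma dotv_unit_geN1 u v : dotv u u = 1 -> dotv v v = 1 -> -1 <= dotv u v.
Proof.
move=> u1 v1; rewrite lerNl -dotvNl dotv_unit_le1//.
by rewrite !dotvE opprK.
Qed.

Lemma dotv_unit_eq1 u v : dotv u u = 1 -> dotv v v = 1 -> 1 <= dotv u v -> u = v.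
Proof.
move=> u1 v1 uv; apply/eqP; rewrite -subr_eq0; apply/eqP/dotv_eq0/eqP.
by rewrite eq_le dotv_ge0 dotvB_unit//; lra.
Qed.

(** Locked so that rewriting with [dotvZl] does not look inside. *)
Definition dirv u : 'rV[R]_n := locked ((normv u)^-1 *: u).

Lemma dirvE u : dirv u = (normv u)^-1 *: u.
Proof. by rewrite /dirv -lock. Qed.

Lemma dirv_unit u : u != 0 -> dotv (dirv u) (dirv u) = 1.
Proof.
move=> u0; have nu0 : normv u != 0 by apply: contra_neq u0; exact: normv_eq0.
by rewrite !dirvE !dotvE -sqr_normv; field.
Qed.

Lemma normv_dirv u : normv u *: dirv u = u.
Proof.
have [u0|u0] := eqVneq (normv u) 0; first by rewrite u0 (normv_eq0 u0) scale0r.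
by rewrite dirvE scalerA divff ?scale1r.
Qed.

End EuclideanAlgebra.

(** * Primitives and comparison of derivatives *)

Section Calculus.
Context {R : realType}.
Implicit Types (f g F : R -> R) (a b : R).

Lemma contD f g : continuous f -> continuous g -> continuous (fun x => f x + g x).
Proof. by move=> cf cg x; apply: continuousD; [exact: cf|exact: cg]. Qed.

Lemma contB f g : continuous f -> continuous g -> continuous (fun x => f x - g x).
Proof. by move=> cf cg x; apply: continuousB; [exact: cf|exact: cg]. Qed.

Lemma contM f g : continuous f -> continuous g -> continuous (fun x => f x * g x).
Proof. by move=> cf cg x; apply: continuousM; [exact: cf|exact: cg]. Qed.

Lemma contZ k f : continuous f -> continuous (fun x => k * f x).
Proof. by move=> cf; apply: contM => // x; exact: cst_continuous. Qed.

Lemma derD f g (x df dg : R) : is_derive x 1 f df -> is_derive x 1 g dg ->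
  is_derive x 1 (fun y => f y + g y) (df + dg).
Proof. by move=> ? ?; exact: is_deriveD. Qed.

Lemma derN f (x df : R) : is_derive x 1 f df -> is_derive x 1 (fun y => - f y) (- df).
Proof. by move=> ?; exact: is_deriveN. Qed.

Lemma derB f g (x df dg : R) : is_derive x 1 f df -> is_derive x 1 g dg ->
  is_derive x 1 (fun y => f y - g y) (df - dg).
Proof. by move=> ? ?; exact: is_deriveB. Qed.

Lemma derM f g (x df dg : R) : is_derive x 1 f df -> is_derive x 1 g dg ->
  is_derive x 1 (fun y => f y * g y) (f x * dg + g x * df).
Proof. by move=> ? ?; exact: is_deriveM. Qed.

Lemma der_cst (k x : R) : is_derive x 1 (fun=> k) 0.
Proof. exact: is_derive_cst. Qed.

Lemma der_id (x : R) : is_derive x 1 (fun y => y) 1.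
Proof. exact: is_derive_id. Qed.

Lemma derZ k f (x df : R) : is_derive x 1 f df ->
  is_derive x 1 (fun y => k * f y) (k * df).
Proof. by move=> ?; exact: is_deriveZ. Qed.

Lemma der_comp f g (x df dg : R) : is_derive (g x) 1 f df -> is_derive x 1 g dg ->
  is_derive x 1 (fun y => f (g y)) (df * dg).
Proof. by move=> ? ?; exact: is_derive1_comp. Qed.

Lemma der_eq f (x df df' : R) : is_derive x 1 f df -> df = df' -> is_derive x 1 f df'.
Proof. by move=> ? <-. Qed.

Lemma derive_nondecreasing F f a b : a <= b ->
  (forall x : R, a <= x <= b -> is_derive x 1 F (f x)) ->
  (forall x, a <= x <= b -> 0 <= f x) -> F a <= F b.
Proof.
move=> ab Ff f0.
have cF : {within `[a, b], continuous F}.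
  apply: derivable_within_continuous => x; rewrite in_itv/= => xab.
  exact: (@ex_derive _ _ _ _ _ _ _ (Ff x xab)).
have dF (x : R) : x \in `]a, b[%R -> is_derive x 1 F (f x).
  by rewrite in_itv/= => /andP[ax xb]; apply: Ff; rewrite !ltW.
have [c] := MVT_segment ab dF cF.
rewrite in_itv/= => cab FE; rewrite -subr_ge0 FE mulr_ge0// ?subr_ge0//.
exact: f0.
Qed.

Lemma derive0_const F a b : a <= b ->
  (forall x : R, a <= x <= b -> is_derive x 1 F 0) -> F a = F b.
Proof.
move=> ab Ff; apply/eqP; rewrite eq_le; apply/andP; split.
  exact: (@derive_nondecreasing F (fun=> 0) a b ab Ff).
rewrite -lerN2.
apply: (@derive_nondecreasing (fun x => - F x) (fun=> 0) a b ab) => // x xab.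
by apply: (der_eq (derN (Ff x xab))); rewrite oppr0.
Qed.

Lemma is_derive_continuous F f :
  (forall x : R, is_derive x 1 F (f x)) -> continuous F.
Proof.
move=> Ff x; apply/differentiable_continuous/derivable1_diffP.
exact: (@ex_derive _ _ _ _ _ _ _ (Ff x)).
Qed.

Lemma continuous_integrable_itv f a b : continuous f ->
  lebesgue_measure.-integrable `[a, b] (EFin \o f).
Proof.
move=> cf; apply: continuous_compact_integrable; first exact: segment_compact.
exact: continuous_subspaceT.
Qed.

Lemma exists_primitive_gtN1 f : continuous f ->
  exists F, forall x : R, -1 < x -> is_derive x 1 F (f x).
Proof.
move=> cf.
pose F (x : R) := (\int[lebesgue_measure]_(t in [set` `[(-1)%R, x]]) f t)%R.
exists F => x x1.
have xx1 : x < x + 1 by rewrite ltrDl.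
have /= := continuous_FTC1_closed xx1 (continuous_integrable_itv _ _ cf) x1 (cf x).
rewrite -/F derive1E; clearbody F => -[d1 d2].
exact: (DeriveDef d1 d2).
Qed.

(** An integral with a fixed left bound is a primitive to the right of that bound only;
    the primitives of [f t] and of [f (- t)] based at [-1] are glued at [0]. *)
Lemma exists_primitive f : continuous f ->
  exists F, forall x : R, is_derive x 1 F (f x).
Proof.
move=> cf; have [G dG] := exists_primitive_gtN1 cf.
have cfN : continuous (fun x => f (- x)).
  by move=> x; apply: continuous_comp; [exact: opp_continuous|exact: cf].
have [K dK] := exists_primitive_gtN1 cfN.
pose G0 x := G x - G 0; pose K0 x := K 0 - K (- x).
have dG0 (x : R) : -1 < x -> is_derive x 1 G0 (f x).
  by move=> x1; apply: (der_eq (derB (dG _ x1) (der_cst _ _))); rewrite subr0.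
have dK0 (x : R) : x < 1 -> is_derive x 1 K0 (f x).
  move=> x1; have x1' : -1 < - x by rewrite ltrN2.
  have h := der_comp (dK _ x1') (derN (der_id x)).
  by apply: (der_eq (derB (der_cst _ x) h)); rewrite opprK mulrN1 sub0r opprK.
have GK (x : R) : -1 < x < 1 -> G0 x = K0 x.
  move=> /andP[x1 x2].
  have mvt a b : a <= b -> -1 < a -> b < 1 -> G0 a - K0 a = G0 b - K0 b.
    move=> ab a1 b1.
    apply: (@derive0_const (fun y => G0 y - K0 y) _ _ ab) => y /andP[ay yb].
    apply: (der_eq (derB (dG0 y (lt_le_trans a1 ay)) (dK0 y (le_lt_trans yb b1)))).
    by rewrite subrr.
  apply/eqP; rewrite -subr_eq0; apply/eqP.
  have -> : 0 = G0 0 - K0 0 by rewrite /G0 /K0 oppr0 !subrr.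
  have [x0|/ltW x0] := leP x 0; [apply: mvt|apply/esym/mvt]; lra.
exists (fun x => if 0 < x then G0 x else K0 x) => x.
have [x0|x0] := ltP (-1) x; last first.
- have xlt : x < 0 by lra.
  apply: (@near_eq_is_derive _ _ _ K0); rewrite ?oner_eq0//; last first.
    by apply: dK0; rewrite (lt_trans xlt).
  by near=> y; rewrite ifF//; apply/negbTE; rewrite -leNgt ltW//; near: y; exact: lt_nbhsl.
- apply: (@near_eq_is_derive _ _ _ G0); rewrite ?oner_eq0//; last exact: dG0.
  near=> y; case: ltP => // y0; rewrite GK//; apply/andP; split.
    by near: y; exact: lt_nbhsr.
  by rewrite (le_lt_trans y0).
Unshelve. all: by end_near. Qed.

Definition primitive f : R -> R :=
  xget (fun=> 0) [set F | forall x : R, is_derive x 1 F (f x)].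

Lemma primitiveP f : continuous f -> forall x : R, is_derive x 1 (primitive f) (f x).
Proof.
move=> /exists_primitive [F dF]; rewrite /primitive.
have /(@xgetPex _ (fun=> 0)) : exists F, [set F | forall x : R, is_derive x 1 F (f x)] F by exists F.
exact.
Qed.

(** The oriented integral; unlike the Lebesgue integral over an interval, it is
    additive in its bounds without any condition on their order. *)
Definition integ f a b : R := primitive f b - primitive f a.

Lemma integ_split f a b c : integ f a c = integ f a b + integ f b c.
Proof. by rewrite /integ; ring. Qed.

Lemma integxx f a : integ f a a = 0.
Proof. exact: subrr. Qed.

Lemma integE F f a b : a <= b -> continuous f ->
  (forall x : R, a <= x <= b -> is_derive x 1 F (f x)) -> integ f a b = F b - F a.
Proof.
move=> ab cf Ff.
have := @derive0_const (fun x => primitive f x - F x) a b ab.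
have /[swap]/[apply] : forall x : R, a <= x <= b ->
    is_derive x 1 (fun x => primitive f x - F x) 0.
  by move=> x xab; apply: (der_eq (derB (primitiveP cf x) (Ff x xab))); rewrite subrr.
by rewrite /integ; lra.
Qed.

Lemma integ_le f g a b : a <= b -> continuous f -> continuous g ->
  (forall x, a <= x <= b -> f x <= g x) -> integ f a b <= integ g a b.
Proof.
move=> ab cf cg fg.
have := @derive_nondecreasing (fun x => primitive g x - primitive f x)
  (fun x => g x - f x) a b ab.
have /[swap]/[apply] : forall x : R, a <= x <= b ->
    is_derive x 1 (fun x => primitive g x - primitive f x) (g x - f x).
  by move=> x xab; exact: derB (primitiveP cg x) (primitiveP cf x).
have /[swap]/[apply] : forall x, a <= x <= b -> 0 <= g x - f x.
  by move=> x xab; rewrite subr_ge0; exact: fg.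
by rewrite /integ; lra.
Qed.

Lemma eq_integ f g a b : a <= b -> continuous f -> continuous g ->
  (forall x, a <= x <= b -> f x = g x) -> integ f a b = integ g a b.
Proof.
move=> ab cf cg fg; apply/eqP; rewrite eq_le !integ_le// => x /fg ->//.
Qed.

Lemma integ_cst k a b : integ (fun=> k) a b = k * (b - a).
Proof.
have h a' b' : a' <= b' -> integ (fun=> k) a' b' = k * (b' - a').
  move=> ab; rewrite mulrBr; apply: (integE ab); first exact: cst_continuous.
  by move=> x _; apply: (der_eq (derZ k (der_id x))); rewrite mulr1.
have [/h//|/ltW/h] := leP a b.
by rewrite /integ; lra.
Qed.

Lemma integD f g a b : a <= b -> continuous f -> continuous g ->
  integ (fun x => f x + g x) a b = integ f a b + integ g a b.
Proof.
move=> ab cf cg.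
have -> : integ f a b + integ g a b =
    primitive f b + primitive g b - (primitive f a + primitive g a).
  by rewrite /integ; ring.
apply: (@integE (fun x => primitive f x + primitive g x) _ _ _ ab).
- by move=> x; apply: continuousD; [exact: cf|exact: cg].
- by move=> x _; exact: derD (primitiveP cf x) (primitiveP cg x).
Qed.

Lemma integZ k f a b : a <= b -> continuous f ->
  integ (fun x => k * f x) a b = k * integ f a b.
Proof.
move=> ab cf; rewrite mulrBr; apply: (@integE (fun x => k * primitive f x) _ _ _ ab).
- by move=> x; apply: continuousM; [exact: cst_continuous|exact: cf].
- by move=> x _; exact: (derZ k (primitiveP cf x)).
Qed.

Lemma integB f g a b : a <= b -> continuous f -> continuous g ->
  integ (fun x => f x - g x) a b = integ f a b - integ g a b.
Proof.
move=> ab cf cg.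
have -> : integ f a b - integ g a b =
    primitive f b - primitive g b - (primitive f a - primitive g a).
  by rewrite /integ; ring.
apply: (@integE (fun x => primitive f x - primitive g x) _ _ _ ab).
- by move=> x; apply: continuousB; [exact: cf|exact: cg].
- by move=> x _; exact: derB (primitiveP cf x) (primitiveP cg x).
Qed.

Lemma integ_ge0 f a b : a <= b -> continuous f ->
  (forall x, a <= x <= b -> 0 <= f x) -> 0 <= integ f a b.
Proof.
move=> ab cf f0; have := integ_le ab (@cst_continuous _ _ 0) cf f0.
by rewrite integ_cst mul0r.
Qed.

Lemma integ_eq0 f a b : a <= b -> continuous f ->
  (forall x, a <= x <= b -> 0 <= f x) -> integ f a b <= 0 ->
  forall x, a < x < b -> f x = 0.
Proof.
move=> ab cf f0 I0 x /andP[ax xb].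
have Fconst y : a <= y <= b -> primitive f y = primitive f a.
  move=> /andP[ay yb].
  have : 0 <= integ f a y.
    by apply: integ_ge0 => // z /andP[az zy]; apply: f0; rewrite az (le_trans zy).
  have : 0 <= integ f y b.
    by apply: integ_ge0 => // z /andP[az zy]; apply: f0; rewrite zy (le_trans ay).
  by move: I0; rewrite /integ; lra.
have h0 : is_derive x 1 (primitive f) 0.
  apply: (@near_eq_is_derive _ _ _ (fun=> primitive f a) _ x 1 0 _ (der_cst _ _)).
  near=> y; rewrite Fconst//; apply/andP; split; apply: ltW; near: y.
    exact: lt_nbhsr.
  exact: lt_nbhsl.
have := primitiveP cf x => h1.
by rewrite -(@derive_val _ _ _ _ _ _ _ h1) (@derive_val _ _ _ _ _ _ _ h0).
Unshelve. all: by end_near. Qed.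

Lemma lipschitz_continuous f k : (forall x y, `|f x - f y| <= k * `|x - y|) ->
  continuous f.
Proof.
move=> fk x; apply/cvgrPdist_lt => e e0; near=> y.
have k0 : 0 < `|k| + 1 by rewrite ltr_wpDl.
apply: le_lt_trans (fk _ _) _.
apply: (@le_lt_trans _ _ ((`|k| + 1) * `|x - y|)).
  by rewrite ler_wpM2r// (le_trans (ler_norm k))// lerDl.
rewrite -ltr_pdivlMl// mulrC; near: y.
apply: (@cvgr_dist_lt _ _ _ _ _ id x) => //; last by rewrite divr_gt0.
Unshelve. all: by end_near. Qed.

(** * Elementary trigonometric inequalities *)

Lemma sin_le_id (x : R) : 0 <= x -> sin x <= x.
Proof.
move=> x0.
have d (y : R) : 0 <= y <= x -> is_derive y 1 (fun y => y - sin y) (1 - cos y).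
  by move=> _; exact: (derB (der_id y) (is_derive_sin y)).
have := derive_nondecreasing x0 d; rewrite sin0 subrr subr_ge0; apply => y _.
by rewrite subr_ge0 cos_le1.
Qed.

Lemma norm_sin_le (x : R) : `|sin x| <= `|x|.
Proof.
wlog x0 : x / 0 <= x.
  move=> h; have [/h//|/ltW x0] := leP 0 x.
  by rewrite -normrN -sinN -(normrN x) h// oppr_ge0.
rewrite (ger0_norm x0) ler_norml (sin_le_id x0) andbT.
have [x1|/ltW x1] := leP x pi; last by have := sin_geN1 x; have := @pi_ge2 R; lra.
by have := @sin_ge0_pi _ x; rewrite x0 x1 => /(_ isT); lra.
Qed.

Lemma cos_half (x : R) : cos x = 1 - 2 * sin (x / 2) ^+ 2.
Proof.
have -> : x = x / 2 + x / 2 by field.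
by rewrite cosD -!expr2 cos2sin2 -splitr; ring.
Qed.

Lemma cos_ge_quad (x : R) : 1 - x ^+ 2 / 2 <= cos x.
Proof.
rewrite cos_half.
have : sin (x / 2) ^+ 2 <= (x / 2) ^+ 2.
  by rewrite -[leLHS]real_normK ?num_real// -[leRHS]real_normK ?num_real// lerXn2r ?nnegrE ?norm_sin_le.
by lra.
Qed.

Lemma cos_lip (x y : R) : `|cos x - cos y| <= `|x - y|.
Proof.
have -> : cos x - cos y = - 2 * (sin ((x + y) / 2) * sin ((x - y) / 2)).
  have -> : cos x = cos ((x + y) / 2 + (x - y) / 2) by congr cos; field.
  have -> : cos y = cos ((x + y) / 2 - (x - y) / 2) by congr cos; field.
  by rewrite cosD cosB; ring.
have h1 := norm_sin_le ((x - y) / 2); have h2 := sin_max ((x + y) / 2).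
rewrite !normrM normrN (ger0_norm (ler0n _ 2)).
have h3 : `|(x - y) / 2| = `|x - y| / 2 by rewrite normrM [X in _ * X]ger0_norm.
rewrite h3 in h1.
have := normr_ge0 (sin ((x - y) / 2)); have := normr_ge0 (sin ((x + y) / 2)).
by nra.
Qed.

Lemma sin_lip (x y : R) : `|sin x - sin y| <= `|x - y|.
Proof.
have sE z : sin z = cos (z - pi / 2) by rewrite cosBpihalf.
by rewrite !sE (le_trans (cos_lip _ _))// opprB addrA subrK.
Qed.

Lemma sin_ge_cubic (x : R) : 0 <= x <= pi -> x - x ^+ 3 / 2 <= sin x.
Proof.
move=> /andP[x0 xpi].
have d (y : R) : 0 <= y <= x ->
    is_derive y 1 (fun y => sin y - y * cos y) (y * sin y).
  move=> _; apply: (der_eq (derB (is_derive_sin y) (derM (der_id y) (is_derive_cos y)))).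
  by ring.
have h : x * cos x <= sin x.
  have := derive_nondecreasing x0 d; rewrite sin0 mul0r subrr subr_ge0; apply.
  by move=> y /andP[y0 yx]; rewrite mulr_ge0// sin_ge0_pi// y0 (le_trans yx).
have := cos_ge_quad x; nra.
Qed.

Lemma sin_ge_quarter (x : R) : 0 <= x <= pi / 2 -> x / 4 <= sin x.
Proof.
move=> /andP[x0 x1]; have pi2 := @pihalf_lt2 R; have pi1 := @pihalf_ge1 R.
have [xl1|x1l] := leP x 1.
  have := @sin_ge_cubic x; rewrite x0/= => /(_ ltac:(lra)) h.
  have : x ^+ 3 <= x by rewrite -[leRHS]expr1 ler_wiXn2l// x0.
  by lra.
have := @sin_ge_cubic 1; rewrite ler01 expr1n => /(_ ltac:(lra)) h.
have : sin 1 <= sin x.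
  have [->//|/negP/eqP x1'] := eqVneq x 1.
  apply: ltW; rewrite ltr_sin// in_itv/=; lra.
by lra.
Qed.

Lemma cos_le_mono (x y : R) : 0 <= x -> x <= y -> y <= pi -> cos y <= cos x.
Proof.
move=> x0 xy yp; have [->//|nxy] := eqVneq x y.
by apply: ltW; rewrite ltr_cos ?in_itv/= ?x0 ?yp ?andbT ?(le_trans x0)// ?(le_trans xy)// lt_neqAle nxy.
Qed.

End Calculus.

(** * Curves of bounded curvature *)

Section VectorCurves.
Context {R : realType} {n : nat}.
Implicit Types (gamma q p : R -> 'rV[R]_n) (u v w : 'rV[R]_n) (Lam : R -> R).

Definition coord_continuous_fun q := forall i, continuous (fun s => q s ord0 i).

Lemma coord_continuous_cst u : coord_continuous_fun (fun=> u).
Proof. by move=> i; exact: cst_continuous. Qed.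

Lemma coord_continuousD q p : coord_continuous_fun q -> coord_continuous_fun p ->
  coord_continuous_fun (fun s => q s + p s).
Proof.
move=> cq cp i; under eq_fun do rewrite mxE.
by move=> s; apply: continuousD; [exact: cq|exact: cp].
Qed.

Lemma coord_continuousZ (f : R -> R) q : continuous f -> coord_continuous_fun q ->
  coord_continuous_fun (fun s => f s *: q s).
Proof.
move=> cf cq i; under eq_fun do rewrite mxE.
by move=> s; apply: continuousM; [exact: cf|exact: cq].
Qed.

Lemma continuous_sum I (r : seq I) (F : I -> R -> R) : (forall i, continuous (F i)) ->
  continuous (fun s => \sum_(i <- r) F i s).
Proof.
move=> cF; elim: r => [|i r IH].
  by under eq_fun do rewrite big_nil; exact: cst_continuous.
under eq_fun do rewrite big_cons.
by move=> s; apply: continuousD; [exact: cF|exact: IH].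
Qed.

Lemma continuous_dotv q p : coord_continuous_fun q -> coord_continuous_fun p ->
  continuous (fun s => dotv (q s) (p s)).
Proof.
move=> cq cp; apply: (@continuous_sum _ _ (fun i s => q s ord0 i * p s ord0 i)) => i s.
by apply: continuousM; [exact: cq|exact: cp].
Qed.

Lemma continuous_normv q : coord_continuous_fun q -> continuous (fun s => normv (q s)).
Proof.
move=> cq s; apply: (@continuous_comp _ _ _ (fun s => dotv (q s) (q s)) Num.sqrt).
  exact: continuous_dotv.
exact: sqrt_continuous.
Qed.

Lemma lipschitz_coord_continuous q k :
  (forall s t, normv (q s - q t) <= k * `|s - t|) -> coord_continuous_fun q.
Proof.
move=> qk i; apply: (@lipschitz_continuous _ _ k) => s t.
by apply: le_trans (qk s t); have := normv_coord (q s - q t) i; rewrite !mxE.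
Qed.

(** Differentiability tested against constant vectors: enough to compare
    displacements, and insensitive to the topology put on row vectors. *)
Definition has_velocity gamma q := forall u (s : R),
  is_derive s 1 (fun x => dotv (gamma x) u) (dotv (q s) u).

Lemma has_velocity_continuous gamma q : has_velocity gamma q ->
  coord_continuous_fun gamma.
Proof.
move=> gq i.
have := is_derive_continuous (gq (delta_mx 0 i)).
by under eq_fun do rewrite dotv_delta.
Qed.

(** The spherical triangle inequality: the components of [u] and [w] orthogonal to [v]
    have norms the sines of the two angles, which bounds their inner product below. *)
Lemma spherical_triangle u v w (a b : R) :
  dotv u u = 1 -> dotv v v = 1 -> dotv w w = 1 ->
  0 <= a -> 0 <= b -> a + b <= pi ->
  cos a <= dotv u v -> cos b <= dotv v w -> cos (a + b) <= dotv u w.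
Proof.
move=> u1 v1 w1 a0 b0 abpi ax by_.
set x := dotv u v in ax; set y := dotv v w in by_.
have hx : -1 <= x <= 1 by rewrite dotv_unit_geN1// dotv_unit_le1.
have hy : -1 <= y <= 1 by rewrite dotv_unit_geN1// dotv_unit_le1.
have acos_le (c z : R) : -1 <= z <= 1 -> 0 <= c -> c <= pi -> cos c <= z -> acos z <= c.
  move=> hz c0 cpi; apply: contraTT; rewrite -!ltNge => cz.
  rewrite -[z](@acosK R) ?in_itv//= ltr_cos ?in_itv//= ?c0 ?cpi ?acos_ge0 ?acos_lepi//.
have hax : acos x <= a by apply: acos_le => //; lra.
have hby : acos y <= b by apply: acos_le => //; lra.
have norm_perp (s : 'rV[R]_n) z : dotv s s = 1 -> dotv s v = z -> -1 <= z <= 1 ->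
    normv (s - z *: v) = sin (acos z).
  move=> s1 sv hz; rewrite sin_acos// /normv !dotvE (dotvC v s) s1 sv v1.
  by congr Num.sqrt; ring.
have nu : normv (u - x *: v) = sin (acos x) by exact: norm_perp.
have nw : normv (w - y *: v) = sin (acos y) by apply: norm_perp => //; rewrite dotvC.
have := dotv_ge (u - x *: v) (w - y *: v); rewrite nu nw.
rewrite !dotvE v1 -/x -/y => h; apply: (@le_trans _ _ (cos (acos x + acos y))).
  by apply: cos_le_mono; rewrite ?addr_ge0 ?acos_ge0// lerD.
rewrite cosD !acosK ?in_itv//=; lra.
Qed.

(** [curvature_le q Lam r a b]: along [a, b], the direction of [q] turns by at most
    the angle [(Lam t - Lam s) / r] between [s] and [t]; when [Lam] is arclength and
    [q] a velocity, this says that the curvature is at most [1 / r]. *)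
Definition curvature_le q Lam (r a b : R) := forall s t, a <= s -> s <= t -> t <= b ->
  Lam t - Lam s <= pi * r ->
  cos ((Lam t - Lam s) / r) <= dotv (dirv (q s)) (dirv (q t)).

Lemma curvature_le_sub q Lam (r a b a' b' : R) : a <= a' -> b' <= b ->
  curvature_le q Lam r a b -> curvature_le q Lam r a' b'.
Proof. by move=> aa bb h s t s1 st t1; apply: h => //; lra. Qed.

Lemma curvature_le_cat q Lam (r a b c : R) : 0 < r ->
  (forall s, q s != 0) -> {homo Lam : x y / x <= y} -> a <= b -> b <= c ->
  curvature_le q Lam r a b -> curvature_le q Lam r b c -> curvature_le q Lam r a c.
Proof.
move=> r0 q0 hL ab bc h1 h2 s t as_ st tc l.
have [tb|/ltW bt] := leP t b; first exact: h1.
have [bs|/ltW sb] := leP b s; first exact: h2.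
have l1 := hL _ _ sb; have l2 := hL _ _ bt.
have -> : (Lam t - Lam s) / r = (Lam b - Lam s) / r + (Lam t - Lam b) / r.
  by rewrite -mulrDl; congr (_ / _); ring.
apply: (@spherical_triangle _ (dirv (q b))); rewrite ?dirv_unit//.
- by rewrite divr_ge0 ?subr_ge0// ltW.
- by rewrite divr_ge0 ?subr_ge0// ltW.
- by rewrite -mulrDl ler_pdivrMr//; lra.
- by apply: h1 => //; lra.
- by apply: h2 => //; lra.
Qed.

(** The right-hand side is the cosine of the angle spanned by a chord of length [x] of the
    unit circle; this angle exceeds [x] to third order only. *)
Lemma cos_le_chord (d x : R) : 0 < d -> 0 <= x -> (1 + d) * x <= d -> d <= 1 ->
  cos ((1 + d) * x) <= 1 - x ^+ 2 / 2.
Proof.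
move=> d0 x0 xd d1; rewrite cos_half.
set y := (1 + d) * x / 2.
have y0 : 0 <= y by rewrite /y divr_ge0// mulr_ge0//; lra.
have yd : y <= d / 2 by rewrite /y; lra.
have hs : x / 2 <= sin y.
  have hy : 0 <= y <= pi by rewrite y0/=; have := @pi_ge2 R; lra.
  apply: le_trans (sin_ge_cubic hy).
  have -> : x / 2 = y / (1 + d) by rewrite /y; field; lra.
  rewrite ler_pdivrMr; last lra.
  have : y ^+ 2 <= d / 4 * d by rewrite expr2; nra.
  rewrite [y ^+ 3]exprS; set z := y ^+ 2 => hz.
  have z0 : 0 <= z by rewrite sqr_ge0.
  have : y * (z * (1 + d)) <= y * (2 * d) by rewrite ler_wpM2l//; nra.
  by lra.
have : (x / 2) ^+ 2 <= sin y ^+ 2 by rewrite lerXn2r// nnegrE; lra.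
by lra.
Qed.

(** An infinitesimal bound on chords of the direction integrates to a bound on
    angles: subdivide, replace chords by angles, and add them up on the sphere. *)
Lemma curvature_le_local q Lam (r a b M : R) : 0 < r ->
  (forall s, q s != 0) -> {homo Lam : x y / x <= y} ->
  (forall s t, a <= s -> s <= t -> t <= b -> Lam t - Lam s <= M * (t - s)) ->
  (forall d, 0 < d -> exists2 eta, 0 < eta & forall s t, a <= s -> s <= t -> t <= b ->
     t - s < eta -> normv (dirv (q s) - dirv (q t)) <= (1 + d) * ((Lam t - Lam s) / r)) ->
  curvature_le q Lam r a b.
Proof.
move=> r0 q0 hL hM hloc.
have approx d : 0 < d -> d <= 1 -> forall s t, a <= s -> s <= t -> t <= b ->
    (1 + d) ^+ 2 * ((Lam t - Lam s) / r) <= pi ->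
    cos ((1 + d) ^+ 2 * ((Lam t - Lam s) / r)) <= dotv (dirv (q s)) (dirv (q t)).
  move=> d0 d1; have [eta eta0 heta] := hloc d d0.
  pose mu := Num.min eta (d * r / (4 * (`|M| + 1))).
  have M0 : 0 < `|M| + 1 by rewrite ltr_wpDl.
  have mu0 : 0 < mu by rewrite lt_min eta0/= divr_gt0 ?mulr_gt0.
  have small s t : a <= s -> s <= t -> t <= b -> t - s < mu ->
      cos ((1 + d) ^+ 2 * ((Lam t - Lam s) / r)) <= dotv (dirv (q s)) (dirv (q t)).
    move=> as_ st tb; rewrite lt_min => /andP[ts1 ts2].
    have := heta _ _ as_ st tb ts1.
    set l := (Lam t - Lam s) / r => hc.
    have l0 : 0 <= l by rewrite /l divr_ge0 ?subr_ge0 ?hL// ltW.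
    have ld : l <= d / 4.
      rewrite /l ler_pdivrMr//; apply: le_trans (hM _ _ as_ st tb) _.
      apply: (@le_trans _ _ ((`|M| + 1) * (t - s))).
        by rewrite ler_wpM2r ?subr_ge0// (le_trans (ler_norm M))// lerDl.
      move: ts2; rewrite ltr_pdivlMr ?mulr_gt0// => /ltW ts2.
      by lra.
    apply: (@le_trans _ _ (1 - ((1 + d) * l) ^+ 2 / 2)).
      rewrite expr2 -mulrA; apply: cos_le_chord => //; first by rewrite mulr_ge0//; lra.
      by nra.
    have := dotvB_unit (dirv_unit (q0 s)) (dirv_unit (q0 t)); rewrite -sqr_normv.
    have : normv (dirv (q s) - dirv (q t)) ^+ 2 <= ((1 + d) * l) ^+ 2.
      by rewrite lerXn2r ?nnegrE ?normv_ge0// mulr_ge0//; lra.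
    by lra.
  have part N s t : a <= s -> s <= t -> t <= b -> t - s < N.+1%:R * mu ->
      (1 + d) ^+ 2 * ((Lam t - Lam s) / r) <= pi ->
      cos ((1 + d) ^+ 2 * ((Lam t - Lam s) / r)) <= dotv (dirv (q s)) (dirv (q t)).
    elim: N s t => [|N IH] s t as_ st tb; first by rewrite mul1r => ? _; exact: small.
    move=> tsN lpi; pose m := t - (t - s) / N.+2%:R.
    have N0 : (0 : R) < N.+2%:R by rewrite ltr0n.
    have Ninv : (N.+2%:R : R)^-1 <= 1 by rewrite invf_le1// ler1n.
    have Ninv0 : 0 <= (N.+2%:R : R)^-1 by rewrite invr_ge0 ltW.
    have D1 : (t - s) / N.+2%:R <= t - s by rewrite ler_piMr// subr_ge0.
    have D0 : 0 <= (t - s) / N.+2%:R by rewrite mulr_ge0// subr_ge0.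
    have ms : s <= m by move: D1; rewrite /m; set z := _ / _; lra.
    have mt : m <= t by move: D0; rewrite /m; set z := _ / _; lra.
    have tm : t - m < mu.
      have -> : t - m = (t - s) / N.+2%:R by rewrite /m; ring.
      by rewrite ltr_pdivrMr// mulrC.
    have sm : m - s < N.+1%:R * mu.
      have -> : m - s = (t - s) / N.+2%:R * N.+1%:R.
        move: N0; rewrite /m -(natr1 N.+1); set K : R := N.+1%:R => /lt0r_neq0 K0.
        by field.
      by rewrite mulrC ltr_pM2l ?ltr0n// ltr_pdivrMr// mulrC.
    have l1 := hL _ _ ms; have l2 := hL _ _ mt.
    have d2 : 0 <= (1 + d) ^+ 2 by rewrite sqr_ge0.
    have e : (1 + d) ^+ 2 * ((Lam t - Lam s) / r) =
      (1 + d) ^+ 2 * ((Lam m - Lam s) / r) + (1 + d) ^+ 2 * ((Lam t - Lam m) / r).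
      by rewrite -mulrDr -mulrDl; congr (_ * (_ / _)); ring.
    have h1 : 0 <= (1 + d) ^+ 2 * ((Lam m - Lam s) / r).
      by rewrite mulr_ge0// divr_ge0 ?subr_ge0// ltW.
    have h2 : 0 <= (1 + d) ^+ 2 * ((Lam t - Lam m) / r).
      by rewrite mulr_ge0// divr_ge0 ?subr_ge0// ltW.
    rewrite e in lpi *.
    apply: (@spherical_triangle _ (dirv (q m))); rewrite ?dirv_unit//.
      by apply: IH => //; [exact: le_trans mt tb|lra].
    by apply: small => //; exact: le_trans as_ ms.
  move=> s t as_ st tb lpi.
  apply: (part `|Num.ceil ((t - s) / mu)|%N) => //.
  rewrite -ltr_pdivrMr//.
  have x0 : 0 <= (t - s) / mu by rewrite divr_ge0 ?subr_ge0// ltW.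
  rewrite -natr1 (le_lt_trans (ceil_ge _))// natr_absz ger0_norm ?ltrDl//.
  by rewrite -(ler_int R) (le_trans x0)// ceil_ge.
move=> s t as_ st tb lpi; set l := (Lam t - Lam s) / r.
have l0 : 0 <= l by rewrite /l divr_ge0 ?subr_ge0 ?hL// ltW.
have lp : l <= pi by rewrite /l ler_pdivrMr.
have pi0 := @pi_gt0 R.
have [le|] := eqVneq l pi.
  by rewrite le cospi dotv_unit_geN1// dirv_unit.
move=> nl; have {lp nl} lp : l < pi by rewrite lt_neqAle nl.
rewrite leNgt; apply/negP => hlt.
set c := dotv _ _ in hlt.
pose d := Num.min 1 (Num.min ((cos l - c) / (4 * pi)) ((pi - l) / (4 * pi))).
have d0 : 0 < d by rewrite !lt_min ltr01/= !divr_gt0 ?mulr_gt0 ?subr_gt0.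
have d1 : d <= 1 by rewrite ge_min lexx.
have d2 : d * (4 * pi) <= cos l - c by rewrite -ler_pdivlMr ?mulr_gt0// !ge_min lexx !orbT.
have d3 : d * (4 * pi) <= pi - l by rewrite -ler_pdivlMr ?mulr_gt0// !ge_min lexx !orbT.
have K : (1 + d) ^+ 2 * l - l <= d * (3 * pi).
  have -> : (1 + d) ^+ 2 * l - l = d * ((2 + d) * l) by ring.
  have : (2 + d) * l <= 3 * l by rewrite ler_wpM2r//; lra.
  by move=> h; rewrite ler_wpM2l ?(ltW d0)//; lra.
have K0 : 0 <= (1 + d) ^+ 2 * l - l.
  have -> : (1 + d) ^+ 2 * l - l = d * ((2 + d) * l) by ring.
  by rewrite mulr_ge0 ?(ltW d0)// mulr_ge0//; lra.
have dpi : 0 < d * pi by rewrite mulr_gt0.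
have := approx d d0 d1 s t as_ st tb; rewrite -/l -/c => /(_ ltac:(lra)).
have := cos_lip l ((1 + d) ^+ 2 * l).
rewrite (distrC l) (ger0_norm K0) ler_norml => /andP[_ h1] h2.
by lra.
Qed.

End VectorCurves.

Section ArcGeometry.
Context {R : realType} {n : nat}.
Implicit Types (gamma q : R -> 'rV[R]_n) (u v w z : 'rV[R]_n) (Lam : R -> R).

(** [Lam] is an arclength function of the regular curve [gamma] of velocity [q]. *)
Definition arc_curve gamma q Lam := [/\ has_velocity gamma q,
  forall s : R, is_derive s 1 Lam (normv (q s)) & forall s, q s != 0].

Lemma normv_gt0 u : u != 0 -> 0 < normv u.
Proof.
by move=> u0; rewrite lt_def normv_ge0 andbT; apply: contra_neq u0; exact: normv_eq0.
Qed.

Lemma arc_curve_homo gamma q Lam : arc_curve gamma q Lam -> {homo Lam : x y / x <= y}.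
Proof.
move=> [_ dL _] x y xy; apply: (derive_nondecreasing xy (fun s _ => dL s)) => s _.
exact: normv_ge0.
Qed.

Lemma arc_curve_continuous gamma q Lam : arc_curve gamma q Lam -> continuous Lam.
Proof. by move=> [_ dL _]; exact: is_derive_continuous dL. Qed.

Lemma arc_curve_rev gamma q Lam : arc_curve gamma q Lam ->
  arc_curve (fun s => gamma (- s)) (fun s => - q (- s)) (fun s => - Lam (- s)).
Proof.
move=> [gq dL q0]; split=> [u s|s|s].
- by apply: (der_eq (der_comp (gq u (- s)) (derN (der_id s)))); rewrite dotvNl; ring.
- apply: (der_eq (derN (der_comp (dL (- s)) (derN (der_id s))))).
  by rewrite normvN; ring.
- by rewrite oppr_eq0.
Qed.

Lemma dirvN u : dirv (- u) = - dirv u.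
Proof. by rewrite !dirvE normvN scalerN. Qed.

Lemma curvature_le_rev q Lam r a b : curvature_le q Lam r a b ->
  curvature_le (fun s => - q (- s)) (fun s => - Lam (- s)) r (- b) (- a).
Proof.
move=> h s t bs st ta /=; rewrite opprK (addrC _ (Lam (- s))) => l.
by rewrite !dirvN dotvNl dotvNr opprK dotvC; apply: h => //; lra.
Qed.

Lemma bessel2 u v w : dotv v v = 1 -> dotv w w = 1 -> dotv v w = 0 ->
  dotv u v ^+ 2 + dotv u w ^+ 2 <= dotv u u.
Proof.
move=> v1 w1 vw; rewrite -subr_ge0.
have := dotv_ge0 (u - dotv u v *: v - dotv u w *: w).
rewrite !dotvE (dotvC v u) (dotvC w u) (dotvC w v) v1 w1 vw => h.
by apply: le_trans h _; rewrite le_eqVlt; apply/orP; left; apply/eqP; ring.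
Qed.

Lemma dirv_dotv u v : dotv u v = normv u * dotv (dirv u) v.
Proof. by rewrite -dotvZl normv_dirv. Qed.

(** Schur's comparison: a curve of curvature at most [1 / r] advances in any of its
    tangent directions at least as much as the circle of radius [r]. *)
Lemma schur_right gamma q Lam r a b m t : 0 < r -> arc_curve gamma q Lam ->
  curvature_le q Lam r a b -> a <= m -> m <= t -> t <= b -> Lam t - Lam m <= pi * r ->
  r * sin ((Lam t - Lam m) / r) <= dotv (gamma t - gamma m) (dirv (q m)).
Proof.
move=> r0 arc cur am mt tb l; have hL := arc_curve_homo arc; case: arc => gq dL q0.
set u := dirv (q m).
have d (x : R) : m <= x <= t -> is_derive x 1
    (fun x => dotv (gamma x) u - r * sin ((Lam x - Lam m) / r))
    (normv (q x) * (dotv (dirv (q x)) u - cos ((Lam x - Lam m) / r))).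
  move=> _; have dL' := derM (derB (dL x) (der_cst (Lam m) x)) (der_cst r^-1 x).
  apply: (der_eq (derB (gq u x) (derZ r (der_comp (is_derive_sin _) dL')))).
  by rewrite /= (dirv_dotv (q x)); field; rewrite gt_eqF.
have := derive_nondecreasing mt d; rewrite subrr mul0r sin0 mulr0 subr0 dotvDl dotvNl.
have -> : forall A B C : R, (A <= B - C) = (C <= B - A) by move=> A B C; apply/idP/idP; lra.
apply=> x /andP[mx xt]; rewrite mulr_ge0 ?normv_ge0// subr_ge0 dotvC.
by apply: cur => //; have := hL _ _ xt; lra.
Qed.

Lemma schur_left gamma q Lam r a b s m : 0 < r -> arc_curve gamma q Lam ->
  curvature_le q Lam r a b -> a <= s -> s <= m -> m <= b -> Lam m - Lam s <= pi * r ->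
  r * sin ((Lam m - Lam s) / r) <= dotv (gamma m - gamma s) (dirv (q m)).
Proof.
move=> r0 /arc_curve_rev arc /curvature_le_rev cur as_ sm mb l.
have := @schur_right _ _ _ r (- b) (- a) (- m) (- s) r0 arc cur.
rewrite /= !opprK dirvN !lerN2 => /(_ mb sm as_).
rewrite (addrC _ (Lam m)) => /(_ l); congr (_ <= _).
by rewrite !dotvE; ring.
Qed.

Lemma schur_mid gamma q Lam r a b s t : 0 < r -> arc_curve gamma q Lam ->
  curvature_le q Lam r a b -> a <= s -> s <= t -> t <= b ->
  Lam t - Lam s <= 2 * (pi * r) ->
  exists2 m, s <= m <= t &
    2 * r * sin ((Lam t - Lam s) / (2 * r)) <= dotv (gamma t - gamma s) (dirv (q m)).
Proof.
move=> r0 arc cur as_ st tb l.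
have st' := arc_curve_homo arc st.
have : Num.min (Lam s) (Lam t) <= (Lam s + Lam t) / 2 <= Num.max (Lam s) (Lam t).
  by rewrite (min_idPl st') (max_idPr st'); apply/andP; split; lra.
have cL : {within `[s, t], continuous Lam}.
  exact/continuous_subspaceT/(arc_curve_continuous arc).
move=> /(IVT st cL)[m]; rewrite in_itv/= => /andP[sm mt] mE.
exists m; first by rewrite sm.
have h1 := @schur_right _ _ _ _ _ _ m t r0 arc cur (le_trans as_ sm) mt tb.
have h2 := @schur_left _ _ _ _ _ _ s m r0 arc cur as_ sm (le_trans mt tb).
rewrite mE in h1 h2.
have -> : gamma t - gamma s = (gamma t - gamma m) + (gamma m - gamma s) by rewrite addrA subrK.
have e1 : (Lam t - (Lam s + Lam t) / 2) / r = (Lam t - Lam s) / (2 * r) by field; rewrite gt_eqF.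
have e2 : ((Lam s + Lam t) / 2 - Lam s) / r = (Lam t - Lam s) / (2 * r) by field; rewrite gt_eqF.
rewrite e1 in h1; rewrite e2 in h2; rewrite dotvDl.
have := h1 ltac:(lra); have := h2 ltac:(lra); lra.
Qed.

Lemma schur_chord gamma q Lam r a b s t : 0 < r -> arc_curve gamma q Lam ->
  curvature_le q Lam r a b -> a <= s -> s <= t -> t <= b ->
  Lam t - Lam s <= 2 * (pi * r) ->
  2 * r * sin ((Lam t - Lam s) / (2 * r)) <= normv (gamma t - gamma s).
Proof.
move=> r0 arc cur as_ st tb l; have [m _ h] := schur_mid r0 arc cur as_ st tb l.
apply: le_trans h _; apply: le_trans (dotv_le _ _) _.
have -> : normv (dirv (q m)) = 1 by apply/normv_unit/dirv_unit; case: arc.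
by rewrite mulr1.
Qed.

(** Up to a quarter of the circle, the component of the chord along [z] is at most that
    of the circle of radius [r], and its tangential component at least; beyond, Schur's
    lower bounds on the chord and on its tangential component leave too little room for
    the component along [z], by Bessel's inequality. *)
Lemma tangent_ball_right gamma q Lam r a b s t z : 0 < r -> arc_curve gamma q Lam ->
  curvature_le q Lam r a b -> a <= s -> s <= t -> t <= b -> Lam t - Lam s <= pi * r ->
  dotv z z = 1 -> dotv z (q s) = 0 ->
  2 * r * dotv (gamma t - gamma s) z <= dotv (gamma t - gamma s) (gamma t - gamma s).
Proof.
move=> r0 arc cur as_ st tb l z1 zq.
have hL := arc_curve_homo arc; have [gq dL q0] := arc.
set u := dirv (q s); have u1 : dotv u u = 1 by rewrite dirv_unit.
have uz : dotv u z = 0 by rewrite dotvC /u dirvE dotvZr zq mulr0.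
have h1 := schur_right r0 arc cur as_ st tb l; rewrite -/u in h1.
have hb := bessel2 (gamma t - gamma s) u1 z1 uz.
set D := gamma t - gamma s in h1 hb *; set th := (Lam t - Lam s) / r in h1.
have th0 : 0 <= th by rewrite /th divr_ge0 ?subr_ge0 ?hL// ltW.
have thpi : th <= pi by rewrite /th ler_pdivrMr.
have sth : 0 <= sin th by rewrite sin_ge0_pi// th0.
have rs0 : 0 <= r * sin th by rewrite mulr_ge0// ltW.
have [th2|th2] := leP th (pi / 2).
  have d (x : R) : s <= x <= t -> is_derive x 1
      (fun x => r * (1 - cos ((Lam x - Lam s) / r)) - dotv (gamma x) z)
      (normv (q x) * (sin ((Lam x - Lam s) / r) - dotv (dirv (q x)) z)).
    move=> _; have dL' := derM (derB (dL x) (der_cst (Lam s) x)) (der_cst r^-1 x).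
    apply: (der_eq (derB (derZ r (derB (der_cst 1 x)
      (der_comp (is_derive_cos _) dL'))) (gq z x))).
    by rewrite /= (dirv_dotv (q x)); field; rewrite gt_eqF.
  have h2 : dotv D z <= r * (1 - cos th).
    have := derive_nondecreasing st d; rewrite subrr mul0r cos0 subrr mulr0 sub0r.
    rewrite /D dotvDl dotvNl -/th.
    suff h : forall x, s <= x <= t ->
        0 <= normv (q x) * (sin ((Lam x - Lam s) / r) - dotv (dirv (q x)) z).
      by move=> /(_ h); lra.
    move=> x /andP[sx xt]; rewrite mulr_ge0 ?normv_ge0// subr_ge0.
    have lx : Lam x - Lam s <= pi * r by have := hL _ _ xt; lra.
    have cx := cur s x as_ sx (le_trans xt tb) lx.
    have hb2 := bessel2 (dirv (q x)) u1 z1 uz.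
    rewrite dirv_unit// in hb2; rewrite (dotvC u) in cx.
    set ph := (Lam x - Lam s) / r in cx *.
    have ph0 : 0 <= ph by rewrite /ph divr_ge0 ?subr_ge0 ?hL// ltW.
    have phth : ph <= th by rewrite /ph /th ler_pM2r ?invr_gt0//; have := hL _ _ xt; lra.
    have c0 : 0 <= cos ph by rewrite cos_ge0_pihalf//; apply/andP; split; lra.
    have s0 : 0 <= sin ph by rewrite sin_ge0_pi// ph0; lra.
    have := cos2Dsin2 ph => cs.
    rewrite leNgt; apply/negP => sz.
    have : sin ph ^+ 2 < dotv (dirv (q x)) z ^+ 2 by rewrite ltrXn2r ?nnegrE//; lra.
    have : cos ph ^+ 2 <= dotv (dirv (q x)) u ^+ 2 by rewrite lerXn2r ?nnegrE//; lra.
    by lra.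
  have c0 : 0 <= cos th by rewrite cos_ge0_pihalf//; apply/andP; split; lra.
  have e1 : (r * sin th) ^+ 2 <= dotv D u ^+ 2.
    by rewrite lerXn2r ?nnegrE//; lra.
  have e2 : (r * cos th) ^+ 2 <= (r - dotv D z) ^+ 2.
    have : 0 <= r * cos th by rewrite mulr_ge0// ltW.
    by move=> h; rewrite lerXn2r ?nnegrE//; lra.
  have := cos2Dsin2 th => cs.
  have : r ^+ 2 * (cos th ^+ 2 + sin th ^+ 2) = r ^+ 2 by rewrite cs mulr1.
  by lra.
have pr0 : 0 <= pi * r by rewrite mulr_ge0 ?pi_ge0// ltW.
have ch := schur_chord r0 arc cur as_ st tb ltac:(lra).
have {}ch : 2 * r ^+ 2 * (1 - cos th) <= dotv D D.
  have -> : 2 * r ^+ 2 * (1 - cos th) = (2 * r * sin (th / 2)) ^+ 2.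
    by rewrite (cos_half th); ring.
  rewrite -sqr_normv lerXn2r ?nnegrE ?normv_ge0//.
    by rewrite !mulr_ge0 ?ltW// sin_gt0_pi//; apply/andP; split; have := @pi_gt0 R; lra.
  by move: ch; congr (_ * sin _ <= _); rewrite /th; field; rewrite gt_eqF.
have e1 : (r * sin th) ^+ 2 <= dotv D u ^+ 2.
  by rewrite lerXn2r ?nnegrE//; lra.
have cth : cos th <= 0.
  by rewrite -(@cos_pihalf R); apply: cos_le_mono; have := @pi_gt0 R; lra.
have cs := cos2Dsin2 th.
set X := dotv D D in hb ch *; set A := dotv D u ^+ 2 in hb e1; set c := dotv D z in hb *.
have r2 : 0 < r ^+ 2 by rewrite exprn_gt0.
have X0 : 0 <= X by exact: dotv_ge0.
have [c0|c0] := leP c 0; first by apply: le_trans X0; rewrite mulr_ge0_le0//; lra.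
rewrite -(@ler_pXn2r _ 2)// ?nnegrE ?mulr_ge0//; try lra.
have : 0 <= 2 * r ^+ 2 * - cos th by rewrite mulr_ge0//; lra.
have : (2 * r ^+ 2 * - cos th) ^+ 2 <= (X - 2 * r ^+ 2) ^+ 2.
  have h : 0 <= 2 * r ^+ 2 * - cos th by rewrite mulr_ge0//; lra.
  by rewrite lerXn2r ?nnegrE//; lra.
have : r ^+ 2 * (c ^+ 2) <= r ^+ 2 * (X - A) by rewrite ler_wpM2l//; lra.
have : r ^+ 2 * (r * sin th) ^+ 2 <= r ^+ 2 * A by rewrite ler_wpM2l// ltW.
have : r ^+ 4 * (cos th ^+ 2 + sin th ^+ 2) = r ^+ 4 by rewrite cs mulr1.
by lra.
Qed.

Lemma tangent_ball_left gamma q Lam r a b s t z : 0 < r -> arc_curve gamma q Lam ->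
  curvature_le q Lam r a b -> a <= s -> s <= t -> t <= b -> Lam t - Lam s <= pi * r ->
  dotv z z = 1 -> dotv z (q t) = 0 ->
  2 * r * dotv (gamma s - gamma t) z <= dotv (gamma s - gamma t) (gamma s - gamma t).
Proof.
move=> r0 /arc_curve_rev arc /curvature_le_rev cur as_ st tb l z1 zq.
have := @tangent_ball_right _ _ _ r (- b) (- a) (- t) (- s) z r0 arc cur.
rewrite /= !opprK !lerN2 (addrC _ (Lam t)) dotvNr zq oppr0.
by apply.
Qed.

Lemma has_velocity_lip gamma q k s t : has_velocity gamma q -> s <= t -> 0 <= k ->
  (forall x, s <= x <= t -> normv (q x) <= k) -> normv (gamma t - gamma s) <= k * (t - s).
Proof.
move=> gq st k0 qk.
have [->|D0] := eqVneq (gamma t - gamma s) 0.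
  by rewrite normv0 mulr_ge0// subr_ge0.
set u := dirv (gamma t - gamma s).
have u1 : normv u = 1 by apply/normv_unit/dirv_unit.
have d (x : R) : s <= x <= t -> is_derive x 1 (fun x => k * x - dotv (gamma x) u)
    (k - dotv (q x) u).
  by move=> _; apply: (der_eq (derB (derZ k (der_id x)) (gq u x))); rewrite mulr1.
have := derive_nondecreasing st d.
have -> : normv (gamma t - gamma s) = dotv (gamma t - gamma s) u.
  by rewrite dirv_dotv dirv_unit// mulr1.
rewrite dotvDl dotvNl => h.
suff : forall x, s <= x <= t -> 0 <= k - dotv (q x) u by move=> /h; lra.
move=> x /qk; rewrite subr_ge0; apply: le_trans.
by rewrite (le_trans (dotv_le _ _))// u1 mulr1.
Qed.

Lemma arclength_congr q p Lam (M : R -> R) a b :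
  (forall s : R, is_derive s 1 Lam (normv (q s))) ->
  (forall s : R, is_derive s 1 M (normv (p s))) ->
  (forall s, a <= s <= b -> q s = p s) ->
  forall s t, a <= s -> s <= t -> t <= b -> Lam t - Lam s = M t - M s.
Proof.
move=> dL dM qp s t as_ st tb.
have d (x : R) : s <= x <= t -> is_derive x 1 (fun x => Lam x - M x) 0.
  move=> /andP[sx xt]; apply: (der_eq (derB (dL x) (dM x))).
  by rewrite qp ?subrr//; apply/andP; split; lra.
by have := derive0_const st d; lra.
Qed.

Lemma curvature_le_congr q p Lam (M : R -> R) r a b :
  (forall s : R, is_derive s 1 Lam (normv (q s))) ->
  (forall s : R, is_derive s 1 M (normv (p s))) ->
  (forall s, a <= s <= b -> q s = p s) ->
  curvature_le p M r a b -> curvature_le q Lam r a b.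
Proof.
move=> dL dM qp h s t as_ st tb; rewrite (arclength_congr dL dM qp)//.
by rewrite !qp; [exact: h|rewrite tb (le_trans as_)|rewrite as_ (le_trans st)].
Qed.

End ArcGeometry.

(** * The ball radius and the tangent balls *)

Section BallRadius.
Context {R : realType} {n : nat}.
Implicit Types (gamma q T : R -> 'rV[R]_n) (u v w z : 'rV[R]_n) (Lam : R -> R).

(** No point of [gamma] lies in an open ball of radius [r] tangent to [gamma]; the
    centres [r *: z] are eliminated by expanding the square. *)
Definition outside_tangent_balls gamma q (r : R) := forall s t z,
  dotv z z = 1 -> dotv z (q s) = 0 ->
  2 * r * dotv (gamma t - gamma s) z <= dotv (gamma t - gamma s) (gamma t - gamma s).

Lemma in_tangent_ball u z (r : R) : 0 < r -> dotv z z = 1 ->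
  (normv (u - r *: z) < r) = (dotv u u < 2 * r * dotv u z).
Proof.
move=> r0 z1.
rewrite -(@ltr_pXn2r _ 2)// ?nnegrE ?normv_ge0 ?(ltW r0)// sqr_normv.
rewrite !dotvE (dotvC z u) z1.
by apply/idP/idP; lra.
Qed.

Lemma ball_radius_ge gamma r : 0 < r ->
  outside_tangent_balls gamma (derive1 gamma) r -> (r%:E <= ball_radius gamma)%E.
Proof.
move=> r0 tb; apply: le_ereal_inf_tmp => _ [r' [r'0 [y [[x _ [u [z hz]]] [t _ ty]]]] <-].
case: hz => -[u1 [s [sx [k uk]]] uz z1].
rewrite -ty -sx {x y sx ty} lee_fin leNgt in_tangent_ball//; last exact/normv_unit.
move=> hlt; apply/negP => r'r.
have zs : dotv z (derive1 gamma s) = 0.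
  have k0 : k != 0.
    by apply/eqP => k0; move: u1; rewrite uk k0 scale0r normv0 => /eqP; rewrite eq_sym oner_eq0.
  by move/eqP: uz; rewrite uk dotvZl mulf_eq0 (negbTE k0)/= => /eqP; rewrite dotvC.
have z1' : dotv z z = 1 by exact/normv_unit.
have := tb s t z z1' zs; have := dotv_ge0 (gamma t - gamma s).
set X := dotv (_ - _) (_ - _) in hlt *; set c := dotv _ z in hlt *.
move=> X0 Xr; have rr0 : 0 < 2 * r' by rewrite mulr_gt0.
have c0 : 0 < c by rewrite -(pmulr_rgt0 _ rr0); exact: le_lt_trans X0 hlt.
have : 0 < (r - r') * c by rewrite mulr_gt0// subr_gt0.
by lra.
Qed.

Lemma ball_radius_outside gamma r : 0 < r -> (forall s, derive1 gamma s != 0) ->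
  (r%:E <= ball_radius gamma)%E -> outside_tangent_balls gamma (derive1 gamma) r.
Proof.
move=> r0 q0 hr s t z z1 zs; rewrite leNgt; apply/negP.
set X := dotv (_ - _) (_ - _); set c := dotv _ z => hlt.
have X0 : 0 <= X by exact: dotv_ge0.
have c0 : 0 < c.
  have rr0 : 0 < 2 * r by rewrite mulr_gt0.
  by rewrite -(pmulr_rgt0 _ rr0); exact: le_lt_trans X0 hlt.
(* Any radius strictly between the critical one, [X / (2 c)], and [r] also fails. *)
pose r' := (X / (2 * c) + r) / 2.
have Xr : X / (2 * c) < r by rewrite ltr_pdivrMr ?mulr_gt0//; lra.
have Xr0 : 0 <= X / (2 * c) by rewrite divr_ge0// mulr_ge0// ltW.
have r'0 : 0 < r' by rewrite /r'; lra.
have r'r : r' < r by rewrite /r'; lra.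
suff : (ball_radius gamma <= r'%:E)%E.
  by move=> /(le_trans hr); rewrite lee_fin leNgt r'r.
apply: ereal_inf_lbound; exists r' => //; split => //.
exists (gamma t); split; last by exists t.
exists (gamma s); first by exists s.
exists (dirv (derive1 gamma s)), z; split.
- split; first exact/normv_unit/dirv_unit.
  by exists s; split => //; exists (normv (derive1 gamma s))^-1; rewrite dirvE.
- by rewrite dirvE dotvZl dotvC zs mulr0.
- exact/normv_unit.
- rewrite in_tangent_ball// -/X -/c.
  have : X / (2 * c) < r' by rewrite /r'; lra.
  by rewrite ltr_pdivrMr ?mulr_gt0//; lra.
Qed.

Lemma periodicz (U W : zmodType) (f : U -> W) (L : U) :
  periodic f L -> forall (k : int) x, f (x + L *~ k) = f x.
Proof.
move=> fL; have nat_case (m : nat) x : f (x + L *+ m) = f x.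
  by elim: m x => [|m IH] x; [rewrite mulr0n addr0|rewrite mulrSr addrA fL IH].
case=> m x; first exact: nat_case.
by rewrite NegzE mulrNz -{2}(subrK (L *+ m.+1) x) nat_case.
Qed.

Lemma periodic_window (L s t : R) : 0 < L -> exists k : int, s <= t + L *~ k < s + L.
Proof.
move=> L0; exists (- Num.floor ((t - s) / L)).
rewrite mulrNz -mulrzl; set k := Num.floor _.
have : k%:~R <= (t - s) / L < (k + 1)%:~R by exact: floor_itv.
rewrite intrD.
rewrite ler_pdivlMr// ltr_pdivrMr// => /andP[h1 h2].
by apply/andP; split; lra.
Qed.

(** Tangent balls are avoided by short arcs because of the curvature, and by points at
    distance at least [2 r], the diameter of the balls, in any case. *)
Lemma outside_tangent_balls_far gamma q Lam L r : 0 < r -> 0 < L ->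
  arc_curve gamma q Lam -> (forall a b, curvature_le q Lam r a b) ->
  periodic gamma L -> periodic q L ->
  (forall s t, s <= t -> t <= s + L -> pi * r <= Lam t - Lam s ->
    pi * r <= Lam (s + L) - Lam t -> 2 * r <= normv (gamma t - gamma s)) ->
  outside_tangent_balls gamma q r.
Proof.
move=> r0 L0 arc cur pg pq far s t z z1 zs.
have [k] := periodic_window s t L0; rewrite -(periodicz pg k t).
move: (t + L *~ k) => {k}t /andP[st /ltW tL].
have [l1|/ltW l1] := leP (Lam t - Lam s) (pi * r).
  exact: (tangent_ball_right r0 arc (cur s t)).
have [l2|/ltW l2] := leP (Lam (s + L) - Lam t) (pi * r).
  rewrite -(pg s); rewrite -(pq s) in zs.
  exact: (tangent_ball_left r0 arc (cur t (s + L))).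
have h := far s t st tL l1 l2.
have := dotv_le (gamma t - gamma s) z; rewrite -sqr_normv.
have -> : normv z = 1 by exact/normv_unit.
set D := normv _ in h * => h2; rewrite expr2.
apply: (@le_trans _ _ (2 * r * D)); first by rewrite ler_wpM2l ?mulr_ge0 ?(ltW r0)//; lra.
by rewrite ler_wpM2r ?normv_ge0.
Qed.

(** A Lipschitz constant valid at small scales is valid at all scales. *)
Lemma lipschitz_local_global (f : R -> 'rV[R]_n) (k eta : R) : 0 < eta ->
  (forall s t, s <= t -> t - s < eta -> normv (f s - f t) <= k * (t - s)) ->
  forall s t, s <= t -> normv (f s - f t) <= k * (t - s).
Proof.
move=> eta0 hloc.
have part N s t : s <= t -> t - s < N.+1%:R * eta -> normv (f s - f t) <= k * (t - s).
  elim: N s t => [|N IH] s t st; first by rewrite mul1r => ?; exact: hloc.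
  rewrite -natr1 => tsN; have [tseta|tseta] := ltP (t - s) eta; first exact: hloc.
  have N0 : 0 < (N.+1%:R : R) by rewrite ltr0n.
  set K : R := N.+1%:R in tsN N0.
  pose m := t - (t - s) / (K + 1).
  have D0 : 0 <= (t - s) / (K + 1) by rewrite divr_ge0 ?subr_ge0//; lra.
  have D1 : (t - s) / (K + 1) < eta by rewrite ltr_pdivrMr; lra.
  have sm : m - s = (t - s) / (K + 1) * K by rewrite /m; field; lra.
  have mt : t - m = (t - s) / (K + 1) by rewrite /m; ring.
  apply: le_trans (normv_dist _ (f m) _) _.
  have -> : k * (t - s) = k * (m - s) + k * (t - m) by ring.
  apply: lerD; last by apply: hloc; lra.
  apply: IH; first by rewrite -subr_ge0 sm mulr_ge0// ltW.
  by rewrite sm -/K (mulrC K) ltr_pM2r.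
move=> s t st; apply: (part `|Num.ceil ((t - s) / eta)|%N) => //.
rewrite -ltr_pdivrMr//.
have x0 : 0 <= (t - s) / eta by rewrite divr_ge0 ?subr_ge0// ltW.
rewrite -natr1 (le_lt_trans (ceil_ge _))// natr_absz ger0_norm ?ltrDl//.
by rewrite -(ler_int R) (le_trans x0)// ceil_ge.
Qed.

End BallRadius.

Section UnitSpeed.
Context {R : realType} {n : nat}.
Variables (gamma T : R -> 'rV[R]_n) (r : R).
Hypotheses (r0 : 0 < r) (gT : has_velocity gamma T) (T1 : forall s, dotv (T s) (T s) = 1).

Lemma unit_neq0 s : T s != 0.
Proof.
by apply/eqP => Ts0; have := T1 s; rewrite Ts0 dotv0 => /eqP; rewrite eq_sym oner_eq0.
Qed.

Lemma unit_normv s : normv (T s) = 1.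
Proof. exact/normv_unit. Qed.

Lemma unit_dirv s : dirv (T s) = T s.
Proof. by rewrite dirvE unit_normv invr1 scale1r. Qed.

Lemma unit_arc_curve : arc_curve gamma T id.
Proof. by split=> // s; [rewrite unit_normv; exact: der_id|exact: unit_neq0]. Qed.

Lemma unit_lip s t : s <= t -> normv (gamma t - gamma s) <= t - s.
Proof.
move=> st; rewrite -[leRHS]mul1r; apply: (has_velocity_lip gT) => // x _.
by rewrite unit_normv.
Qed.

Lemma unit_lip_norm s t : normv (gamma t - gamma s) <= `|t - s|.
Proof.
have [st|/ltW ts] := leP s t; first by rewrite ger0_norm ?subr_ge0// unit_lip.
by rewrite normvC distrC ger0_norm ?subr_ge0// unit_lip.
Qed.

(** Both tangents make with the chord an angle of sine at most half the chord
    divided by [r]. *)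
Lemma outside_tangent_balls_chord s t : s <= t ->
  outside_tangent_balls gamma T r ->
  0 < dotv (gamma t - gamma s) (T s) -> 0 < dotv (gamma t - gamma s) (T t) ->
  normv (T s - T t) <= r^-1 * (t - s).
Proof.
move=> st tb; have [D DE] : exists D, D = gamma t - gamma s by eexists.
rewrite -DE => A0 B0.
set A := dotv D (T s) in A0; set B := dotv D (T t) in B0.
have D0 : D != 0 by apply/eqP => D0; move: A0; rewrite /A D0 dot0v ltxx.
have X0 : 0 < dotv D D by rewrite -sqr_normv exprn_gt0// normv_gt0.
have perp x y : D = gamma y - gamma x \/ D = gamma x - gamma y ->
    4 * r ^+ 2 * (dotv D D - dotv D (T x) ^+ 2) <= dotv D D ^+ 2.
  move=> hxy.
  have [P0|P0] := eqVneq (D - dotv D (T x) *: T x) 0.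
    have : dotv (D - dotv D (T x) *: T x) (D - dotv D (T x) *: T x) = 0.
      by rewrite P0 dot0v.
    rewrite !dotvE T1 (dotvC (T x)) => h.
    have -> : dotv D D - dotv D (T x) ^+ 2 = 0 by rewrite -h; ring.
    by rewrite mulr0 sqr_ge0.
  set P := D - _ in P0; set z := dirv P.
  have z1 : dotv z z = 1 by exact: dirv_unit.
  have zP : dotv P z = normv P by rewrite dirv_dotv z1 mulr1.
  have Px : dotv P (T x) = 0 by rewrite /P !dotvE T1; ring.
  have zx : dotv z (T x) = 0 by rewrite /z dirvE dotvZl Px mulr0.
  have DP : dotv D z = normv P.
    by rewrite -zP /P dotvDl dotvNl dotvZl (dotvC (T x)) zx mulr0 subr0.
  have PP : dotv P P = dotv D D - dotv D (T x) ^+ 2.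
    by rewrite /P !dotvE T1 (dotvC (T x)); ring.
  rewrite -PP -sqr_normv.
  have h : 2 * r * normv P <= dotv D D.
    case: hxy => hxy.
      by have := tb x y z z1 zx; rewrite -hxy DP.
    have Nz1 : dotv (- z) (- z) = 1 by rewrite dotvNl dotvNr opprK.
    have Nzx : dotv (- z) (T x) = 0 by rewrite dotvNl zx oppr0.
    have := tb x y (- z) Nz1 Nzx.
    have -> : gamma y - gamma x = - D by rewrite hxy opprB.
    by rewrite !dotvNl !dotvNr !opprK DP.
  have -> : 4 * r ^+ 2 * normv P ^+ 2 = (2 * r * normv P) ^+ 2 by ring.
  by rewrite lerXn2r ?nnegrE ?mulr_ge0 ?normv_ge0 ?dotv_ge0// ltW.
have hA := perp s t (or_introl DE); have hB := perp t s (or_intror DE).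
rewrite -/A in hA; rewrite -/B in hB.
set X := dotv D D in X0 hA hB.
have r2 : 0 < 4 * r ^+ 2 by rewrite mulr_gt0// exprn_gt0.
pose e := X / (4 * r ^+ 2).
have e0 : 0 <= e by rewrite /e divr_ge0// ltW.
have eX : X ^+ 2 / (4 * r ^+ 2) = e * X by rewrite /e; field; rewrite gt_eqF.
have {}hA : X - A ^+ 2 <= e * X by rewrite -eX ler_pdivlMr// mulrC.
have {}hB : X - B ^+ 2 <= e * X by rewrite -eX ler_pdivlMr// mulrC.
(* The components of the tangents orthogonal to the chord, scaled by [X]. *)
have hc : - (e * X ^+ 2) <= X * (X * dotv (T s) (T t)) - X * (A * B).
  have := dotv_ge (X *: T s - A *: D) (X *: T t - B *: D).
  have nn (a : R) u : dotv u u = 1 -> dotv D u = a -> X - a ^+ 2 <= e * X ->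
      normv (X *: u - a *: D) ^+ 2 <= e * X ^+ 2.
    move=> u1 ua ha; rewrite sqr_normv !dotvE u1 (dotvC u) ua -/X.
    have : X * (X - a ^+ 2) <= X * (e * X) by rewrite ler_wpM2l// ltW.
    by lra.
  have ns := nn A (T s) (T1 s) erefl hA; have nt := nn B (T t) (T1 t) erefl hB.
  have : normv (X *: T s - A *: D) * normv (X *: T t - B *: D) <= e * X ^+ 2.
    have := sqr_ge0 (normv (X *: T s - A *: D) - normv (X *: T t - B *: D)).
    by lra.
  rewrite !dotvE (dotvC (T s) D) -/A -/B -/X; lra.
have hAB : X * (1 - e) <= A * B.
  have [e1|e1] := leP 1 e.
    apply: (@le_trans _ _ 0); last by rewrite mulr_ge0// ltW.
    by rewrite pmulr_rle0// subr_le0.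
  have p0 : 0 <= X * (1 - e) by rewrite mulr_ge0// ?ltW//; lra.
  have AB0 : 0 <= A * B by rewrite mulr_ge0// ltW.
  rewrite -(@ler_pXn2r _ 2) ?nnegrE//.
  rewrite [leRHS]exprMn [leLHS]expr2; apply: ler_pM => //; lra.
apply: (@le_trans _ _ (r^-1 * normv D)).
  apply: normv_le; first by rewrite mulr_ge0 ?normv_ge0// invr_ge0 ltW.
  rewrite dotvB_unit// exprMn sqr_normv -/X.
  have -> : r^-1 ^+ 2 * X = 4 * e by rewrite /e; field; rewrite gt_eqF.
  have : X * (X * (1 - 2 * e)) <= X * (X * dotv (T s) (T t)).
    have : X * (X * (1 - e)) <= X * (A * B) by rewrite ler_wpM2l// ltW.
    by lra.
  by rewrite !ler_pM2l//; lra.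
by rewrite ler_wpM2l ?invr_ge0 ?(ltW r0)// DE unit_lip.
Qed.

(** At small scales, measured by any Lipschitz constant [K], the tangents point along the
    chord and the bound on their angles applies; it is then propagated to all scales. *)
Lemma outside_tangent_balls_lip (K : R) :
  (forall s t, normv (T s - T t) <= K * `|s - t|) ->
  outside_tangent_balls gamma T r ->
  forall s t, normv (T s - T t) <= r^-1 * `|s - t|.
Proof.
move=> TK tb.
have K0 : 0 < `|K| + 1 by rewrite ltr_wpDl.
have eta0 : 0 < (`|K| + 1)^-1 by rewrite invr_gt0.
have main s t : s <= t -> normv (T s - T t) <= r^-1 * (t - s).
  apply: (lipschitz_local_global eta0) => {}s {}t st ts.
  have [->|nst] := eqVneq s t; first by rewrite !subrr normv0 mulr0.
  have {nst}st' : s < t by rewrite lt_neqAle nst.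
  have close x y : s <= x <= t -> s <= y <= t -> 1 / 2 <= dotv (T x) (T y).
    move=> /andP[sx xt] /andP[sy yt].
    have h1 : normv (T x - T y) <= 1.
      apply: le_trans (TK _ _) _.
      apply: (@le_trans _ _ ((`|K| + 1) * (t - s))).
        apply: (@le_trans _ _ ((`|K| + 1) * `|x - y|)).
          by rewrite ler_wpM2r// (le_trans (ler_norm K))// lerDl.
        rewrite ler_wpM2l ?(ltW K0)// ler_norml; apply/andP; split; lra.
      by rewrite mulrC -ler_pdivlMr// mul1r ltW.
    have := dotvB_unit (T1 x) (T1 y); rewrite -sqr_normv.
    have : normv (T x - T y) ^+ 2 <= 1 by rewrite expr_le1// normv_ge0.
    by lra.
  have pos y : s <= y <= t -> 0 < dotv (gamma t - gamma s) (T y).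
    move=> yst.
    have d (x : R) : s <= x <= t -> is_derive x 1
        (fun x => dotv (gamma x) (T y) - 1 / 2 * x) (dotv (T x) (T y) - 1 / 2).
      move=> _; apply: (der_eq (derB (gT (T y) x) (derZ _ (der_id x)))).
      by rewrite mulr1.
    have := derive_nondecreasing (ltW st') d.
    suff h : forall x, s <= x <= t -> 0 <= dotv (T x) (T y) - 1 / 2.
      by move=> /(_ h); rewrite dotvDl dotvNl; lra.
    by move=> x xst; rewrite subr_ge0 close.
  by apply: outside_tangent_balls_chord => //; apply: pos; rewrite ?lexx ?st.
move=> s t; have [st|/ltW ts] := leP s t.
  by rewrite distrC ger0_norm ?subr_ge0// main.
by rewrite normvC ger0_norm ?subr_ge0// main.
Qed.

(** For unit vectors the chord bound is infinitesimally the angle bound. *)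
Lemma lip_curvature_le a b : (forall s t, normv (T s - T t) <= r^-1 * `|s - t|) ->
  curvature_le T id r a b.
Proof.
move=> TL; apply: (@curvature_le_local _ _ _ _ _ _ _ 1) => //; first exact: unit_neq0.
  by move=> s t *; rewrite mul1r.
move=> d d0; exists 1 => // s t _ st _ _; rewrite !unit_dirv.
apply: le_trans (TL _ _) _; rewrite distrC ger0_norm ?subr_ge0// mulrC.
by rewrite ler_peMl ?mulr_ge0 ?subr_ge0 ?invr_ge0 ?(ltW r0)//; lra.
Qed.

(** Compactness in two steps: the minimum over the length [h] of the chord is a Lipschitz
    function of its origin [s], hence attains its own minimum. *)
Lemma chord_compact (a b u v c : R) : a <= b -> u <= v ->
  (forall s h, u <= s <= v -> a <= h <= b -> c < normv (gamma (s + h) - gamma s)) ->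
  exists2 d, 0 < d & forall s h, u <= s <= v -> a <= h <= b ->
    c + d <= normv (gamma (s + h) - gamma s).
Proof.
move=> ab uv big.
have minh s : exists h, (a <= h <= b) /\ forall h', a <= h' <= b ->
    normv (gamma (s + h) - gamma s) <= normv (gamma (s + h') - gamma s).
  have cf : continuous (fun h => normv (gamma (s + h) - gamma s)).
    apply: (@lipschitz_continuous _ _ 1) => x y; rewrite mul1r.
    apply: le_trans (ler_norm _) _; rewrite normr_id ler_norml.
    have e1 : gamma (s + x) - gamma s - (gamma (s + y) - gamma s) = gamma (s + x) - gamma (s + y).
      by rewrite opprB addrA subrK.
    have e2 : `|(s + x) - (s + y)| = `|x - y| by congr (`|_|); ring.
    have := unit_lip_norm (s + y) (s + x); rewrite e2 => h1.
    have h2 := normv_sub (gamma (s + x) - gamma s) (gamma (s + y) - gamma s).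
    have h3 := normv_sub (gamma (s + y) - gamma s) (gamma (s + x) - gamma s).
    rewrite e1 in h2; rewrite (normvC (gamma (s + y) - gamma s)) e1 in h3.
    by apply/andP; split; lra.
  have [h] := EVT_min ab (continuous_subspaceT cf).
  rewrite in_itv/= => hh hmin; by exists h.
pose hm s := sval (cid (minh s)); pose m s := normv (gamma (s + hm s) - gamma s).
have [hmP mP] : (forall s, a <= hm s <= b) /\
    (forall s h', a <= h' <= b -> m s <= normv (gamma (s + h') - gamma s)).
  by split=> s; have [] := svalP (cid (minh s)).
have cm : continuous m.
  have h s t : m s - m t <= 2 * `|s - t|.
    have h1 := mP s _ (hmP t).
    have h2 := unit_lip_norm (t + hm t) (s + hm t).
    have h3 := unit_lip_norm s t.
    have e : gamma (s + hm t) - gamma s = (gamma (s + hm t) - gamma (t + hm t)) +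
        ((gamma (t + hm t) - gamma t) + (gamma t - gamma s)).
      by rewrite !addrA !subrK.
    have h4 := normv_triangle (gamma (s + hm t) - gamma (t + hm t))
      ((gamma (t + hm t) - gamma t) + (gamma t - gamma s)).
    have h5 := normv_triangle (gamma (t + hm t) - gamma t) (gamma t - gamma s).
    rewrite -e in h4; rewrite /m in h1 *; rewrite distrC in h3.
    have e' : `|s + hm t - (t + hm t)| = `|s - t| by congr (`|_|); ring.
    rewrite e' in h2; move: h1 h2 h3 h4 h5; clear.
    by do 6 (move: (normv _) => ?); lra.
  apply: (@lipschitz_continuous _ _ 2) => s t; rewrite ler_norml.
  by have := h s t; have := h t s; rewrite (distrC t s) => ? ?; apply/andP; split; lra.
have [x] := EVT_min uv (continuous_subspaceT cm).
rewrite in_itv/= => xuv xmin.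
exists (m x - c); first by rewrite subr_gt0; exact: big xuv (hmP x).
move=> s h suv hab; rewrite addrC subrK; have := xmin s; rewrite in_itv/= suv => /(_ isT) hx.
exact: le_trans hx (mP _ _ hab).
Qed.

End UnitSpeed.

(** * Contact points of a closed curve *)

Section ClosedUnitSpeed.
Context {R : realType} {n : nat}.
Variables (gamma T : R -> 'rV[R]_n) (r L : R).
Hypotheses (r0 : 0 < r) (L0 : 0 < L).
Hypotheses (gT : has_velocity gamma T) (T1 : forall s, dotv (T s) (T s) = 1).
Hypotheses (pg : periodic gamma L) (pT : periodic T L).
Hypotheses (TL : forall s t, normv (T s - T t) <= r^-1 * `|s - t|).

Let arc := unit_arc_curve gT T1.
Let cur a b : curvature_le T id r a b := lip_curvature_le r0 T1 TL.
Arguments cur : clear implicits.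
Let pr0 : 0 < pi * r := mulr_gt0 (pi_gt0 R) r0.

(** A closed curve of curvature at most [1 / r] is at least as long as the circle of
    radius [r]: otherwise it would advance in its middle direction. *)
Lemma closed_length_ge : 2 * (pi * r) <= L.
Proof.
rewrite leNgt; apply/negP => hL.
have L2 : 0 <= L / 2 by rewrite divr_ge0// ltW.
have h1 := @schur_right _ _ _ _ _ _ 0 L (L / 2) L r0 arc (cur 0 L) L2.
have h2 := @schur_left _ _ _ _ _ _ 0 L 0 (L / 2) r0 arc (cur 0 L) (lexx 0) L2.
rewrite /= in h1 h2.
have {}h1 := h1 ltac:(lra) ltac:(lra) ltac:(lra).
have {}h2 := h2 ltac:(lra) ltac:(lra).
have e1 : (L - L / 2) / r = L / (2 * r) by field; rewrite gt_eqF.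
have e2 : (L / 2 - 0) / r = L / (2 * r) by field; rewrite gt_eqF.
rewrite e1 in h1; rewrite e2 in h2.
have gL : gamma L = gamma 0 by rewrite -(pg 0) add0r.
have : 0 < r * sin (L / (2 * r)).
  rewrite mulr_gt0// sin_gt0_pi// divr_gt0 ?mulr_gt0//=.
  by rewrite ltr_pdivrMr ?mulr_gt0//; lra.
by move: h1 h2; rewrite gL !dotvDl !dotvNl; lra.
Qed.

Lemma schur_chord_unit s t : s <= t -> t - s <= 2 * (pi * r) ->
  2 * r * sin ((t - s) / (2 * r)) <= normv (gamma t - gamma s).
Proof. by move=> st l; exact: (schur_chord r0 arc (cur s t)). Qed.

Lemma schur_half s t : t - s = pi * r -> 2 * r <= normv (gamma t - gamma s).
Proof.
move=> ts; have hp := pr0; have := @schur_chord_unit s t ltac:(lra) ltac:(lra).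
have -> : (t - s) / (2 * r) = pi / 2 by rewrite ts; field; rewrite gt_eqF.
by rewrite sin_pihalf mulr1.
Qed.

Hypotheses (tb : outside_tangent_balls gamma T r).
Hypotheses (inj : forall s t, s < t -> t < s + L -> gamma t != gamma s).

Lemma der_sqdist s (x : R) : is_derive x 1
  (fun x => dotv (gamma x - gamma s) (gamma x - gamma s))
  (2 * dotv (gamma x - gamma s) (T x)).
Proof.
(* The squared distance is expanded over coordinates, the form in which the
   velocity of [gamma] is available. *)
have h i : is_derive x 1 (fun x => (gamma x - gamma s) ord0 i * (gamma x - gamma s) ord0 i)
    (2 * ((gamma x - gamma s) ord0 i * T x ord0 i)).
  have hi : is_derive x 1 (fun x => (gamma x - gamma s) ord0 i) (T x ord0 i).
    have -> : (fun x => (gamma x - gamma s) ord0 i) =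
        (fun x => dotv (gamma x) (delta_mx 0 i) - gamma s ord0 i).
      by apply/funext => y; rewrite !mxE dotv_delta.
    apply: (der_eq (derB (gT (delta_mx 0 i) x) (der_cst _ x))).
    by rewrite dotv_delta subr0.
  by apply: (der_eq (derM hi hi)); ring.
have hs (l : seq 'I_n) : is_derive x 1
    (fun x => \sum_(i <- l) (gamma x - gamma s) ord0 i * (gamma x - gamma s) ord0 i)
    (\sum_(i <- l) 2 * ((gamma x - gamma s) ord0 i * T x ord0 i)).
  elim: l => [|i l IH].
    by rewrite big_nil; under eq_fun do rewrite big_nil; exact: der_cst.
  by rewrite big_cons; under eq_fun do rewrite big_cons; exact: (derD (h i) IH).
by apply: (der_eq (hs _)); rewrite mulr_sumr.
Qed.

(** On [s + pi r, s + L - pi r] the distance to [gamma s] cannot have an interior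
    minimum below [2 r]: the chord would be normal to the curve at its far end, and
    the tangent ball there would contain [gamma s]. *)
Lemma far_apart s t : s + pi * r <= t -> t <= s + L - pi * r ->
  2 * r <= normv (gamma t - gamma s).
Proof.
move=> st tL; have hp := pr0; have hLr := closed_length_ge.
pose f x := dotv (gamma x - gamma s) (gamma x - gamma s).
have df x := der_sqdist s x.
have cf : {within `[s + pi * r, s + L - pi * r], continuous f}.
  by apply: continuous_subspaceT; exact: (is_derive_continuous df).
have hab : s + pi * r <= s + L - pi * r by lra.
have [c] := EVT_min hab cf.
rewrite in_itv/= => /andP[c1 c2] cmin.
have h2r : 0 <= 2 * r by rewrite mulr_ge0// ltW.
suff hc : (2 * r) ^+ 2 <= f c.
  apply: normv_ge; apply: le_trans hc _; apply: cmin.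
  by rewrite in_itv/= st tL.
have [ec|nc1] := eqVneq c (s + pi * r).
  by rewrite /f -sqr_normv lerXn2r ?nnegrE ?normv_ge0 ?schur_half//; lra.
have [ec|nc2] := eqVneq c (s + L - pi * r).
  rewrite /f -sqr_normv lerXn2r ?nnegrE ?normv_ge0//.
  by rewrite -(pg s) normvC schur_half//; lra.
have c1' : s + pi * r < c by rewrite lt_neqAle eq_sym nc1.
have c2' : c < s + L - pi * r by rewrite lt_neqAle nc2.
have dc : is_derive c 1 f 0.
  apply: (@derive1_at_min _ f (s + pi * r) (s + L - pi * r)).
  - by lra.
  - by move=> x _; exact: (@ex_derive _ _ _ _ _ _ _ (df x)).
  - by rewrite in_itv/= c1'.
  - move=> x; rewrite in_itv/= => /andP[x1 x2]; apply: cmin.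
    by rewrite in_itv/= !ltW.
have : 2 * dotv (gamma c - gamma s) (T c) = 0.
  by rewrite -(@derive_val _ _ _ _ _ _ _ (df c)) (@derive_val _ _ _ _ _ _ _ dc).
move=> /eqP; rewrite mulf_eq0 pnatr_eq0/= => /eqP hn.
set D := gamma c - gamma s in hn.
have D0 : D != 0 by rewrite subr_eq0; apply: inj; lra.
have z1 : dotv (- dirv D) (- dirv D) = 1 by rewrite dotvNl dotvNr opprK dirv_unit.
have zc : dotv (- dirv D) (T c) = 0 by rewrite dotvNl dirvE dotvZl hn mulr0 oppr0.
have := tb s z1 zc; have -> : gamma s - gamma c = - D by rewrite opprB.
have hD : dotv D (dirv D) = normv D by rewrite dirv_dotv dirv_unit// mulr1.
rewrite !dotvNl !dotvNr !opprK hD -sqr_normv expr2 ler_pM2r ?normv_gt0// => h.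
by rewrite /f -/D -sqr_normv lerXn2r ?nnegrE ?normv_ge0.
Qed.

Definition contact s := exists y, [/\ normv (gamma s - gamma y) = 2 * r,
  dotv (gamma s - gamma y) (T s) = 0 & dotv (gamma s - gamma y) (T y) = 0].

(** Nearly antipodal pairs are nearly [2 r] apart, to second order. *)
Lemma nearly_far_apart s t (eta : R) : 0 <= eta -> eta <= pi * r ->
  s + pi * r - eta <= t -> t <= s + L - pi * r + eta ->
  (2 * r) ^+ 2 - eta ^+ 2 <= dotv (gamma t - gamma s) (gamma t - gamma s).
Proof.
move=> e0 epi st tL; have hp := pr0; have hLr := closed_length_ge.
have near_half x y : x <= y -> y <= x + pi * r -> x + pi * r - eta <= y ->
    (2 * r) ^+ 2 - eta ^+ 2 <= dotv (gamma y - gamma x) (gamma y - gamma x).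
  move=> xy1 xy2 xy3; have := @schur_chord_unit x y ltac:(lra) ltac:(lra).
  pose xi := (pi * r - (y - x)) / (2 * r).
  have -> : (y - x) / (2 * r) = - xi + pi / 2 by rewrite /xi; field; rewrite gt_eqF.
  rewrite sinDpihalf cosN => h.
  have xi0 : 0 <= xi by rewrite /xi divr_ge0 ?mulr_ge0 ?(ltW r0)//; lra.
  have xie : 2 * r * xi <= eta.
    have -> : 2 * r * xi = pi * r - (y - x) by rewrite /xi; field; rewrite gt_eqF.
    by lra.
  have c0 : 0 <= cos xi.
    have : xi <= pi / 2 by rewrite /xi ler_pdivrMr ?mulr_gt0//; lra.
    by move=> ?; rewrite cos_ge0_pihalf//; apply/andP; split; have := pi_gt0 R; lra.
  rewrite -sqr_normv; apply: (@le_trans _ _ ((2 * r * cos xi) ^+ 2)); last first.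
    by rewrite lerXn2r ?nnegrE ?normv_ge0 ?mulr_ge0 ?(ltW r0).
  rewrite [leRHS]exprMn cos2sin2 mulrBr mulr1 lerD2l lerN2 -exprMn.
  have s0 : 0 <= sin xi.
    rewrite sin_ge0_pi// xi0/=.
    by rewrite /xi ler_pdivrMr ?mulr_gt0//; have := mulr_gt0 (pi_gt0 R) r0; lra.
  rewrite lerXn2r ?nnegrE ?mulr_ge0 ?(ltW r0)//.
  by apply: le_trans xie; rewrite ler_wpM2l ?mulr_ge0 ?(ltW r0)// sin_le_id.
have [h1|h1] := leP t (s + pi * r); first by apply: near_half; lra.
have [h2|h2] := leP (s + L - pi * r) t.
  have := @near_half t (s + L); rewrite pg -(opprB (gamma t)) dotvNl dotvNr opprK; apply; lra.
have := @far_apart s t ltac:(lra) ltac:(lra) => h.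
have : (2 * r) ^+ 2 <= dotv (gamma t - gamma s) (gamma t - gamma s).
  by rewrite -sqr_normv lerXn2r ?nnegrE ?normv_ge0 ?mulr_ge0 ?(ltW r0).
by have := sqr_ge0 eta; lra.
Qed.

(** The squared distance to [gamma s], corrected by [(x - t)^2], has by
    [nearly_far_apart] a local minimum at [t], where the correction is flat. *)
Lemma contact_normal s t : s + pi * r <= t -> t <= s + L - pi * r ->
  normv (gamma t - gamma s) = 2 * r -> dotv (gamma t - gamma s) (T t) = 0.
Proof.
move=> st tL h.
pose f x := dotv (gamma x - gamma s) (gamma x - gamma s) + (x - t) ^+ 2.
have df (x : R) : is_derive x 1 f (2 * dotv (gamma x - gamma s) (T x) + 2 * (x - t)).
  apply: (der_eq (derD (der_sqdist s x)
    (derM (derB (der_id x) (der_cst t x)) (derB (der_id x) (der_cst t x))))).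
  by ring.
have dt : is_derive t 1 f 0.
  apply: (@derive1_at_min _ f (t - pi * r) (t + pi * r)).
  - by have := pr0; lra.
  - by move=> x _; exact: (@ex_derive _ _ _ _ _ _ _ (df x)).
  - by rewrite in_itv/=; apply/andP; split; have := pr0; lra.
  - move=> x; rewrite in_itv/= => /andP[x1 x2].
    rewrite /f subrr expr0n addr0 -sqr_normv h.
    have := @nearly_far_apart s x `|x - t| (normr_ge0 _).
    have a1 : `|x - t| <= pi * r by rewrite ler_norml; lra.
    have a2 := ler_norm (x - t); have a3 := ler_norm (t - x).
    rewrite distrC in a3; rewrite real_normK ?num_real//.
    by move=> /(_ a1 ltac:(lra) ltac:(lra)); lra.
have := @derive_val _ _ _ _ _ _ _ (df t); rewrite (@derive_val _ _ _ _ _ _ _ dt).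
by lra.
Qed.

Lemma contact_of_antipodal s t : s + pi * r <= t -> t <= s + L - pi * r ->
  normv (gamma t - gamma s) = 2 * r -> contact s /\ contact t.
Proof.
move=> st tL h; have hp := pr0; have h1 := contact_normal st tL h.
have h2 : dotv (gamma t - gamma s) (T s) = 0.
  have := @contact_normal t (s + L) ltac:(lra) ltac:(lra).
  by rewrite pg pT normvC => /(_ h); rewrite -(opprB (gamma t)) dotvNl => /eqP; rewrite oppr_eq0 => /eqP.
split; [exists t|exists s]; split => //; try by rewrite normvC.
- by rewrite -(opprB (gamma t)) dotvNl h2 oppr0.
- by rewrite -(opprB (gamma t)) dotvNl h1 oppr0.
Qed.

(** On shorter arcs the chord has a positive component along its initial tangent, by
    Schur's comparison, and cannot be normal to the curve. *)
Lemma contact_antipode s : contact s ->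
  exists t, [/\ s + pi * r <= t, t <= s + L - pi * r & normv (gamma t - gamma s) = 2 * r].
Proof.
move=> [y [h1 h2 h3]]; have hp := pr0; have [k] := periodic_window s y L0.
rewrite -(periodicz pg k y) in h1 h2 *; move: (y + L *~ k) h1 h2 => {h3 k}t h1 h2.
move=> /andP[st tL]; exists t; split; last by rewrite normvC.
- rewrite leNgt; apply/negP => ts.
  have := schur_right r0 arc (cur s t) (lexx s) st (lexx t); rewrite /= (unit_dirv T1).
  rewrite -(opprB (gamma s) (gamma t)) dotvNl h2 oppr0 => /(_ ltac:(lra)).
  have [e|ne] := eqVneq s t.
    by move: h1; rewrite e subrr normv0 => /eqP; rewrite eq_sym mulf_eq0 pnatr_eq0/= gt_eqF.
  have st' : s < t by rewrite lt_neqAle ne.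
  suff : 0 < r * sin ((t - s) / r) by lra.
  by rewrite mulr_gt0// sin_gt0_pi// divr_gt0 ?subr_gt0//= ltr_pdivrMr//; lra.
- rewrite leNgt; apply/negP => ts.
  have := schur_left r0 arc (cur t (s + L)) (lexx t) (ltW tL) (lexx (s + L)).
  rewrite /= (unit_dirv T1) pg pT h2 => /(_ ltac:(lra)).
  suff : 0 < r * sin ((s + L - t) / r) by lra.
  by rewrite mulr_gt0// sin_gt0_pi// divr_gt0 ?subr_gt0//= ltr_pdivrMr//; lra.
Qed.

(** On a compact set of parameters free of contacts, the distance to the antipodal
    part of the curve exceeds [2 r] by a definite amount. *)
Lemma far_apart_strict u v : u <= v -> (forall s, u <= s <= v -> ~ contact s) ->
  exists2 d, 0 < d & forall s t, u <= s <= v -> s + pi * r <= t -> t <= s + L - pi * r ->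
    2 * r + d <= normv (gamma t - gamma s).
Proof.
move=> uv free; have hp := pr0; have hLr := closed_length_ge.
have hab : pi * r <= L - pi * r by lra.
have [s h suv /andP[h1 h2]|d d0 hd] := @chord_compact _ _ _ _ gT T1 _ _ _ _ (2 * r) hab uv.
  rewrite lt_neqAle far_apart ?andbT//; try lra.
  apply/eqP => e; apply: (free s suv).
  by have [] := @contact_of_antipodal s (s + h) ltac:(lra) ltac:(lra) (esym e).
exists d => // s t suv st tL; have := hd s (t - s) suv.
have -> : s + (t - s) = t by ring.
by apply; apply/andP; split; lra.
Qed.

Lemma contact_free_open s : ~ contact s ->
  exists2 e, 0 < e & forall t, `|t - s| <= e -> ~ contact t.
Proof.
move=> ns; have hp := pr0; have hLr := closed_length_ge.
have [|d d0 hd] := @far_apart_strict s s (lexx s).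
  by move=> x /andP[x1 x2]; have -> : x = s by lra.
exists (d / 3); first by rewrite divr_gt0.
move=> t ts /contact_antipode [y [h1 h2 h3]].
(* Move the antipode of [t] by [s - t]. *)
have := hd s (y + (s - t)); rewrite lexx => /(_ isT ltac:(lra) ltac:(lra)).
have e : gamma (y + (s - t)) - gamma s = (gamma (y + (s - t)) - gamma y) +
    ((gamma y - gamma t) + (gamma t - gamma s)) by rewrite !addrA !subrK.
have a1 := unit_lip_norm gT T1 y (y + (s - t)).
have a2 := unit_lip_norm gT T1 s t.
have a3 := normv_triangle (gamma (y + (s - t)) - gamma y)
  ((gamma y - gamma t) + (gamma t - gamma s)).
have a4 := normv_triangle (gamma y - gamma t) (gamma t - gamma s).
have e1 : y + (s - t) - y = - (t - s) by ring.
rewrite -e in a3; rewrite e1 normrN in a1; lra.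
Qed.

End ClosedUnitSpeed.

(** * Perturbing a closed curve *)

Section RowFunctions.
Context {R : realType} {n : nat}.
Implicit Types (f g : R -> 'rV[R]_n).

Lemma coord_continuous_row f : coord_continuous_fun f -> continuous f.
Proof.
move=> cf s; apply/cvgrPdist_lt => e e0.
near=> t.
rewrite [ltLHS]/Num.Def.normr/= mx_normrE (bigmax_lt _ e0)//= => -[i j] _.
rewrite /= (ord1 i) !mxE {i}.
move: j; near: t; apply: filter_forall => j.
by move/cvgrPdist_lt : (cf j s) => /(_ e e0).
Unshelve. all: by end_near. Qed.

Lemma row_derive f (s : R) (u : 'rV[R]_n) :
  (forall i, is_derive s 1 (fun x => f x ord0 i) (u ord0 i)) ->
  derivable f s 1 /\ derive1 f s = u.
Proof.
move=> h; have df : derivable f s 1.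
  by apply/derivable_mxP => i j; rewrite (ord1 i); exact: (@ex_derive _ _ _ _ _ _ _ (h j)).
split=> //; rewrite derive1E derive_mx//; apply/rowP => j; rewrite mxE.
exact: (@derive_val _ _ _ _ _ _ _ (h j)).
Qed.

Lemma coord_has_velocity f g :
  (forall i (s : R), is_derive s 1 (fun x => f x ord0 i) (g s ord0 i)) -> has_velocity f g.
Proof.
move=> h u s.
have hs (l : seq 'I_n) : is_derive s 1 (fun x => \sum_(i <- l) f x ord0 i * u ord0 i)
    (\sum_(i <- l) g s ord0 i * u ord0 i).
  elim: l => [|i l IH].
    by rewrite big_nil; under eq_fun do rewrite big_nil; exact: der_cst.
  rewrite big_cons; under eq_fun do rewrite big_cons.
  by apply: (der_eq (derD (derM (h i s) (der_cst _ _)) IH)); rewrite mulr0 add0r mulrC.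
exact: hs.
Qed.

Lemma has_velocity_coord f g : has_velocity f g ->
  forall i (s : R), is_derive s 1 (fun x => f x ord0 i) (g s ord0 i).
Proof.
move=> fg i s; have := fg (delta_mx 0 i) s; rewrite dotv_delta.
by under eq_fun do rewrite dotv_delta.
Qed.

Lemma derivable_has_velocity f : (forall s, derivable f s 1) -> has_velocity f (derive1 f).
Proof.
move=> df; apply: coord_has_velocity => i s.
have dfi : derivable (fun x => f x ord0 i) s 1 by move/derivable_mxP : (df s); apply.
by apply: DeriveDef => //; rewrite derive1E derive_mx// mxE.
Qed.

Definition integv f a s : 'rV[R]_n := \row_i integ (fun x => f x ord0 i) a s.

Lemma integv_coord_derive f a i (s : R) : coord_continuous_fun f ->
  is_derive s 1 (fun x => integv f a x ord0 i) (f s ord0 i).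
Proof.
move=> cf; have d := primitiveP (cf i) s; under eq_fun do rewrite mxE.
by apply: (der_eq (derB d (der_cst _ s))); rewrite subr0.
Qed.

Lemma integvxx f a : integv f a a = 0.
Proof. by apply/rowP => i; rewrite !mxE integxx. Qed.

Lemma integv_dotv f a b w : coord_continuous_fun f -> a <= b ->
  dotv (integv f a b) w = integ (fun s => dotv (f s) w) a b.
Proof.
move=> cf ab; have d := coord_has_velocity (fun i s => integv_coord_derive a i s cf).
have cw : continuous (fun s => dotv (f s) w).
  by apply: continuous_dotv => //; exact: coord_continuous_cst.
by rewrite (integE ab cw (fun s _ => d w s)) integvxx dot0v subr0.
Qed.

Lemma arclengthE f (a b : R) : a <= b -> coord_continuous_fun (derive1 f) ->
  arclength f a b = integ (fun s => normv (derive1 f s)) a b.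
Proof.
move=> ab cf; have cn := continuous_normv cf; rewrite /arclength.
have [->|nab] := eqVneq a b.
  by rewrite integxx set_itv1 Rintegral_set1.
have {}ab : a < b by rewrite lt_neqAle nab.
set g := fun s => normv _ in cn *.
have dG := primitiveP cn.
have cG := is_derive_continuous dG.
rewrite /Rintegral (@continuous_FTC2 _ g (primitive g) a b ab)//.
- exact: continuous_subspaceT.
- split.
  + by move=> x _; exact: (@ex_derive _ _ _ _ _ _ _ (dG x)).
  + exact/cvg_at_right_filter/cG.
  + exact/cvg_at_left_filter/cG.
- by move=> x _; rewrite derive1E; exact: (@derive_val _ _ _ _ _ _ _ (dG x)).
Qed.

End RowFunctions.

Section Periodization.
Context {R : realType} {W : zmodType}.
Variables (L u v : R).
Hypotheses (L0 : 0 < L) (uv : u <= v) (vuL : v - u < L).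

(** The [L]-periodic function that agrees with [f] on the period [[u, u + L[]. *)
Definition periodize (f : R -> W) s := f (s + L *~ sval (cid (periodic_window u s L0))).

Definition supported (f : R -> W) := forall s, ~ (u < s < v) -> f s = 0.

Lemma periodizeE f s (k : int) : supported f ->
  v - L <= s + L *~ k -> s + L *~ k <= u + L -> periodize f s = f (s + L *~ k).
Proof.
move=> f0 h1 h2; rewrite /periodize; case: cid => m /= /andP[h3 h4].
have [->//|nkm] := eqVneq k m.
have e : s + L *~ k = s + L *~ m + (k - m)%:~R * L.
  by rewrite -addrA mulrzl -mulrzDr; congr (_ + _ *~ _); rewrite addrC subrK.
have out x : x <= u \/ v <= x -> f x = 0.
  by move=> hx; apply: f0 => /andP[? ?]; case: hx; rewrite leNgt => /negP; apply.
have [km|km] : k - m <= -1 \/ 1 <= k - m.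
  by move: nkm; rewrite neq_lt => /orP[]; rewrite -lezD1 => ?; [left|right]; lra.
- have : (k - m)%:~R * L <= - L.
    by rewrite -[leRHS]mulN1r ler_pM2r// -(mulrNz 1 1) ler_int.
  move=> ?; rewrite (out (s + L *~ k)); last by left; lra.
  by rewrite (out (s + L *~ m))//; right; lra.
- have : L <= (k - m)%:~R * L.
    by rewrite -[leLHS]mul1r ler_pM2r// -(mulr1z 1) ler_int.
  move=> H; rewrite (out (s + L *~ k)).
    rewrite (out (s + L *~ m))//; left; rewrite e in h2.
    by move: h2 vuL H; clear; move: (_ *~ _) (_ * _) => A B; lra.
  by right; rewrite e; move: h3 vuL H; clear; move: (_ *~ _) (_ * _) => A B; lra.
Qed.

Lemma periodize_center s : exists k : int,
  (u + v - L) / 2 <= s + L *~ k < (u + v + L) / 2.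
Proof.
have [k /andP[h1 h2]] := periodic_window ((u + v - L) / 2) s L0.
by exists k; apply/andP; split => //; lra.
Qed.

Lemma periodize_periodic f : supported f -> periodic (periodize f) L.
Proof.
move=> f0 s; have [k /andP[h1 h2]] := periodize_center s.
have [h3 h4] : v - L <= s + L *~ k /\ s + L *~ k <= u + L.
  by move: h1 h2 vuL; clear; move: (_ *~ _) => A ? ? ?; split; lra.
rewrite (periodizeE f0 h3 h4).
have e : s + L + L *~ (k - 1) = s + L *~ k by rewrite mulrzBr mulr1z; ring.
by rewrite (@periodizeE f (s + L) (k - 1) f0) e.
Qed.

Lemma periodize_near f s : supported f -> exists2 k : int, v - L < s + L *~ k < u + L &
  \forall x \near s, periodize f x = f (x + L *~ k).
Proof.
move=> f0; have [k /andP[h1 h2]] := periodize_center s; exists k.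
  by move: h1 h2 vuL; clear; move: (_ *~ _) => A ? ? ?; apply/andP; split; lra.
have e0 : 0 < (L - (v - u)) / 2 by rewrite divr_gt0// subr_gt0.
near=> x.
have : `|s - x| < (L - (v - u)) / 2.
  by near: x; apply: (@cvgr_dist_lt _ _ _ _ _ id s).
rewrite ltr_norml => /andP[h3 h4].
have [h5 h6] : v - L <= x + L *~ k /\ x + L *~ k <= u + L.
  by move: h1 h2 h3 h4 vuL; clear; move: (_ *~ _) => A ? ? ? ? ?; split; lra.
exact: periodizeE.
Unshelve. all: by end_near. Qed.

End Periodization.

Lemma window_bounds {R : realType} (L u v x y A : R) : v - u < L ->
  x <= y -> y - x < (L - (v - u)) / 2 -> (u + v - L) / 2 <= x + A < (u + v + L) / 2 ->
  [/\ v - L <= x + A, x + A <= u + L, v - L <= y + A & y + A <= u + L].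
Proof. by move=> ? ? ? /andP[? ?]; split; lra. Qed.

Section CloseCurves.
Context {R : realType} {n : nat}.
Variables (gamma T : R -> 'rV[R]_n) (r L : R).
Hypotheses (r0 : 0 < r) (L0 : 0 < L).
Hypotheses (gT : has_velocity gamma T) (T1 : forall s, dotv (T s) (T s) = 1).
Hypotheses (pg : periodic gamma L) (pT : periodic T L).
Hypotheses (TL : forall s t, normv (T s - T t) <= r^-1 * `|s - t|).
Hypotheses (tb : outside_tangent_balls gamma T r).
Hypotheses (inj : forall s t, s < t -> t < s + L -> gamma t != gamma s).

Let arc := unit_arc_curve gT T1.
Let cur a b : curvature_le T id r a b := lip_curvature_le r0 T1 TL.
Arguments cur : clear implicits.
Let pr0 : 0 < pi * r := mulr_gt0 (pi_gt0 R) r0.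

(** By Schur's comparison, arcs of length at most [pi r] advance in their middle direction
    at an average speed of at least [1 / 4], which a change [e1] of the velocity cannot
    undo; the ends of the other arcs are [2 r] apart and move by at most [e2] each. *)
Lemma close_injective eta q (e1 e2 : R) : e1 < 1 / 4 -> e2 < r ->
  has_velocity eta q -> periodic eta L ->
  (forall s, normv (q s - T s) <= e1) -> (forall s, normv (eta s - gamma s) <= e2) ->
  forall s t, s < t -> t < s + L -> eta t != eta s.
Proof.
move=> e1l e2r eq pe qT eg; have hp := pr0.
have e10 : 0 <= e1 by apply: le_trans (qT 0); exact: normv_ge0.
have short s t : s < t -> t - s <= pi * r -> eta t != eta s.
  move=> st l; apply/eqP => et.
  have [m _] := schur_mid r0 arc (cur s t) (lexx s) (ltW st) (lexx t) ltac:(rewrite /=; lra).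
  rewrite /= (unit_dirv T1) => h.
  have a0 : 0 <= (t - s) / (2 * r) by rewrite divr_ge0 ?subr_ge0 ?mulr_ge0// ltW.
  have a1 : (t - s) / (2 * r) <= pi / 2 by rewrite ler_pdivrMr ?mulr_gt0//; lra.
  have := @sin_ge_quarter R ((t - s) / (2 * r)); rewrite a0 a1 => /(_ isT) h1.
  have h2 : (t - s) / 4 <= dotv (gamma t - gamma s) (T m).
    apply: le_trans h.
    have -> : (t - s) / 4 = 2 * r * ((t - s) / (2 * r) / 4) by field; rewrite gt_eqF.
    by rewrite ler_wpM2l ?mulr_ge0// ltW.
  have vel : has_velocity (fun x => eta x - gamma x) (fun x => q x - T x).
    move=> w x; rewrite dotvDl dotvNl.
    under eq_fun do rewrite dotvDl dotvNl.
    exact: (derB (eq w x) (gT w x)).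
  have h3 := has_velocity_lip vel (ltW st) e10 (fun x _ => qT x).
  have h4 := dotv_ge (eta t - gamma t - (eta s - gamma s)) (T m).
  rewrite (unit_normv T1) mulr1 in h4.
  have e : eta t - gamma t - (eta s - gamma s) = - (gamma t - gamma s).
    by rewrite et; apply/rowP => i; rewrite !mxE; ring.
  rewrite e dotvNl in h4; rewrite e in h3.
  have : e1 * (t - s) < (t - s) / 4 by rewrite mulrC ltr_pM2l ?subr_gt0//; lra.
  by lra.
move=> s t st tL.
have [l1|/ltW l1] := leP (t - s) (pi * r); first exact: short.
have [l2|/ltW l2] := leP (s + L - t) (pi * r).
  by rewrite eq_sym -(pe s); apply: short.
have h := @far_apart _ _ _ _ _ _ r0 L0 gT T1 pg TL tb inj s t ltac:(lra) ltac:(lra).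
apply/eqP => et.
have e : gamma t - gamma s = (eta s - gamma s) - (eta t - gamma t).
  by rewrite et; apply/rowP => i; rewrite !mxE; ring.
have := normv_triangleB (eta s - gamma s) (eta t - gamma t); rewrite -e.
by have := eg s; have := eg t; lra.
Qed.

End CloseCurves.

Section Perturbation.
Context {R : realType} {n : nat}.
Variables (gamma T : R -> 'rV[R]_n) (r L : R).
Hypotheses (r0 : 0 < r) (L0 : 0 < L).
Hypotheses (gT : has_velocity gamma T) (T1 : forall s, dotv (T s) (T s) = 1).
Hypotheses (pg : periodic gamma L) (pT : periodic T L).
Hypotheses (TL : forall s t, normv (T s - T t) <= r^-1 * `|s - t|).
Hypotheses (tb : outside_tangent_balls gamma T r).
Hypotheses (inj : forall s t, s < t -> t < s + L -> gamma t != gamma s).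
Variables (u v : R).
Hypotheses (uv : u < v) (vuL : v - u < L).
Variables (q : R -> 'rV[R]_n) (e k : R).
Hypotheses (e0 : 0 < e) (e1 : e < 1 / 4).
Hypotheses (qk : forall s t, normv (q s - q t) <= k * `|s - t|).
Hypothesis qout : forall s, ~ (u < s < v) -> q s = T s.
Hypothesis qe : forall s, normv (q s - T s) <= e.
Hypothesis qdisp : forall w,
  integ (fun s => dotv (q s) w) u v = integ (fun s => dotv (T s) w) u v.
Hypothesis qcur : curvature_le q (primitive (fun s => normv (q s))) r u v.

Let arc := unit_arc_curve gT T1.
Let cur a b : curvature_le T id r a b := lip_curvature_le r0 T1 TL.
Arguments cur : clear implicits.
Let pr0 : 0 < pi * r := mulr_gt0 (pi_gt0 R) r0.

Definition bump_velocity s := q s - T s.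

(** The displacement between the arcs of velocities [q] and [T] that leave [gamma u]
    together; by [qdisp] they also arrive together. *)
Definition bump := integv bump_velocity u.

Let cT : coord_continuous_fun T := lipschitz_coord_continuous TL.
Let cq : coord_continuous_fun q := lipschitz_coord_continuous qk.

Lemma bump_velocity_coord_continuous : coord_continuous_fun bump_velocity.
Proof.
move=> i; rewrite /bump_velocity; under eq_fun do rewrite !mxE.
by move=> s; apply: continuousB; [exact: cq|exact: cT].
Qed.

Lemma bump_velocity_supported : supported u v bump_velocity.
Proof. by move=> s /qout qs; rewrite /bump_velocity qs subrr. Qed.

Lemma bump_coord_derive i (s : R) :
  is_derive s 1 (fun x => bump x ord0 i) (bump_velocity s ord0 i).
Proof.
exact/integv_coord_derive/bump_velocity_coord_continuous.
Qed.

Lemma bump_supported : supported u v bump.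
Proof.
have c0 i : continuous (fun x => bump_velocity x ord0 i).
  exact: bump_velocity_coord_continuous.
have z a b i : a <= b -> (forall x, a <= x <= b -> ~ (u < x < v)) ->
    integ (fun x => bump_velocity x ord0 i) a b = 0.
  move=> ab h; rewrite (@eq_integ _ _ (fun=> 0) _ _ ab (c0 i)).
  - by rewrite integ_cst mul0r.
  - exact: cst_continuous.
  - by move=> x /h /bump_velocity_supported ->; rewrite mxE.
move=> s hs; apply/rowP => i; rewrite !mxE.
have [su|/ltW us] := leP s u.
  have := z s u i su; rewrite /integ => hz.
  have {}hz := hz ltac:(by move=> x /andP[? ?] /andP[? ?]; lra).
  by apply/eqP; rewrite -oppr_eq0 opprB; apply/eqP.
have [vs|sv] := leP v s; last first.
  have -> : s = u; last exact: integxx.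
  apply/eqP; rewrite eq_le us andbT leNgt; apply/negP => ?.
  by apply: hs; apply/andP.
rewrite (integ_split _ _ v) (z v s)//; last by move=> x /andP[? ?] /andP[? ?]; lra.
rewrite addr0; have := qdisp (delta_mx 0 i).
have cE (f : R -> 'rV[R]_n) : (fun x => dotv (f x) (delta_mx 0 i)) = (fun x => f x ord0 i).
  by apply/funext => x; exact: dotv_delta.
rewrite !cE => h.
rewrite /bump_velocity.
have -> : (fun x => (q x - T x) ord0 i) = (fun x => q x ord0 i - T x ord0 i).
  by apply/funext => x; rewrite !mxE.
by rewrite (integB (ltW uv) (@cq i) (@cT i)) h subrr.
Qed.

Lemma bump_small s : normv (bump s) <= e * (v - u).
Proof.
have vel := coord_has_velocity bump_coord_derive.
have [suv|/bump_supported ->] := pselect (u < s < v); last first.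
  by rewrite normv0 mulr_ge0// ?subr_ge0 ltW.
have /andP[us sv] := suv.
have bu : bump u = 0 by apply: bump_supported; rewrite ltxx.
have := has_velocity_lip vel (ltW us) (ltW e0) (fun x _ => qe x).
rewrite bu subr0 => h; apply: le_trans h _.
by rewrite ler_pM2l//; lra.
Qed.

Local Notation per := (periodize u L0).

Lemma periodize_bump_coord_derive i (s : R) :
  is_derive s 1 (fun x => per bump x ord0 i) (per bump_velocity s ord0 i).
Proof.
have [m /andP[h1 h2] hm] := periodize_near L0 vuL s bump_supported.
rewrite (periodizeE L0 vuL bump_velocity_supported (ltW h1) (ltW h2)).
have d := @der_comp R (fun x => bump x ord0 i) (fun x => x + L *~ m) s _ _
  (bump_coord_derive i (s + L *~ m)) (derD (der_id s) (der_cst (L *~ m) s)).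
rewrite addr0 mulr1 in d.
apply: (@near_eq_is_derive _ _ _ _ _ s 1 _ _ d).
by near=> x; rewrite (near hm x).
Unshelve. all: by end_near. Qed.

(** The perturbed curves, [tau] running from [0] to [1]. *)
Definition perturb (tau : R) s := gamma s + tau *: per bump s.
Definition perturb_velocity (tau : R) s := T s + tau *: per bump_velocity s.

Lemma perturb_has_velocity tau : has_velocity (perturb tau) (perturb_velocity tau).
Proof.
apply: coord_has_velocity => i s; rewrite /perturb /perturb_velocity.
have E (a b : 'rV[R]_n) : (a + tau *: b) ord0 i = a ord0 i + tau * b ord0 i by rewrite !mxE.
rewrite E; under eq_fun do rewrite E.
exact: (derD (has_velocity_coord gT i s) (derZ tau (periodize_bump_coord_derive i s))).
Qed.

Lemma perturb_periodic tau : periodic (perturb tau) L.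
Proof.
by move=> s; rewrite /perturb pg (periodize_periodic L0 vuL bump_supported).
Qed.

Lemma perturb_velocity_periodic tau : periodic (perturb_velocity tau) L.
Proof.
move=> s; rewrite /perturb_velocity pT.
by rewrite (periodize_periodic L0 vuL bump_velocity_supported).
Qed.

Lemma perturb_velocity_close tau s : 0 <= tau <= 1 ->
  normv (perturb_velocity tau s - T s) <= e.
Proof.
move=> /andP[t0 t1]; rewrite /perturb_velocity addrC addKr normvZ ger0_norm//.
apply: le_trans (_ : 1 * e <= e); last by rewrite mul1r.
by apply: ler_pM => //; [exact: normv_ge0|exact: qe].
Qed.

Lemma perturb_close tau s : 0 <= tau <= 1 -> normv (perturb tau s - gamma s) <= e * L.
Proof.
move=> /andP[t0 t1]; rewrite /perturb addrC addKr normvZ ger0_norm//.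
apply: le_trans (_ : 1 * (e * (v - u)) <= _); last by rewrite mul1r ler_pM2l// ltW.
by apply: ler_pM => //; [exact: normv_ge0|exact: bump_small].
Qed.

Lemma perturb_velocity_shift s (m : int) : v - L <= s + L *~ m -> s + L *~ m <= u + L ->
  perturb_velocity 1 s = q (s + L *~ m).
Proof.
move=> h1 h2; rewrite /perturb_velocity scale1r.
rewrite (periodizeE L0 vuL bump_velocity_supported h1 h2) /bump_velocity.
by rewrite (periodicz pT m) addrC subrK.
Qed.

Lemma perturb_velocity_window s : v - L <= s -> s <= u + L -> perturb_velocity 1 s = q s.
Proof.
move=> h1 h2; have := @perturb_velocity_shift s 0; rewrite mulr0z addr0; exact.
Qed.

Lemma perturb_outside s : v - L <= s -> s <= u + L -> ~ (u < s < v) ->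
  perturb 1 s = gamma s.
Proof.
move=> h1 h2 hs; rewrite /perturb scale1r.
rewrite (@periodizeE _ _ _ _ _ L0 vuL _ s 0 bump_supported) mulr0z addr0//.
by rewrite bump_supported ?addr0.
Qed.

Local Notation eta := (perturb 1).
Local Notation Q := (perturb_velocity 1).
Local Notation Lam := (primitive (fun s => normv (Q s))).

Let Qe s : normv (Q s - T s) <= e.
Proof. by apply: perturb_velocity_close; rewrite ler01 lexx. Qed.

Lemma perturb_velocity_lip s t : normv (Q s - Q t) <= k * `|s - t|.
Proof.
have w0 : 0 < (L - (v - u)) / 2 by rewrite divr_gt0// subr_gt0.
have main x y : x <= y -> normv (Q x - Q y) <= k * (y - x).
  apply: (lipschitz_local_global w0) => {}x {}y xy yx.
  have [m hm] := periodize_center u v L0 x.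
  have [h3 h4 h5 h6] := window_bounds vuL xy yx hm.
  rewrite (perturb_velocity_shift h3 h4) (perturb_velocity_shift h5 h6).
  apply: le_trans (qk _ _) _.
  have -> : x + L *~ m - (y + L *~ m) = - (y - x) by ring.
  by rewrite normrN ger0_norm ?subr_ge0.
have [st|/ltW ts] := leP s t.
  by rewrite distrC ger0_norm ?subr_ge0// main.
by rewrite normvC ger0_norm ?subr_ge0// main.
Qed.

Lemma perturb_velocity_neq0 s : Q s != 0.
Proof.
apply/eqP => Qs0; have := Qe s; rewrite Qs0 sub0r normvN (unit_normv T1).
by apply/negP; rewrite -ltNge (lt_trans e1)//; lra.
Qed.

Lemma perturb_arc : arc_curve eta Q Lam.
Proof.
split; [exact: perturb_has_velocity| |exact: perturb_velocity_neq0].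
apply: primitiveP; apply: continuous_normv.
exact: (lipschitz_coord_continuous perturb_velocity_lip).
Qed.

Let dLam (s : R) : is_derive s 1 Lam (normv (Q s)).
Proof. by case: perturb_arc. Qed.

Let dnq (s : R) : is_derive s 1 (primitive (fun s => normv (q s))) (normv (q s)).
Proof. by apply: primitiveP; exact: continuous_normv. Qed.

Let dnT (s : R) : is_derive s 1 id (normv (T s)).
Proof. by rewrite (unit_normv T1); exact: der_id. Qed.

Let QT s : v - L <= s -> s <= u + L -> ~ (u < s < v) -> Q s = T s.
Proof. by move=> h1 h2 hs; rewrite perturb_velocity_window// qout. Qed.

Lemma perturb_curvature_window : curvature_le Q Lam r (v - L) (u + L).
Proof.
have [huv hvuL] := (uv, vuL).
have hL := arc_curve_homo perturb_arc.
apply: (@curvature_le_cat _ _ _ _ _ _ u) => //.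
- exact: perturb_velocity_neq0.
- by lra.
- by lra.
- apply: (curvature_le_congr dLam dnT _ (cur _ _)) => s /andP[h1 h2].
  by apply: QT => //; [lra|move=> /andP[? ?]; lra].
apply: (@curvature_le_cat _ _ _ _ _ _ v) => //.
- exact: perturb_velocity_neq0.
- by rewrite ltW.
- by lra.
- apply: (curvature_le_congr dLam dnq _ qcur) => s /andP[h1 h2].
  by apply: perturb_velocity_window; lra.
- apply: (curvature_le_congr dLam dnT _ (cur _ _)) => s /andP[h1 h2].
  by apply: QT => //; [lra|move=> /andP[? ?]; lra].
Qed.

Lemma perturb_arclength_shift (m : int) s t :
  Lam (t + L *~ m) - Lam (s + L *~ m) = Lam t - Lam s.
Proof.
have per1 x y : x <= y -> Lam (y + L) - Lam y = Lam (x + L) - Lam x.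
  move=> xy; symmetry; apply: (@derive0_const _ (fun z => Lam (z + L) - Lam z) x y xy).
  move=> z _; have d := @der_comp R Lam (fun z => z + L) z _ _
    (dLam (z + L)) (derD (der_id z) (der_cst L z)).
  apply: (der_eq (derB d (dLam z))).
  by rewrite perturb_velocity_periodic addr0 mulr1 subrr.
pose F x := Lam (x + (t - s)) - Lam x.
have pF : periodic F L.
  move=> x; rewrite /F; have -> : x + L + (t - s) = x + (t - s) + L by ring.
  have [h|/ltW h] := leP x (x + (t - s)); first by have := per1 _ _ h; lra.
  by have := per1 _ _ h; lra.
have := periodicz pF m s; rewrite /F.
have -> : s + L *~ m + (t - s) = t + L *~ m by ring.
by have -> : s + (t - s) = t by ring.
Qed.

(** The window [[v - L, u + L]], where the perturbed velocity is [q], is longer than a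
    period; chaining its translates covers every interval. *)
Lemma perturb_curvature a b : curvature_le Q Lam r a b.
Proof.
have [huv hvuL] := (uv, vuL).
have hL0 := L0.
have hL := arc_curve_homo perturb_arc.
have shift (m : int) a' b' : curvature_le Q Lam r (a' + L *~ m) (b' + L *~ m) ->
    curvature_le Q Lam r a' b'.
  move=> h s t as_ st tb_ l; have := h (s + L *~ m) (t + L *~ m).
  rewrite perturb_arclength_shift !(periodicz (perturb_velocity_periodic 1)).
  by rewrite !lerD2r; apply.
have many (N : nat) : curvature_le Q Lam r (v - L) (u + L + L *+ N).
  elim: N => [|N IH]; first by rewrite mulr0n addr0; exact: perturb_curvature_window.
  have LN : 0 <= L *+ N by rewrite mulrn_wge0// ltW.
  apply: (@curvature_le_cat _ _ _ _ _ _ (u + L + L *+ N)) => //.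
  - exact: perturb_velocity_neq0.
  - by lra.
  - by rewrite lerD2l ler_wpMn2l// ltW.
  - apply: (shift (- (N.+1)%:Z)).
    apply: (@curvature_le_sub _ _ _ _ _ (v - L) (u + L)); last exact: perturb_curvature_window.
      by rewrite mulrNz -pmulrn mulrSr; lra.
    by rewrite mulrNz -pmulrn; lra.
have [m /andP[h1 h2]] := periodic_window (v - L) a L0.
apply: (shift m); pose N := `|Num.ceil ((b + L *~ m - u) / L)|%N.
apply: (@curvature_le_sub _ _ _ _ _ (v - L) (u + L + L *+ N)) => //.
have : (b + L *~ m - u) / L <= N%:R.
  apply: le_trans (ceil_ge _) _; rewrite natr_absz ler_int; exact: ler_norm.
by rewrite ler_pdivrMr// -mulr_natl; lra.
Qed.

Lemma perturb_arclength_le s t : s <= t -> Lam t - Lam s <= (1 + e) * (t - s).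
Proof.
move=> st.
have d (x : R) : s <= x <= t -> is_derive x 1 (fun x => (1 + e) * x - Lam x)
    (1 + e - normv (Q x)).
  by move=> _; apply: (der_eq (derB (derZ _ (der_id x)) (dLam x))); rewrite mulr1.
have := derive_nondecreasing st d => h.
suff /h : forall x, s <= x <= t -> 0 <= 1 + e - normv (Q x) by lra.
move=> x _; have := normv_sub (Q x) (T x); rewrite (unit_normv T1).
by have := Qe x; lra.
Qed.

Lemma perturb_length :
  integ (fun s => normv (Q s)) 0 L = L - (v - u) + integ (fun s => normv (q s)) u v.
Proof.
have [huv hvuL] := (uv, vuL).
have h1 := perturb_arclength_shift 1 0 u; rewrite mulr1z add0r in h1.
have h2 : Lam v - Lam u = integ (fun s => normv (q s)) u v.
  apply: (arclength_congr (a := u) (b := v) dLam dnq _ (lexx u) (ltW uv) (lexx v)).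
  by move=> z /andP[? ?]; apply: perturb_velocity_window; lra.
have h3 : Lam (u + L) - Lam v = u + L - v.
  apply: (arclength_congr (a := v) (b := u + L) dLam dnT) => //; last by lra.
  by move=> z /andP[? ?]; apply: QT => //; [lra|move=> /andP[? ?]; lra].
rewrite -/(Lam) /integ in h1 h2 h3 *; lra.
Qed.

Hypothesis qshort : integ (fun s => normv (q s)) u v <= v - u.

(** Between points that are not moved, arcs only get shorter. *)
Lemma perturb_arclength_outside s t : v - L <= s -> s <= t -> t <= u + L ->
  ~ (u < s < v) -> ~ (u < t < v) -> Lam t - Lam s <= t - s.
Proof.
have [huv hvuL] := (uv, vuL).
move=> h1 st h2 hs ht.
have out x : ~ (u < x < v) -> x <= u \/ v <= x.
  move=> hx; have [|ux] := leP x u; first by left.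
  by right; rewrite leNgt; apply/negP => xv; apply: hx; rewrite ux.
have left_ x y : v - L <= x -> x <= y -> y <= u -> Lam y - Lam x = y - x.
  move=> xl xy yu; apply: (arclength_congr (a := v - L) (b := u) dLam dnT) => //.
  by move=> z /andP[? ?]; apply: QT => //; [lra|move=> /andP[? ?]; lra].
have right_ x y : v <= x -> x <= y -> y <= u + L -> Lam y - Lam x = y - x.
  move=> xl xy yu; apply: (arclength_congr (a := v) (b := u + L) dLam dnT) => //.
  by move=> z /andP[? ?]; apply: QT => //; [lra|move=> /andP[? ?]; lra].
have mid : Lam v - Lam u <= v - u.
  have := arclength_congr (a := u) (b := v) dLam dnq _ (lexx u) (ltW uv) (lexx v).
  rewrite -/(integ _ u v) => h; apply: le_trans qshort; rewrite h//.
  by move=> z /andP[? ?]; apply: perturb_velocity_window; lra.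
have [su|vs] := out s hs; have [tu|vt] := out t ht.
- by rewrite left_.
- by have := left_ s u h1 su (lexx u); have := right_ v t (lexx v) vt h2; lra.
- by lra.
- by rewrite right_.
Qed.

Variable d : R.
Hypothesis ed : 3 * (e * L) <= d.
Hypothesis far_strict : forall s t, u <= s <= v -> s + pi * r <= t ->
  t <= s + L - pi * r -> 2 * r + d <= normv (gamma t - gamma s).

Let eta_close s : normv (eta s - gamma s) <= e * L.
Proof. by apply: perturb_close; rewrite ler01 lexx. Qed.

(** The gap [d] between the perturbed arc and its antipodes pays for the displacement of
    both points and for the change of arclength between them. *)
Lemma perturb_far_inside s t : u <= s <= v -> s <= t -> t <= s + L ->
  pi * r <= Lam t - Lam s -> pi * r <= Lam (s + L) - Lam t ->
  2 * r <= normv (eta t - eta s).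
Proof.
move=> suv st tL l1 l2; have hp := pr0; have [hL0 hed] := (L0, ed).
have hLr := closed_length_ge r0 L0 gT T1 pg TL.
have a1 : pi * r - e * L <= t - s.
  have := perturb_arclength_le st.
  have : e * (t - s) <= e * L by rewrite ler_pM2l//; lra.
  by lra.
have a2 : pi * r - e * L <= s + L - t.
  have := perturb_arclength_le tL.
  have : e * (s + L - t) <= e * L by rewrite ler_pM2l//; lra.
  by lra.
have [t' [b1 b2 b3]] : exists t', [/\ s + pi * r <= t', t' <= s + L - pi * r &
    `|t - t'| <= e * L].
  have eL : 0 <= e * L by rewrite mulr_ge0// ltW.
  have [c1|c1] := leP t (s + pi * r).
    by exists (s + pi * r); split; [lra|lra|rewrite ler_norml; apply/andP; split; lra].
  have [c2|c2] := leP (s + L - pi * r) t.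
    by exists (s + L - pi * r); split; [lra|lra|rewrite ler_norml; apply/andP; split; lra].
  by exists t; split; [lra|lra|rewrite subrr normr0].
have f1 := far_strict suv b1 b2.
have f2 := unit_lip_norm gT T1 t t'; rewrite distrC in f2.
have f3 := eta_close t; have f4 := eta_close s.
have f5 : normv (gamma t' - gamma s) <= normv (gamma t' - gamma t) +
    (normv (gamma t - eta t) + (normv (eta t - eta s) + normv (eta s - gamma s))).
  apply: le_trans (normv_dist _ (gamma t) _) _; rewrite lerD2l.
  apply: le_trans (normv_dist _ (eta t) _) _; rewrite lerD2l.
  exact: normv_dist.
rewrite (normvC (gamma t) (eta t)) in f5; lra.
Qed.

(** If neither end is moved, the two arcs of the original curve between them are at least
    as long as those of the perturbed one, so that [far_apart] applies. *)
Lemma perturb_far s t : s <= t -> t <= s + L ->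
  pi * r <= Lam t - Lam s -> pi * r <= Lam (s + L) - Lam t ->
  2 * r <= normv (eta t - eta s).
Proof.
have [huv hvuL] := (uv, vuL).
have [hp hL0] := (pr0, L0).
wlog hs : s t / v - L <= s < v.
  move=> h st tL l1 l2; have [m /andP[h1 h2]] := periodic_window (v - L) s L0.
  have := h (s + L *~ m) (t + L *~ m).
  rewrite !(periodicz (perturb_periodic 1)) addrAC !perturb_arclength_shift.
  by apply => //; [apply/andP; split; lra|rewrite lerD2r|rewrite lerD2r].
move: hs => /andP[h1 h2] st tL l1 l2.
have [us|su] := leP u s; first by apply: perturb_far_inside => //; rewrite us ltW.
have [tuv|tuv] := pselect (u < t < v).
  rewrite normvC -(perturb_periodic 1 s); move: tuv => /andP[ut tv].
  apply: perturb_far_inside => //; first by rewrite !ltW.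
    by lra.
  by have := perturb_arclength_shift 1 s t; rewrite mulr1z; lra.
have suv : ~ (u < s < v) by move=> /andP[? ?]; lra.
have [tl|tl] := leP t (u + L); last first.
  (* Impossible, as [t <= s + L] and [s < u]. *)
  by lra.
have p1 := perturb_arclength_outside h1 st tl suv tuv.
rewrite !perturb_outside//; try lra.
have sL : s + L <= u + L by lra.
have sLuv : ~ (u < s + L < v) by move=> /andP[? ?]; lra.
have p2 := perturb_arclength_outside (le_trans h1 st) tL sL tuv sLuv.
by apply: (@far_apart _ _ _ _ _ _ r0 L0 gT T1 pg TL tb inj); lra.
Qed.

Lemma perturb_outside_tangent_balls : outside_tangent_balls eta Q r.
Proof.
apply: (outside_tangent_balls_far r0 L0 perturb_arc) => //.
- exact: perturb_curvature.
- exact: perturb_periodic.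
- exact: perturb_velocity_periodic.
- exact: perturb_far.
Qed.

End Perturbation.

(** * Relatively extremal knots are locally shortest *)

(** Along [u, v], the arc with unit tangent [T] is shortest among the arcs with the
    same end conditions, curvature at most [1 / r] and nearby velocity [q]; the
    competitors are encoded by velocities on the whole line that agree with [T] off
    the interval. *)
Definition locally_shortest {R : realType} {n : nat} (T : R -> 'rV[R]_n) (r u v : R) :=
  exists2 e, 0 < e & forall (q : R -> 'rV[R]_n) k,
    (forall s t, normv (q s - q t) <= k * `|s - t|) ->
    (forall s, ~ (u < s < v) -> q s = T s) ->
    (forall s, normv (q s - T s) <= e) ->
    (forall w, integ (fun s => dotv (q s) w) u v = integ (fun s => dotv (T s) w) u v) ->
    curvature_le q (primitive (fun s => normv (q s))) r u v ->
    v - u <= integ (fun s => normv (q s)) u v.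

Section UnitSpeedKnot.
Context {R : realType} {n : nat}.
Variables (L : R) (gamma : R -> 'rV[R]_n).
Hypotheses (L0 : 0 < L) (knot : simple_C11_closed L gamma) (unit : unit_speed gamma).

Local Notation T := (derive1 gamma).

Lemma knot_has_velocity : has_velocity gamma T.
Proof. by case: knot => -[_ d _] _ _ _; exact: derivable_has_velocity. Qed.

Lemma knot_unit s : dotv (T s) (T s) = 1.
Proof. exact/normv_unit/unit. Qed.

Lemma knot_periodic : periodic gamma L.
Proof. by case: knot => -[]. Qed.

Lemma knot_velocity_periodic : periodic T L.
Proof.
move=> s; apply/rowP => i.
have d1 := has_velocity_coord knot_has_velocity i s.
have d2 := @der_comp R (fun x => gamma x ord0 i) (fun x => x + L) s _ _
  (has_velocity_coord knot_has_velocity i (s + L)) (derD (der_id s) (der_cst L s)).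
rewrite addr0 mulr1 in d2.
have e : (fun x => gamma (x + L) ord0 i) = (fun x => gamma x ord0 i).
  by apply/funext => x; rewrite knot_periodic.
rewrite e in d2.
by rewrite -(@derive_val _ _ _ _ _ _ _ d1) (@derive_val _ _ _ _ _ _ _ d2).
Qed.

Lemma knot_injective s t : s < t -> t < s + L -> gamma t != gamma s.
Proof.
move=> st tL; apply/eqP => /[dup] ts; have [_ inj _ _] := knot.
move=> /inj [k e]; have hL := L0; rewrite e in st tL.
have k1 : (k%:~R : R) < 0.
  by rewrite -(@pmulr_rlt0 _ L)//; rewrite mulrC; lra.
have k2 : -1 < (k%:~R : R).
  by rewrite -(ltr_pM2r L0); lra.
have : k < 0 by rewrite -(ltr_int R).
have : -1 < k by rewrite -(ltr_int R) mulrNz.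
by case: k {e st tL k1 k2} => // -[].
Qed.

Lemma knot_neq0 s : T s != 0.
Proof. by case: knot. Qed.

Lemma knot_lip : exists K, forall s t, normv (T s - T t) <= K * `|s - t|.
Proof. by case: knot. Qed.

Lemma knot_ball_radius_lip r : 0 < r -> (r%:E <= ball_radius gamma)%E ->
  outside_tangent_balls gamma T r /\
  forall s t, normv (T s - T t) <= r^-1 * `|s - t|.
Proof.
move=> r0 hr; have tb := ball_radius_outside r0 knot_neq0 hr; split=> //.
have [K TK] := knot_lip.
exact: (outside_tangent_balls_lip r0 knot_has_velocity knot_unit TK tb).
Qed.

(** Otherwise the curvature would be at most [1 / L], and a curve that closes up under this
    bound has length at least [2 pi L]. *)
Lemma knot_ball_radius_lt : (ball_radius gamma < L%:E)%E.
Proof.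
rewrite ltNge; apply/negP => h; have [tb TL] := knot_ball_radius_lip L0 h.
have := closed_length_ge L0 L0 knot_has_velocity knot_unit knot_periodic TL.
have := @pi_ge2 R => hpi; have hL := L0.
have : 2 * L <= pi * L by rewrite ler_pM2r.
by lra.
Qed.

(** Short arcs avoid small tangent balls by the curvature bound, long ones by compactness. *)
Lemma knot_ball_radius_gt : exists2 r, 0 < r & (r%:E <= ball_radius gamma)%E.
Proof.
have [K TK] := knot_lip; pose r1 := (`|K| + 1)^-1.
have K0 : 0 < `|K| + 1 by rewrite ltr_wpDl.
have r10 : 0 < r1 by rewrite invr_gt0.
have TL s t : normv (T s - T t) <= r1^-1 * `|s - t|.
  apply: le_trans (TK s t) _; rewrite invrK ler_wpM2r//.
  by rewrite (le_trans (ler_norm K))// lerDl.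
have gT := knot_has_velocity; have T1 := knot_unit.
have pg := knot_periodic; have pT := knot_velocity_periodic.
have arc := unit_arc_curve gT T1.
have cur a b : curvature_le T id r1 a b by exact: lip_curvature_le.
have hLr := closed_length_ge r10 L0 gT T1 pg TL.
have pr0 : 0 < pi * r1 by rewrite mulr_gt0 ?pi_gt0.
have hab : pi * r1 <= L - pi * r1 by lra.
have [s h _ /andP[h1 h2]|m m0 hm] := @chord_compact _ _ _ _ gT T1 _ _ 0 L 0 hab (ltW L0).
  by apply/normv_gt0; rewrite subr_eq0; apply: knot_injective; lra.
exists (Num.min r1 (m / 2)); first by rewrite lt_min r10 divr_gt0.
set r := Num.min _ _.
have r0 : 0 < r by rewrite lt_min r10 divr_gt0.
have rr1 : r <= r1 by rewrite ge_min lexx.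
have rm' : r <= m / 2 by rewrite ge_min lexx orbT.
have rm : 2 * r <= m by lra.
apply: ball_radius_ge => // s t z z1 zs.
wlog : s t zs / 0 <= s < 0 + L.
  move=> h; have [k hk] := periodic_window 0 s L0.
  have := h (s + L *~ k) (t + L *~ k).
  by rewrite !(periodicz pg) (periodicz pT) => /(_ zs hk).
move=> /andP[s0 sL].
have [k] := periodic_window s t L0; rewrite -(periodicz pg k t).
move: (t + L *~ k) => {k}t /andP[st tL].
have weaken (D : 'rV[R]_n) : 2 * r1 * dotv D z <= dotv D D -> 2 * r * dotv D z <= dotv D D.
  move=> h; have [c0|c0] := leP (dotv D z) 0.
    by apply: le_trans (dotv_ge0 D); rewrite mulr_ge0_le0// mulr_ge0// ltW.
  apply: le_trans h; rewrite ler_pM2r// ler_pM2l//.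
have [l1|/ltW l1] := leP (t - s) (pi * r1).
  by apply: weaken; exact: (tangent_ball_right r10 arc (cur s t)).
have [l2|/ltW l2] := leP (s + L - t) (pi * r1).
  apply: weaken; rewrite -(pg s); rewrite -(pT s) in zs.
  by apply: (tangent_ball_left r10 arc (cur t (s + L))) => //; exact: ltW.
have := hm s (t - s); have -> : s + (t - s) = t by ring.
rewrite add0r => /(_ ltac:(apply/andP; split; lra) ltac:(apply/andP; split; lra)) hD.
have := dotv_le (gamma t - gamma s) z; rewrite -sqr_normv.
have -> : normv z = 1 by exact/normv_unit.
set D := normv _ in hD * => h2; rewrite expr2.
have D0 : 0 <= D by exact: normv_ge0.
apply: (@le_trans _ _ (2 * r * D)); first by rewrite ler_pM2l ?mulr_gt0//; lra.
by rewrite ler_wpM2r//; lra.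
Qed.

Lemma knot_ball_radius : exists2 r, 0 < r & ball_radius gamma = r%:E.
Proof.
have [r0 r00 hr0] := knot_ball_radius_gt; have := knot_ball_radius_lt.
case: (ball_radius gamma) hr0 => [r|//|//].
by rewrite lee_fin => h _; exists r => //; exact: lt_le_trans h.
Qed.

End UnitSpeedKnot.

Section Extremal.
Context {R : realType} {n : nat}.
Variables (L : R) (gamma : R -> 'rV[R]_n) (r : R).
Hypotheses (L0 : 0 < L) (ext : relatively_extremal L gamma) (unit : unit_speed gamma).
Hypotheses (r0 : 0 < r) (hr : ball_radius gamma = r%:E).

Local Notation T := (derive1 gamma).

Lemma window_simple (eta : R -> 'rV[R]_n) : periodic eta L ->
  (forall s t, s < t -> t < s + L -> eta t != eta s) -> simple L eta.
Proof.
move=> pe inj s t est; have [k /andP[h1 h2]] := periodic_window s t L0.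
have et : eta (t + L *~ k) = eta s by rewrite (periodicz pe).
exists (- k); have [e|ne] := eqVneq s (t + L *~ k).
  by rewrite e mulrNz mulNr -addrA mulrzl subrr addr0.
have := inj s (t + L *~ k); rewrite lt_neqAle ne h1 et eqxx => /(_ isT h2).
by [].
Qed.

(** The competitor replaces the arc of the knot over [[u, v]]. As no contact is touched,
    the ball radius stays at least [r]; the straight homotopy goes through embeddings, so
    the knot class is kept, and extremality of the ropelength bounds the length. *)
Lemma extremal_locally_shortest u v : u < v -> v - u < L ->
  (forall s, u <= s <= v -> ~ contact gamma T r s) -> locally_shortest T r u v.
Proof.
move=> uv vuL free; have [knot [U [[Uc1 Uopen] Ug Umin]]] := ext.
have gT := knot_has_velocity knot; have T1 := knot_unit unit.
have pg := knot_periodic knot; have pT := knot_velocity_periodic knot.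
have inj := knot_injective L0 knot.
have [tb TL] := knot_ball_radius_lip knot unit r0 (eq_ind_r (fun x => (r%:E <= x)%E) (lexx _) hr).
have [d d0 far_strict] := far_apart_strict r0 L0 gT T1 pg pT TL tb inj (ltW uv) free.
have [eU eU0 hU] := Uopen _ Ug.
pose e := Num.min (1 / 8) (Num.min (eU / 2) (Num.min (eU / (2 * L))
  (Num.min (r / (2 * L)) (d / (3 * L))))).
have e0 : 0 < e by rewrite !lt_min !divr_gt0 ?mulr_gt0.
have e1 : e < 1 / 4.
  by apply: (@le_lt_trans _ _ (1 / 8)); [rewrite ge_min lexx|lra].
have e2 : e < eU.
  by apply: (@le_lt_trans _ _ (eU / 2)); [rewrite !ge_min lexx !orbT|lra].
have e3 : e * L < eU.
  apply: (@le_lt_trans _ _ (eU / 2)); last lra.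
  have : e <= eU / (2 * L) by rewrite !ge_min lexx !orbT.
  by rewrite ler_pdivlMr ?mulr_gt0//; lra.
have e4 : e * L < r.
  apply: (@le_lt_trans _ _ (r / 2)); last by have := r0; lra.
  have : e <= r / (2 * L) by rewrite !ge_min lexx !orbT.
  by rewrite ler_pdivlMr ?mulr_gt0//; lra.
have e5 : 3 * (e * L) <= d.
  have : e <= d / (3 * L) by rewrite !ge_min lexx !orbT.
  by rewrite ler_pdivlMr ?mulr_gt0//; lra.
exists e => // q k qk qout qe qdisp qcur; rewrite leNgt; apply/negP => qshort.
pose eta tau := perturb gamma T L0 u q tau.
pose Q tau := perturb_velocity T L0 u q tau.
have tau1 : 0 <= (1 : R) <= 1 by rewrite ler01 lexx.
have vel tau : has_velocity (eta tau) (Q tau).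
  exact: (perturb_has_velocity L0 gT TL uv vuL qk qout qdisp).
have per tau : periodic (eta tau) L.
  exact: (perturb_periodic L0 pg TL uv vuL qk qout qdisp).
have Qe tau : 0 <= tau <= 1 -> forall s, normv (Q tau s - T s) <= e.
  by move=> ht s; apply: perturb_velocity_close.
have close tau : 0 <= tau <= 1 -> forall s, normv (eta tau s - gamma s) <= e * L.
  by move=> ht s; exact: (perturb_close gamma L0 TL uv vuL e0 qk qout qe qdisp s ht).
have dE tau s : derivable (eta tau) s 1 /\ derive1 (eta tau) s = Q tau s.
  by apply: row_derive => i; exact: (has_velocity_coord (vel tau)).
have DE tau : derive1 (eta tau) = Q tau by apply/funext => s; exact: (dE tau s).2.
have inj_eta tau : 0 <= tau <= 1 -> simple L (eta tau).
  move=> ht; apply: window_simple => //.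
  exact: (close_injective r0 L0 gT T1 pg TL tb inj e1 e4 (vel tau) (per tau) (Qe _ ht) (close _ ht)).
have Qlip := perturb_velocity_lip L0 pT vuL qk qout.
have C1 : C1_closed L (eta 1).
  split=> // [s|]; first exact: (dE 1 s).1.
  by rewrite DE; apply: coord_continuous_row; exact: (lipschitz_coord_continuous Qlip).
have Ueta : U (eta 1).
  apply: hU => // s; rewrite DE; split.
    exact: le_lt_trans (close _ tau1 s) e3.
  exact: le_lt_trans (Qe _ tau1 s) e2.
have Keta : knot_class L gamma (eta 1).
  exists (fun p => perturb gamma T L0 u q p.1 p.2); split=> [|t ht|s|s] //=.
  - apply: continuous_subspaceT => p.
    have cg : continuous gamma by apply/coord_continuous_row/(has_velocity_continuous gT).
    have cb : continuous (periodize u L0 (bump T u q)).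
      have -> : periodize u L0 (bump T u q) = (fun s => eta 1 s - gamma s).
        by apply/funext => s; rewrite /eta /perturb scale1r addrC addKr.
      have c1 : continuous (eta 1) by apply/coord_continuous_row/(has_velocity_continuous (vel 1)).
      by move=> s; apply: continuousB; [exact: c1|exact: cg].
    have h1 : (fun x : R * R => gamma x.2) @ p --> gamma p.2.
      by apply: (@continuous_comp _ _ _ snd gamma); [exact: cvg_snd|exact: cg].
    have h2 : (fun x : R * R => periodize u L0 (bump T u q) x.2) @ p -->
        periodize u L0 (bump T u q) p.2.
      by apply: (@continuous_comp _ _ _ snd (periodize u L0 (bump T u q)));
        [exact: cvg_snd|exact: cb].
    have h3 : (fun x : R * R => x.1) @ p --> p.1 by exact: cvg_fst.
    exact: (cvgD h1 (cvgZ h3 h2)).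
  - split; [exact: per| |exact: inj_eta].
    by apply/coord_continuous_row/(has_velocity_continuous (vel t)).
  - by rewrite /perturb scale0r addr0.
have Seta : simple_C11_closed L (eta 1).
  split=> //; first exact: inj_eta.
    by exists k => s t; rewrite DE; exact: Qlip.
  by move=> s; rewrite DE; exact: (perturb_velocity_neq0 L0 T1 u e1 qe s).
have Reta : (r%:E <= ball_radius (eta 1%R))%E.
  apply: ball_radius_ge => //; rewrite DE.
  exact: (perturb_outside_tangent_balls r0 gT T1 pg pT TL tb inj uv vuL e0 e1 qk
    qout qe qdisp qcur (ltW qshort) e5 far_strict).
have := Umin _ Ueta Keta Seta.
have cT : coord_continuous_fun T := lipschitz_coord_continuous TL.
have cQ : coord_continuous_fun (Q 1) := lipschitz_coord_continuous Qlip.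
have cE : coord_continuous_fun (derive1 (eta 1)) by rewrite DE.
rewrite /ropelength hr (arclengthE (ltW L0) cT) (arclengthE (ltW L0) cE) DE.
have -> : integ (fun s => normv (T s)) 0 L = L.
  have -> : (fun s => normv (T s)) = (fun=> 1) by apply/funext => s; exact: unit.
  by rewrite integ_cst mul1r subr0.
set l := integ _ 0 L.
have lL : l < L.
  rewrite /l /Q (perturb_length L0 gT T1 pT TL uv vuL e1 qk qout qe qdisp).
  by move: qshort; lra.
have l0 : 0 <= l.
  apply: integ_ge0; [exact: ltW|exact: continuous_normv|].
  by move=> s _; exact: normv_ge0.
apply/negP; rewrite -ltNge.
have lr : (l%:E / r%:E < L%:E / r%:E)%E.
  by rewrite !inver gt_eqF// -!EFinM lte_fin ltr_pM2r// invr_gt0.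
apply: le_lt_trans lr.
case: (ball_radius (eta 1)) Reta => [r'|_|//].
  rewrite lee_fin => rr'; have r'0 : 0 < r' by exact: lt_le_trans rr'.
  by rewrite !inver !gt_eqF// -!EFinM lee_fin ler_wpM2l// lef_pV2.
by rewrite invey mule0 inver gt_eqF// -EFinM lee_fin mulr_ge0// invr_ge0 ltW.
Qed.

End Extremal.

(** * First variations of a locally shortest arc *)

Section VariationTools.
Context {R : realType} {n : nat}.
Implicit Types (T q p : R -> 'rV[R]_n) (u v w : 'rV[R]_n) (f : R -> R).

Lemma dirv_dist u v (c : R) : 0 < c -> c <= normv u -> c <= normv v ->
  normv (dirv u - dirv v) <= normv (u - v) / c.
Proof.
move=> c0 cu cv; set a := normv u in cu; set b := normv v in cv.
have a0 : 0 < a by exact: lt_le_trans cu.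
have b0 : 0 < b by exact: lt_le_trans cv.
have nz w : 0 < normv w -> w != 0.
  by move=> w0; apply/eqP => w00; rewrite w00 normv0 ltxx in w0.
apply: normv_le; first by rewrite divr_ge0 ?normv_ge0// ltW.
rewrite dotvB_unit; [|exact/dirv_unit/nz|exact/dirv_unit/nz].
rewrite expr_div_n sqr_normv ler_pdivlMr ?exprn_gt0//.
have uE : dotv u u = a ^+ 2 by rewrite sqr_normv.
have vE : dotv v v = b ^+ 2 by rewrite sqr_normv.
have uvE : dotv u v = a * (b * dotv (dirv u) (dirv v)).
  by rewrite -(normv_dirv u) -{1}(normv_dirv v) dotvZl dotvZr -/a -/b !normv_dirv.
have -> : dotv (u - v) (u - v) = (a - b) ^+ 2 + a * b * (2 - 2 * dotv (dirv u) (dirv v)).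
  by rewrite !dotvE (dotvC v u) uE vE uvE; ring.
have d0 : 0 <= 2 - 2 * dotv (dirv u) (dirv v).
  by rewrite -dotvB_unit ?dotv_ge0//; exact/dirv_unit/nz.
have cc : c ^+ 2 <= a * b by rewrite expr2; apply: ler_pM => //; exact: ltW.
have := ler_wpM2l d0 cc; have := sqr_ge0 (a - b); lra.
Qed.

Lemma dirvZ k u : 0 < k -> dirv (k *: u) = dirv u.
Proof.
move=> k0; have [->|u0] := eqVneq u 0; first by rewrite scaler0.
rewrite !dirvE normvZ gtr0_norm// scalerA; congr (_ *: _).
by field; rewrite !gt_eqF ?normv_gt0.
Qed.

(** Inversion in the unit sphere stretches distances by the product of the norms. *)
Lemma inversion_dist u v : u != 0 -> v != 0 ->
  normv ((normv u ^- 2) *: u - (normv v ^- 2) *: v) =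
  normv (u - v) / (normv u * normv v).
Proof.
move=> u0 v0; set a := normv u; set b := normv v.
have a0 : 0 < a by exact: normv_gt0.
have b0 : 0 < b by exact: normv_gt0.
have uE : dotv u u = a ^+ 2 by rewrite sqr_normv.
have vE : dotv v v = b ^+ 2 by rewrite sqr_normv.
apply/eqP; rewrite -(@eqrXn2 _ 2) ?normv_ge0//; last first.
  by rewrite divr_ge0 ?normv_ge0// mulr_ge0// ltW.
rewrite expr_div_n !sqr_normv !dotvE (dotvC v u) uE vE; apply/eqP.
by field; rewrite !gt_eqF.
Qed.

Lemma integ_rev f a b : a <= b -> continuous f ->
  integ (fun s => f (- s)) a b = integ f (- b) (- a).
Proof.
move=> ab cf.
have cfN : continuous (fun x => f (- x)).
  by move=> x; apply: continuous_comp; [exact: opp_continuous|exact: cf].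
have -> : integ f (- b) (- a) = (- primitive f (- b)) - (- primitive f (- a)).
  by rewrite /integ; ring.
apply: (@integE _ (fun s => - primitive f (- s)) _ _ _ ab cfN) => s _.
apply: (der_eq (derN (der_comp (primitiveP cf (- s)) (derN (der_id s))))).
by rewrite mulrN1 opprK.
Qed.

Lemma locally_shortest_rev T r (a b : R) : a < b -> coord_continuous_fun T ->
  locally_shortest T r a b -> locally_shortest (fun s => - T (- s)) r (- b) (- a).
Proof.
move=> ab cT [e e0 h]; exists e => // q k qk qout qe qdisp qcur.
have cq : coord_continuous_fun q := lipschitz_coord_continuous qk.
have cqn : continuous (fun s => normv (q s)) by exact: continuous_normv.
pose p s := - q (- s).
have pk s t : normv (p s - p t) <= k * `|s - t|.
  rewrite /p -normvN opprB opprK addrC; apply: le_trans (qk _ _) _.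
  have -> : - s - - t = - (s - t) by ring.
  by rewrite normrN.
have cp : coord_continuous_fun p := lipschitz_coord_continuous pk.
have lenE : integ (fun s => normv (p s)) a b = integ (fun s => normv (q s)) (- b) (- a).
  rewrite -integ_rev ?(ltW ab)//; congr integ.
  by apply/funext => s; rewrite /p normvN.
have rev (g : R -> 'rV[R]_n) w : coord_continuous_fun g ->
    integ (fun s => dotv (- g (- s)) w) a b = - integ (fun s => dotv (g s) w) (- b) (- a).
  move=> cg; have cgw : continuous (fun s => dotv (g s) w).
    by apply: continuous_dotv => //; exact: coord_continuous_cst.
  have -> : (fun s => dotv (- g (- s)) w) = (fun s => -1 * dotv (g (- s)) w).
    by apply/funext => s; rewrite dotvNl mulN1r.
  rewrite (@integZ _ _ (fun s => dotv (g (- s)) w)) ?(ltW ab)//.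
    by rewrite mulN1r (integ_rev (ltW ab) cgw).
  by move=> x; apply: (@continuous_comp _ _ _ (fun x => - x) (fun s => dotv (g s) w));
    [exact: opp_continuous|exact: cgw].
have := h p k pk; rewrite lenE; have -> : - a - - b = b - a by ring.
apply.
- by move=> s hs; rewrite /p qout ?opprK// !ltrN2 andbC.
- by move=> s; have := qe (- s); rewrite !opprK => qes; rewrite /p -normvN opprD !opprK.
- move=> w; rewrite /p rev// qdisp.
  have cTN : coord_continuous_fun (fun s => - T (- s)).
    move=> i; under eq_fun do rewrite mxE.
    move=> x; apply: continuousN.
    by apply: (@continuous_comp _ _ _ (fun x => - x) (fun s => T s ord0 i));
      [exact: opp_continuous|exact: cT].
  rewrite -(rev (fun s => - T (- s)))//.
  by congr integ; apply/funext => s; rewrite !opprK.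
- have := curvature_le_rev qcur; rewrite !opprK; apply: curvature_le_congr => //.
  + by apply: primitiveP; exact: continuous_normv.
  + move=> s; have d := primitiveP cqn (- s).
    apply: (der_eq (derN (der_comp d (derN (der_id s))))).
    by rewrite normvN mulrN1 opprK.
Qed.

(** A weight for localised perturbations, Lipschitz so that it keeps velocities Lipschitz. *)
Definition tent (a b s : R) : R := Num.max 0 (Num.min (s - a) (b - s)).

Lemma tent_ge0 a b s : 0 <= tent a b s.
Proof. by rewrite le_max lexx. Qed.

Lemma tent_le a b s : a <= b -> tent a b s <= b - a.
Proof.
move=> ab; rewrite ge_max subr_ge0 ab/= ge_min.
by have [h|/ltW h] := leP s b; apply/orP; [left|right]; lra.
Qed.

Lemma tent_out a b s : ~ (a < s < b) -> tent a b s = 0.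
Proof.
move=> hs; apply/eqP; rewrite eq_le tent_ge0 andbT ge_max lexx/= ge_min !subr_le0.
by rewrite !leNgt -negb_and; apply/negP.
Qed.

Lemma tent_gt0 a b s : a < s < b -> 0 < tent a b s.
Proof. by move=> /andP[h1 h2]; rewrite lt_max lt_min !subr_gt0 h1 h2 orbT. Qed.

Lemma tent_lip a b s t : `|tent a b s - tent a b t| <= 1 * `|s - t|.
Proof.
rewrite mul1r; suff main x y : tent a b x - tent a b y <= `|x - y|.
  by rewrite ler_norml main andbT lerNl opprB distrC main.
have h1 := ler_norm (x - y); have h2 := ler_norm (y - x).
rewrite distrC in h2; have h0 := normr_ge0 (x - y).
have hy : 0 <= tent a b y /\ Num.min (y - a) (b - y) <= tent a b y.
  by rewrite /tent !le_max !lexx orbT.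
rewrite lerBlDr ge_max; apply/andP; split; first by case: hy; lra.
have [c|c] := leP (y - a) (b - y).
  by rewrite ge_min; apply/orP; left; case: hy; rewrite (min_idPl c); lra.
by rewrite ge_min; apply/orP; right; case: hy; rewrite (min_idPr (ltW c)); lra.
Qed.

Lemma continuous_tent a b : continuous (tent a b).
Proof. exact: (lipschitz_continuous (tent_lip a b)). Qed.

Lemma integ_tent_gt0 a b : a < b -> 0 < integ (tent a b) a b.
Proof.
move=> ab; rewrite lt_def; apply/andP; split; last first.
  by apply: integ_ge0 => [|x|x _]; [exact: ltW|exact: continuous_tent|exact: tent_ge0].
apply/eqP => I0.
have h := integ_eq0 (ltW ab) (@continuous_tent a b) (fun x _ => tent_ge0 a b x).
rewrite I0 in h; have := h (lexx 0) ((a + b) / 2).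
have m : a < (a + b) / 2 < b by apply/andP; split; lra.
by move=> /(_ m) h0; have := tent_gt0 m; rewrite h0 ltxx.
Qed.

(** [sqrt x <= (1 + x) / 2], which is exact to first order at [x = 1]. *)
Lemma normv_le_sqr_perturb (u w : 'rV[R]_n) (x : R) : dotv u u = 1 ->
  normv (u - x *: w) <= 1 - x * dotv u w + x ^+ 2 * dotv w w / 2.
Proof.
move=> u1; have : dotv (u - x *: w) (u - x *: w) = 1 - 2 * x * dotv u w + x ^+ 2 * dotv w w.
  by rewrite !dotvE u1 (dotvC w u); ring.
rewrite -sqr_normv => h; have := sqr_ge0 (normv (u - x *: w) - 1); lra.
Qed.

(** The Lipschitz constant of the velocity of a nearly unit speed curve bounds its
    curvature, with a loss that is compensated by any slack. *)
Lemma curvature_le_lip q (r a b c K M : R) : 0 < r -> 0 < c ->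
  (forall s, q s != 0) -> coord_continuous_fun q ->
  (forall s, a <= s <= b -> c <= normv (q s)) -> (forall s, normv (q s) <= M) ->
  (forall s t, a <= s -> s <= t -> t <= b -> normv (q s - q t) <= K * (t - s)) ->
  K <= c ^+ 2 / r ->
  curvature_le q (primitive (fun s => normv (q s))) r a b.
Proof.
move=> r0 c0 q0 cq qc qM qK Kc.
have dL := primitiveP (continuous_normv cq).
have hL : {homo (primitive (fun s => normv (q s))) : x y / x <= y}.
  move=> x y xy; apply: (derive_nondecreasing xy (fun s _ => dL s)) => s _.
  exact: normv_ge0.
apply: (@curvature_le_local _ _ _ _ _ _ _ M) => // [s t as_ st tb|d d0].
  have d (x : R) : s <= x <= t -> is_derive x 1
      (fun x => M * x - primitive (fun s => normv (q s)) x) (M - normv (q x)).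
    by move=> _; apply: (der_eq (derB (derZ M (der_id x)) (dL x))); rewrite mulr1.
  have := derive_nondecreasing st d => h.
  suff /h : forall x, s <= x <= t -> 0 <= M - normv (q x) by lra.
  by move=> x _; rewrite subr_ge0.
exists 1 => // s t as_ st tb _.
have l : c * (t - s) <= primitive (fun s => normv (q s)) t - primitive (fun s => normv (q s)) s.
  have d' (x : R) : s <= x <= t -> is_derive x 1
      (fun x => primitive (fun s => normv (q s)) x - c * x) (normv (q x) - c).
    by move=> _; apply: (der_eq (derB (dL x) (derZ c (der_id x)))); rewrite mulr1.
  have := derive_nondecreasing st d' => h.
  suff /h : forall x, s <= x <= t -> 0 <= normv (q x) - c by lra.
  by move=> x /andP[sx xt]; rewrite subr_ge0 qc//; apply/andP; split; lra.
have cs : c <= normv (q s) by rewrite qc//; apply/andP; split; lra.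
have ct : c <= normv (q t) by rewrite qc//; apply/andP; split; lra.
apply: le_trans (dirv_dist c0 cs ct) _.
apply: (@le_trans _ _ (c * (t - s) / r)).
  rewrite ler_pdivrMr//; apply: le_trans (qK _ _ as_ st tb) _.
  have -> : c * (t - s) / r * c = c ^+ 2 / r * (t - s) by ring.
  by rewrite ler_wpM2r// subr_ge0.
apply: (@le_trans _ _ (1 * ((primitive (fun s => normv (q s)) t -
    primitive (fun s => normv (q s)) s) / r))).
  by rewrite mul1r ler_pM2r// invr_gt0.
rewrite ler_wpM2r//; last by lra.
by rewrite divr_ge0 ?(ltW r0)// subr_ge0 hL.
Qed.

End VariationTools.

Section Straightening.
Context {R : realType} {n : nat}.
Variables (T : R -> 'rV[R]_n) (r : R).
Hypotheses (r0 : 0 < r) (T1 : forall s, dotv (T s) (T s) = 1).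
Hypotheses (TL : forall s t, normv (T s - T t) <= r^-1 * `|s - t|).

Let cT : coord_continuous_fun T := lipschitz_coord_continuous TL.

(** Where there is slack in the curvature, the velocity can be contracted towards a
    weighted mean of itself, which keeps the displacement and, unless the velocity
    is constant, shortens the arc to first order. *)
Lemma locally_shortest_straight u v k : u < v -> locally_shortest T r u v ->
  (forall s t, u <= s -> s <= t -> t <= v -> normv (T s - T t) <= k * (t - s)) ->
  0 <= k -> k < r^-1 -> exists m, forall s, u < s < v -> T s = m.
Proof.
move=> uv [e e0 hmin] Tk k0 kr; have rp := r0; have ri0 : 0 < r^-1 by rewrite invr_gt0.
have cph := @continuous_tent R u v.
pose W := v - u; have W0 : 0 < W by rewrite subr_gt0.
have phW s : tent u v s <= W by exact: tent_le (ltW uv).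
have ph0 := @tent_ge0 R u v.
pose I := integ (tent u v) u v; have I0 : 0 < I := integ_tent_gt0 uv.
have cX : coord_continuous_fun (fun s => tent u v s *: T s) by exact: coord_continuousZ.
pose m := I^-1 *: integv (fun s => tent u v s *: T s) u v.
exists m; pose V s := T s - m.
have cV : coord_continuous_fun V.
  by apply: coord_continuousD => //; exact: coord_continuous_cst.
have cTw w : continuous (fun s => tent u v s * dotv (T s) w).
  apply: contM => //.
  by apply: continuous_dotv => //; exact: coord_continuous_cst.
have cVw w : continuous (fun s => tent u v s * dotv (V s) w).
  apply: contM => //.
  by apply: continuous_dotv => //; exact: coord_continuous_cst.
have cVV : continuous (fun s => tent u v s * dotv (V s) (V s)).
  by apply: contM => //; exact: continuous_dotv.
have mean0 w : integ (fun s => tent u v s * dotv (V s) w) u v = 0.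
  have -> : (fun s => tent u v s * dotv (V s) w) =
      (fun s => tent u v s * dotv (T s) w - dotv m w * tent u v s).
    by apply/funext => s; rewrite /V dotvDl dotvNl; ring.
  rewrite (integB (ltW uv) (cTw w)); last first.
    exact: contZ.
  rewrite (integZ _ (ltW uv) cph) -/I /m dotvZl integv_dotv ?(ltW uv)//.
  have -> : (fun s => dotv (tent u v s *: T s) w) = (fun s => tent u v s * dotv (T s) w).
    by apply/funext => s; rewrite dotvZl.
  by rewrite mulrAC mulVf ?gt_eqF// mul1r subrr.
pose B := 1 + normv m; have B0 : 0 < B by rewrite ltr_pwDl ?normv_ge0.
have VB s : normv (V s) <= B.
  by apply: le_trans (normv_triangleB _ _) _; rewrite (unit_normv T1).
have WB0 : 0 < W * B by rewrite mulr_gt0.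
pose C := W / r + B; have C0 : 0 < C by rewrite addr_gt0// divr_gt0.
have XC s t : normv (tent u v s *: V s - tent u v t *: V t) <= C * `|s - t|.
  have -> : tent u v s *: V s - tent u v t *: V t =
      tent u v s *: (T s - T t) + (tent u v s - tent u v t) *: V t.
    by rewrite /V; apply/rowP => i; rewrite !mxE; ring.
  apply: le_trans (normv_triangle _ _) _; rewrite !normvZ (ger0_norm (ph0 s)) mulrDl.
  apply: lerD.
    rewrite -mulrA; apply: ler_pM => //; exact: normv_ge0.
  rewrite mulrC; apply: ler_pM => //; first exact: normv_ge0.
  by have := tent_lip u v s t; rewrite mul1r.
pose E := C + 2 * (W * B) / r.
have E0 : 0 < E by rewrite addr_gt0// divr_gt0// mulr_gt0.
pose ep := Num.min (Num.min (1 / (2 * (W * B))) (e / (W * B)))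
  (Num.min ((r^-1 - k) / E) (1 / W)).
have ep0 : 0 < ep by rewrite !lt_min !divr_gt0 ?subr_gt0// mulr_gt0.
have ep1 : ep * (W * B) <= 1 / 2.
  have : ep <= 1 / (2 * (W * B)) by rewrite !ge_min lexx.
  by rewrite ler_pdivlMr ?mulr_gt0//; lra.
have ep2 : ep * (W * B) <= e.
  have : ep <= e / (W * B) by rewrite !ge_min lexx ?orbT.
  by rewrite ler_pdivlMr.
have ep3 : ep * E <= r^-1 - k.
  have : ep <= (r^-1 - k) / E by rewrite !ge_min lexx ?orbT.
  by rewrite ler_pdivlMr.
have ep4 : ep * W <= 1.
  have : ep <= 1 / W by rewrite !ge_min lexx ?orbT.
  by rewrite ler_pdivlMr.
pose q s := T s - (ep * tent u v s) *: V s.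
have qT s : normv (q s - T s) <= ep * (W * B).
  rewrite /q addrC addrA addNr add0r normvN normvZ normrM (gtr0_norm ep0) (ger0_norm (ph0 s)).
  rewrite -mulrA ler_pM2l//; apply: ler_pM => //; exact: normv_ge0.
have qdiff s t : normv (q s - q t) <= normv (T s - T t) + ep * C * `|s - t|.
  have -> : q s - q t = (T s - T t) - ep *: (tent u v s *: V s - tent u v t *: V t).
    by rewrite /q; apply/rowP => i; rewrite !mxE; ring.
  apply: le_trans (normv_triangleB _ _) _; rewrite lerD2l normvZ (gtr0_norm ep0) -mulrA.
  by rewrite ler_pM2l.
have qlip s t : normv (q s - q t) <= (r^-1 + ep * C) * `|s - t|.
  by apply: le_trans (qdiff s t) _; rewrite mulrDl lerD2r.
have cq : coord_continuous_fun q := lipschitz_coord_continuous qlip.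
have qlow s : 1 - ep * (W * B) <= normv (q s).
  have := normv_sub (T s) (q s); rewrite (unit_normv T1) normvC.
  by have := qT s; lra.
have q0 s : q s != 0.
  by apply/eqP => qs; have := qlow s; rewrite qs normv0; lra.
have := hmin q (r^-1 + ep * C) qlip.
have /[swap]/[apply] : forall s, ~ (u < s < v) -> q s = T s.
  by move=> s hs; rewrite /q tent_out// mulr0 scale0r subr0.
have /[swap]/[apply] : forall s, normv (q s - T s) <= e.
  by move=> s; exact: le_trans (qT s) ep2.
have /[swap]/[apply] : forall w,
    integ (fun s => dotv (q s) w) u v = integ (fun s => dotv (T s) w) u v.
  move=> w; have -> : (fun s => dotv (q s) w) =
      (fun s => dotv (T s) w - ep * (tent u v s * dotv (V s) w)).
    by apply/funext => s; rewrite /q dotvDl dotvNl dotvZl; ring.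
  rewrite integB ?(ltW uv)//.
  - by rewrite (integZ _ (ltW uv) (cVw w)) mean0 mulr0 subr0.
  - by apply: continuous_dotv => //; exact: coord_continuous_cst.
  - by apply: contZ; exact: cVw.
have /[swap]/[apply] : curvature_le q (primitive (fun s => normv (q s))) r u v.
  apply: (@curvature_le_lip _ _ _ r u v (1 - ep * (W * B)) (k + ep * C) (1 + ep * (W * B))) => //.
  - by lra.
  - move=> s; have := normv_sub (q s) (T s); rewrite (unit_normv T1).
    by have := qT s; lra.
  - move=> s t us st tv; apply: le_trans (qdiff s t) _.
    by rewrite distrC (ger0_norm (_ : 0 <= t - s)) ?subr_ge0// mulrDl lerD2r Tk.
  - have : (1 - 2 * (ep * (W * B))) * r^-1 <= (1 - ep * (W * B)) ^+ 2 * r^-1.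
      by rewrite ler_pM2r//; have := sqr_ge0 (ep * (W * B)); lra.
    by move: ep3; rewrite /E; lra.
move=> hlen.
pose J := integ (fun s => tent u v s * dotv (V s) (V s)) u v.
have J0 : J <= 0.
  have up s : normv (q s) <= (1 - ep * (1 - ep * W / 2) * (tent u v s * dotv (V s) (V s)))
      - ep * (tent u v s * dotv (V s) m).
    apply: le_trans (normv_le_sqr_perturb _ _ (T1 s)) _.
    have -> : dotv (T s) (V s) = dotv (V s) (V s) + dotv (V s) m.
      rewrite {3}/V (dotvDr (V s) (T s)) dotvNr (dotvC (V s) (T s)); ring.
    have : (ep * tent u v s) ^+ 2 * dotv (V s) (V s) <=
        ep * ep * (W * tent u v s) * dotv (V s) (V s).
      rewrite ler_wpM2r ?dotv_ge0// exprMn -expr2 ler_pM2l ?exprn_gt0// expr2.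
      by rewrite ler_wpM2r.
    by lra.
  have := hlen.
  have cnq := continuous_normv cq.
  have c1 : continuous (fun s => ep * (1 - ep * W / 2) * (tent u v s * dotv (V s) (V s))).
    exact: contZ.
  have c2 : continuous (fun s => ep * (tent u v s * dotv (V s) m)).
    by apply: contZ; exact: cVw.
  have c3 : continuous (fun s => 1 - ep * (1 - ep * W / 2) * (tent u v s * dotv (V s) (V s))).
    by apply: contB => // x; exact: cst_continuous.
  have c4 : continuous (fun s => (1 - ep * (1 - ep * W / 2) * (tent u v s * dotv (V s) (V s)))
      - ep * (tent u v s * dotv (V s) m)).
    exact: contB.
  have c0 : continuous (fun _ : R => 1 : R) by move=> x; exact: cst_continuous.
  have := integ_le (ltW uv) cnq c4 (fun s _ => up s).
  rewrite (integB (ltW uv) c3 c2) (integB (ltW uv) c0 c1) integ_cst.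
  rewrite (integZ _ (ltW uv) cVV) (integZ _ (ltW uv) (cVw m)) mean0 mulr0 subr0 mul1r -/J -/W.
  move=> h1 h2; have : ep * (1 - ep * W / 2) * J <= 0 by lra.
  have p : 0 < ep * (1 - ep * W / 2) by rewrite mulr_gt0//; lra.
  by rewrite pmulr_rle0.
move=> s suv.
have nn x : u <= x <= v -> 0 <= tent u v x * dotv (V x) (V x).
  by move=> _; rewrite mulr_ge0 ?dotv_ge0.
have := integ_eq0 (ltW uv) cVV nn J0 suv => /eqP.
rewrite mulf_eq0 gt_eqF ?tent_gt0//= => /eqP /dotv_eq0 /eqP.
by rewrite subr_eq0 => /eqP.
Qed.

End Straightening.

(** The first-order expansion behind [comparison_variation]; [nu] is the norm of the
    mixed velocity, and [a], [x], [y] are inner products of unit vectors. *)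
Lemma inversion_estimate {R : realType} (ep a x y nu : R) : 0 < ep -> ep <= 1 / 16 -> 0 <= a <= 2 ->
  -1 <= x <= 1 -> -1 <= y <= 1 -> 0 < nu -> nu ^+ 2 = 1 - 2 * ep * (1 - ep) * a ->
  nu^-1 - nu ^- 2 * ((1 - ep) * x + ep * y) + x <=
  1 + ep * (a * (1 - 2 * x) - (y - x)) + 100 * ep ^+ 2.
Proof.
move=> e0 e1 /andP[a0 a2] /andP[x0 x1] /andP[y0 y1] nu0 nuE.
pose t := 2 * ep * (1 - ep) * a.
have t0 : 0 <= t by rewrite /t !mulr_ge0//; lra.
have t1 : t <= 4 * ep.
  have : ep * a <= ep * 2 by rewrite ler_pM2l.
  have : 0 <= ep * (ep * a) by rewrite !mulr_ge0//; lra.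
  by rewrite /t; lra.
pose p := nu ^- 2.
have nu2 : nu ^+ 2 = 1 - t by rewrite nuE.
have pE : p * (1 - t) = 1 by rewrite /p -nu2 mulVf// gt_eqF// exprn_gt0.
have p0 : 0 < p by rewrite invr_gt0 exprn_gt0.
have p1 : p <= 4 / 3 by have : p * t <= p * (1 / 4) by [rewrite ler_pM2l//; lra]; lra.
pose rho := p - 1 - t.
have rhoE : rho = t ^+ 2 * p by rewrite /rho; have : p = 1 + p * t by [lra]; nra.
have rho0 : 0 <= rho by rewrite rhoE mulr_ge0 ?sqr_ge0// ltW.
have t2 : t ^+ 2 <= 16 * ep ^+ 2.
  have -> : 16 * ep ^+ 2 = (4 * ep) ^+ 2 by ring.
  by rewrite lerXn2r// nnegrE; lra.
have rho1 : rho <= 22 * ep ^+ 2.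
  rewrite rhoE; apply: (@le_trans _ _ (16 * ep ^+ 2 * (4 / 3))).
    by apply: ler_pM => //; [exact: sqr_ge0|exact: ltW].
  by have := sqr_ge0 ep; lra.
have nuV : nu^-1 <= (1 + p) / 2.
  have := sqr_ge0 (nu^-1 - 1).
  by rewrite /p -exprVn; lra.
set w := (1 - ep) * x + ep * y.
have w1 : -1 <= w <= 1 by rewrite /w; apply/andP; split; nra.
have hw : - (22 * ep ^+ 2) <= w * rho by case/andP: w1; nra.
have hyt : - (8 * ep ^+ 2) <= ep * (y - x) * t.
  have : -2 <= y - x by lra.
  have : y - x <= 2 by lra.
  have : ep * t <= ep * (4 * ep) by rewrite ler_pM2l.
  have : 0 <= ep * t by rewrite mulr_ge0// ltW.
  by nra.
have hat : - (x * t) <= - (2 * ep * a * x) + 4 * ep ^+ 2.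
  have : ep ^+ 2 * (a * x) <= ep ^+ 2 * 2.
    by rewrite ler_pM2l ?exprn_gt0//; nra.
  by rewrite /t; lra.
have ht2 : t / 2 <= ep * a.
  have : 0 <= ep * (ep * a) by rewrite !mulr_ge0//; lra.
  by rewrite /t; lra.
have E : p * w = w + w * t + w * rho by rewrite /rho; ring.
rewrite -/p E; have -> : w * t = x * t + ep * (y - x) * t by rewrite /w; ring.
have p2 : p = 1 + t + rho by rewrite /rho; ring.
have := sqr_ge0 ep.
rewrite p2 in nuV; rewrite {1}/w; lra.
Qed.

Section ComparisonVariation.
Context {R : realType} {n : nat}.
Variables (T That : R -> 'rV[R]_n) (r b z v : R) (e : 'rV[R]_n).
Hypotheses (r0 : 0 < r) (z0 : 0 < z) (bv : b < v).
Hypotheses (T1 : forall s, dotv (T s) (T s) = 1).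
Hypotheses (TL : forall s t, normv (T s - T t) <= r^-1 * `|s - t|).
Hypotheses (H1 : forall s, dotv (That s) (That s) = 1).
Hypotheses (HL : forall s t, normv (That s - That t) <= r^-1 * `|s - t|).
Hypothesis Hout : forall s, ~ (b < s < v) -> That s = T s.
Hypothesis Te : forall s, b - z <= s <= b -> T s = e.

Let cT : coord_continuous_fun T := lipschitz_coord_continuous TL.
Let cH : coord_continuous_fun That := lipschitz_coord_continuous HL.

Definition comparison_density s : R :=
  (1 - dotv (T s) (That s)) * (1 - 2 * dotv (T s) e) - (dotv (That s) e - dotv (T s) e).

Lemma continuous_comparison_density : continuous comparison_density.
Proof.
have c1 : continuous (fun _ : R => 1 : R) by move=> x; exact: cst_continuous.
have cTe : continuous (fun s => dotv (T s) e).
  by apply: continuous_dotv => //; exact: coord_continuous_cst.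
have cHe : continuous (fun s => dotv (That s) e).
  by apply: continuous_dotv => //; exact: coord_continuous_cst.
apply: contB; last exact: contB.
apply: contM; first by apply: contB => //; exact: continuous_dotv.
by apply: contB => //; exact: contZ.
Qed.

(** The two velocities are mixed in the ball, [N = (1 - ep) T + ep That]; the chord
    cuts the sphere short and would be too strongly curved at unit speed, so it is
    run at speed [1 / |N|], that is with the velocity inverse to [N]. *)
Let N (ep s : R) : 'rV[R]_n := (1 - ep) *: T s + ep *: That s.
Let q0 ep s : 'rV[R]_n := (normv (N ep s) ^- 2) *: N ep s.

Let NN ep s : dotv (N ep s) (N ep s) = 1 - 2 * ep * (1 - ep) * (1 - dotv (T s) (That s)).
Proof. by rewrite /N !dotvE T1 H1 (dotvC (That s)); ring. Qed.

Let defect_bound s : 0 <= 1 - dotv (T s) (That s) <= 2.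
Proof.
have := dotv_unit_le1 (T1 s) (H1 s); have := dotv_unit_geN1 (T1 s) (H1 s).
by move=> ? ?; apply/andP; split; lra.
Qed.

Let Nlow ep s : 0 < ep -> ep <= 1 / 16 -> 1 / 2 <= normv (N ep s).
Proof.
move=> e0 e1; apply: normv_ge; rewrite NN; have /andP[a0 a2] := defect_bound s.
set a := 1 - dotv _ _ in a0 a2 *.
have p : 0 <= ep * (1 - ep) <= 1 / 16 by apply/andP; split; nra.
have : ep * (1 - ep) * a <= 1 / 16 * 2 by apply: ler_pM => //; lra.
by lra.
Qed.

Let Nlip ep s t : 0 < ep -> ep <= 1 / 16 -> normv (N ep s - N ep t) <= r^-1 * `|s - t|.
Proof.
move=> e0 e1.
have -> : N ep s - N ep t = (1 - ep) *: (T s - T t) + ep *: (That s - That t).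
  by rewrite /N; apply/rowP => i; rewrite !mxE; ring.
have p1 : 0 <= 1 - ep by lra.
have p2 : 0 <= ep by lra.
apply: le_trans (normv_triangle _ _) _; rewrite !normvZ (ger0_norm p1) (ger0_norm p2).
have h1 : (1 - ep) * normv (T s - T t) <= (1 - ep) * (r^-1 * `|s - t|).
  by rewrite ler_wpM2l//; lra.
have h2 : ep * normv (That s - That t) <= ep * (r^-1 * `|s - t|).
  by rewrite ler_wpM2l//; lra.
by lra.
Qed.

Let Nneq0 ep s : 0 < ep -> ep <= 1 / 16 -> N ep s != 0.
Proof.
by move=> e0 e1; apply/eqP => N0; have := Nlow s e0 e1; rewrite N0 normv0; lra.
Qed.

Let normv_q0 ep s : 0 < ep -> ep <= 1 / 16 -> normv (q0 ep s) = (normv (N ep s))^-1.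
Proof.
move=> e0 e1; have h := normv_gt0 (Nneq0 s e0 e1).
rewrite /q0 normvZ gtr0_norm ?invr_gt0 ?exprn_gt0//.
by field; rewrite gt_eqF.
Qed.

Let q0_lip ep s t : 0 < ep -> ep <= 1 / 16 ->
  normv (q0 ep s - q0 ep t) <= 4 * r^-1 * `|s - t|.
Proof.
move=> e0 e1; rewrite inversion_dist ?Nneq0//.
have h1 := Nlow s e0 e1; have h2 := Nlow t e0 e1.
have h3 : 1 / 4 <= normv (N ep s) * normv (N ep t).
  by have -> : 1 / 4 = 1 / 2 * (1 / 2) :> R by [field]; apply: ler_pM.
rewrite ler_pdivrMr; last by apply: lt_le_trans h3; lra.
apply: le_trans (Nlip s t e0 e1) _.
have h4 : 0 <= r^-1 * `|s - t| by rewrite mulr_ge0// invr_ge0 ltW.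
have : r^-1 * `|s - t| * (1 / 4) <= r^-1 * `|s - t| * (normv (N ep s) * normv (N ep t)).
  by rewrite ler_wpM2l.
by lra.
Qed.

Let q0_close ep s : 0 < ep -> ep <= 1 / 16 -> normv (q0 ep s - T s) <= 4 * ep.
Proof.
move=> e0 e1; have Ts : T s = (normv (T s) ^- 2) *: T s.
  by rewrite (unit_normv T1) expr1n invr1 scale1r.
rewrite [X in _ - X]Ts inversion_dist ?Nneq0 ?(unit_neq0 T1)// (unit_normv T1) mulr1.
have h1 := Nlow s e0 e1.
rewrite ler_pdivrMr; last by apply: lt_le_trans h1; lra.
have -> : N ep s - T s = ep *: (That s - T s).
  by rewrite /N; apply/rowP => i; rewrite !mxE; ring.
rewrite normvZ gtr0_norm//.
have : normv (That s - T s) <= 2.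
  by apply: le_trans (normv_triangleB _ _) _; rewrite (unit_normv T1) (unit_normv H1); lra.
have : ep * (1 / 2) <= ep * normv (N ep s) by rewrite ler_pM2l.
move=> h2 h3; have : ep * normv (That s - T s) <= ep * 2 by rewrite ler_pM2l.
by lra.
Qed.

Let q0_out ep s : ~ (b < s < v) -> q0 ep s = T s.
Proof.
move=> hs; rewrite /q0; have -> : N ep s = T s.
  by rewrite /N Hout// -scalerDl subrK scale1r.
by rewrite (unit_normv T1) expr1n invr1 scale1r.
Qed.

Let I := integ (tent (b - z) b) (b - z) b.
Let I0 : 0 < I.
Proof. by apply: integ_tent_gt0; have hz := z0; lra. Qed.

Let D ep := integv (fun s => q0 ep s - T s) b v.
Let q ep s := q0 ep s - (tent (b - z) b s / I) *: D ep.

Let c_q0T ep : 0 < ep -> ep <= 1 / 16 -> coord_continuous_fun (fun s => q0 ep s - T s).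
Proof.
move=> e0 e1; apply: coord_continuousD.
  exact: (lipschitz_coord_continuous (fun s t => q0_lip s t e0 e1)).
move=> i; under eq_fun do rewrite mxE -mulN1r.
exact: contZ.
Qed.

Let D_small ep : 0 < ep -> ep <= 1 / 16 -> normv (D ep) <= 4 * ep * (v - b).
Proof.
move=> e0 e1; have c := c_q0T e0 e1.
have vel := coord_has_velocity (fun i s => integv_coord_derive b i s c).
have e4 : 0 <= 4 * ep by lra.
have := has_velocity_lip vel (ltW bv) e4 (fun s _ => q0_close s e0 e1).
by rewrite integvxx subr0.
Qed.

Let tentI s : 0 <= tent (b - z) b s / I <= z / I.
Proof.
have hz : b - z <= b by have := z0; lra.
rewrite divr_ge0 ?tent_ge0 ?(ltW I0)//= ler_pM2r ?invr_gt0//.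
by apply: le_trans (tent_le s hz) _; lra.
Qed.

Let gap : R := 4 * (1 + z / I * (v - b)).

Let gap_gt0 : 0 < gap.
Proof.
have h : 0 <= z / I * (v - b).
  apply: mulr_ge0; first by apply: divr_ge0; apply: ltW; [exact: z0|exact: I0].
  by rewrite subr_ge0; apply: ltW; exact: bv.
by rewrite /gap; lra.
Qed.

Let q_close ep s : 0 < ep -> ep <= 1 / 16 -> normv (q ep s - T s) <= gap * ep.
Proof.
move=> e0 e1.
have -> : q ep s - T s = (q0 ep s - T s) - (tent (b - z) b s / I) *: D ep.
  by rewrite /q addrAC.
apply: le_trans (normv_triangleB _ _) _; have /andP[t0 t1] := tentI s.
rewrite normvZ (ger0_norm t0).
have h : tent (b - z) b s / I * normv (D ep) <= z / I * (4 * ep * (v - b)).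
  by apply: ler_pM => //; [exact: normv_ge0|exact: D_small].
have := q0_close s e0 e1; rewrite /gap; lra.
Qed.

Let q_left ep s : b - z <= s <= b -> q ep s = e - (tent (b - z) b s / I) *: D ep.
Proof.
move=> hs; rewrite /q q0_out ?Te// => /andP[h1 h2].
by move: hs => /andP[_ h3]; lra.
Qed.

Let q_right ep s : b <= s -> q ep s = q0 ep s.
Proof.
move=> hs; rewrite /q tent_out ?mul0r ?scale0r ?subr0//.
by move=> /andP[h1 h2]; lra.
Qed.

Let q_lip ep : 0 < ep -> ep <= 1 / 16 -> exists k, forall s t,
  normv (q ep s - q ep t) <= k * `|s - t|.
Proof.
move=> e0 e1; exists (4 * r^-1 + normv (D ep) / I) => s t.
have E (A B W : 'rV[R]_n) (x y : R) : (A - x *: W) - (B - y *: W) = (A - B) - (x - y) *: W.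
  by apply/rowP => i; rewrite !mxE; ring.
rewrite /q E -mulrBl.
apply: le_trans (normv_triangleB _ _) _; rewrite [leRHS]mulrDl.
apply: lerD; first exact: q0_lip.
rewrite normvZ normrM (gtr0_norm (_ : 0 < I^-1)) ?invr_gt0//.
set c := normv (D ep) / I; have c0 : 0 <= c by rewrite divr_ge0 ?normv_ge0// ltW.
have -> : `|tent (b - z) b s - tent (b - z) b t| / I * normv (D ep) =
    c * `|tent (b - z) b s - tent (b - z) b t| by rewrite /c; ring.
by rewrite ler_wpM2l//; have := tent_lip (b - z) b s t; rewrite mul1r.
Qed.

Let q_disp ep w : 0 < ep -> ep <= 1 / 16 ->
  integ (fun s => dotv (q ep s) w) (b - z) v = integ (fun s => dotv (T s) w) (b - z) v.
Proof.
move=> e0 e1; have [k qk] := q_lip e0 e1.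
have bz : b - z <= b by have := z0; lra.
have cq : coord_continuous_fun (q ep) := lipschitz_coord_continuous qk.
have cw := @coord_continuous_cst R n w.
have cqw := continuous_dotv cq cw; have cTw := continuous_dotv cT cw.
have c0 := c_q0T e0 e1; have c0w := continuous_dotv c0 cw.
have ctent := @continuous_tent R (b - z) b.
rewrite (integ_split _ _ b) [RHS](integ_split _ _ b).
have -> : integ (fun s => dotv (q ep s) w) (b - z) b =
    integ (fun s => dotv (T s) w) (b - z) b - dotv (D ep) w.
  have cc := @contZ _ (I^-1 * dotv (D ep) w) _ ctent.
  rewrite (@eq_integ _ _ (fun s => dotv (T s) w - I^-1 * dotv (D ep) w * tent (b - z) b s)) //.
  - rewrite (integB bz cTw cc) (integZ _ bz ctent) -/I.
    by rewrite mulrAC mulVf ?gt_eqF// mul1r.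
  - exact: contB.
  - by move=> s hs; rewrite q_left// Te// dotvDl dotvNl dotvZl; ring.
have -> : integ (fun s => dotv (q ep s) w) b v =
    integ (fun s => dotv (T s) w) b v + dotv (D ep) w.
  rewrite /D integv_dotv ?(ltW bv)// -(integD (ltW bv) cTw c0w).
  apply: eq_integ => //; [exact: ltW|exact: contD|].
  by move=> s /andP[hs _]; rewrite q_right// dotvDl dotvNl; ring.
by ring.
Qed.

(** On the left of [b] the velocity is nearly constant. On its right, over a time [t - s],
    the direction turns by at most [(t - s) / (r |N|)], because inversion divides the
    differences of velocities by [|N s| |N t|], while the arclength grows by
    [(t - s) / |N|]. *)
Let q_curvature ep : 0 < ep -> ep <= 1 / 16 -> gap * ep <= 1 / 2 ->
  4 * ep * (v - b) / I <= (1 / 2) ^+ 2 / r ->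
  curvature_le (q ep) (primitive (fun s => normv (q ep s))) r (b - z) v.
Proof.
move=> e0 e1 e2 e3; have [k qk] := q_lip e0 e1; have rp := r0.
have bz : b - z <= b by have := z0; lra.
have cq : coord_continuous_fun (q ep) := lipschitz_coord_continuous qk.
have qlow s : 1 / 2 <= normv (q ep s).
  have := normv_sub (T s) (q ep s); rewrite (unit_normv T1) normvC.
  by have := q_close s e0 e1; lra.
have qup s : normv (q ep s) <= 2.
  have := normv_sub (q ep s) (T s); rewrite (unit_normv T1).
  by have := q_close s e0 e1; lra.
have qn0 s : q ep s != 0.
  by apply/eqP => qs; have := qlow s; rewrite qs normv0; lra.
have dL := primitiveP (continuous_normv cq).
have hL : {homo (primitive (fun s => normv (q ep s))) : x y / x <= y}.
  move=> x y xy; apply: (derive_nondecreasing xy (fun s _ => dL s)) => s _.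
  exact: normv_ge0.
apply: (@curvature_le_cat _ _ _ _ _ _ b) => //; first exact: ltW.
  apply: (@curvature_le_lip _ _ _ r (b - z) b (1 / 2) (normv (D ep) / I) 2) => //.
    move=> s t bs st tb.
    rewrite !q_left; [|apply/andP; split; lra|apply/andP; split; lra].
    have E (A W : 'rV[R]_n) (x y : R) : (A - x *: W) - (A - y *: W) = (y - x) *: W.
      by apply/rowP => i; rewrite !mxE; ring.
    rewrite E -mulrBl normvZ normrM (gtr0_norm (_ : 0 < I^-1)) ?invr_gt0//.
    set c := normv (D ep) / I; have c0 : 0 <= c by rewrite divr_ge0 ?normv_ge0// ltW.
    have -> : `|tent (b - z) b t - tent (b - z) b s| / I * normv (D ep) =
        c * `|tent (b - z) b t - tent (b - z) b s| by rewrite /c; ring.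
    rewrite ler_wpM2l//; have := tent_lip (b - z) b t s.
    by rewrite mul1r (ger0_norm (_ : 0 <= t - s))// subr_ge0.
  by apply: le_trans e3; rewrite ler_pM2r ?invr_gt0// D_small.
apply: (@curvature_le_local _ _ _ _ _ _ _ 2) => // [s t bs st tv|d d0].
  have d (x : R) : s <= x <= t -> is_derive x 1
      (fun x => 2 * x - primitive (fun s => normv (q ep s)) x) (2 - normv (q ep x)).
    by move=> _; apply: (der_eq (derB (derZ 2 (der_id x)) (dL x))); rewrite mulr1.
  have := derive_nondecreasing st d => h.
  suff /h : forall x, s <= x <= t -> 0 <= 2 - normv (q ep x) by lra.
  by move=> x _; rewrite subr_ge0.
pose et := Num.min (1 / 4) (d / (2 * (2 + d))).
have et0 : 0 < et by rewrite lt_min !divr_gt0 ?mulr_gt0//; lra.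
exists (et * r); first by rewrite mulr_gt0.
move=> s t bs st tv ts.
pose h := r^-1 * (t - s).
have h0 : 0 <= h by rewrite mulr_ge0 ?invr_ge0 ?(ltW r0)// subr_ge0.
have het : h < et by rewrite /h mulrC ltr_pdivrMr.
have h1 : h < 1 / 4 by apply: lt_le_trans het _; rewrite ge_min lexx.
have h2 : h * (2 * (2 + d)) <= d.
  have : et <= d / (2 * (2 + d)) by rewrite ge_min lexx orbT.
  move=> h2; rewrite -ler_pdivlMr ?mulr_gt0//; last by lra.
  by apply: ltW; exact: lt_le_trans het h2.
have Ns := Nlow s e0 e1.
have Nx x : s <= x -> x <= t -> normv (N ep s) - h <= normv (N ep x) <= normv (N ep s) + h.
  move=> sx xt; have l := Nlip s x e0 e1.
  have {}l : normv (N ep s - N ep x) <= h.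
    apply: le_trans l _; rewrite /h ler_pM2l ?invr_gt0// distrC ger0_norm; lra.
  have l1 := normv_sub (N ep s) (N ep x); have l2 := normv_sub (N ep x) (N ep s).
  by rewrite normvC in l2; apply/andP; split; lra.
pose c := normv (N ep s) - h.
have c0 : 0 < c by rewrite /c; lra.
have cs : c <= normv (N ep s) by rewrite /c; lra.
have ct : c <= normv (N ep t) by have /andP[] := Nx t st (lexx t).
have dirE x : b <= x -> dirv (q ep x) = dirv (N ep x).
  move=> bx; rewrite q_right// /q0 dirvZ// invr_gt0 exprn_gt0//.
  exact: normv_gt0 (Nneq0 x e0 e1).
rewrite !dirE//; last exact: le_trans st.
apply: le_trans (dirv_dist c0 cs ct) _.
have l : (t - s) / (normv (N ep s) + h) <=
    primitive (fun s => normv (q ep s)) t - primitive (fun s => normv (q ep s)) s.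
  have d' (x : R) : s <= x <= t -> is_derive x 1
      (fun x => primitive (fun s => normv (q ep s)) x - (normv (N ep s) + h)^-1 * x)
      (normv (q ep x) - (normv (N ep s) + h)^-1).
    by move=> _; apply: (der_eq (derB (dL x) (derZ _ (der_id x)))); rewrite mulr1.
  have := derive_nondecreasing st d' => hh.
  suff /hh : forall x, s <= x <= t -> 0 <= normv (q ep x) - (normv (N ep s) + h)^-1.
    by rewrite mulrC; set i := _^-1; lra.
  move=> x /andP[sx xt]; rewrite subr_ge0 q_right ?(le_trans bs)// normv_q0//.
  have /andP[_ n2] := Nx x sx xt; have n0 := Nlow x e0 e1.
  by rewrite lef_pV2// posrE; lra.
apply: (@le_trans _ _ ((1 + d) * (h / (normv (N ep s) + h)))); last first.
  rewrite ler_pM2l; last by lra.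
  have -> : h / (normv (N ep s) + h) = (t - s) / (normv (N ep s) + h) / r by rewrite /h; ring.
  by rewrite ler_pM2r// invr_gt0.
apply: (@le_trans _ _ (h / c)).
  rewrite ler_pM2r ?invr_gt0//; have := Nlip s t e0 e1.
  by rewrite /h distrC ger0_norm// subr_ge0.
rewrite mulrCA ler_wpM2l// ler_pdivlMr; last by lra.
by rewrite mulrC ler_pdivrMr// /c; nra.
Qed.

(** To first order in [ep] the competitor of velocity [q ep] gains the integral of
    the density; the straight piece of direction [e] before [b] absorbs the change of
    displacement, lengthwise at unit price and sideways at no first-order cost. *)
Lemma comparison_variation : locally_shortest T r (b - z) v ->
  0 <= integ comparison_density b v.
Proof.
move=> [e_ e_0 hmin]; have [hz hb] := (z0, bv).
have bz : b - z <= b by lra.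
have cg := continuous_comparison_density.
have ctent := @continuous_tent R (b - z) b.
set G := integ comparison_density b v.
pose C := 100 * (v - b) + z / I * 8 * (v - b) ^+ 2.
have C0 : 0 <= C.
  have vb : 0 <= v - b by lra.
  have zI : 0 <= z / I by rewrite divr_ge0// ltW.
  rewrite /C addr_ge0//; first by rewrite mulr_ge0.
  by rewrite mulr_ge0 ?sqr_ge0// mulr_ge0.
pose K := Num.min (Num.min (1 / 16) (1 / (2 * gap)))
  (Num.min (e_ / gap) ((1 / 2) ^+ 2 / r * I / (4 * (v - b)))).
have K0 : 0 < K.
  have gp := gap_gt0; have vb : 0 < 4 * (v - b) by lra.
  have k4 : 0 < (1 / 2) ^+ 2 / r * I / (4 * (v - b)).
    by apply: divr_gt0 => //; apply: mulr_gt0 => //; apply: divr_gt0 => //; rewrite exprn_gt0.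
  have k3 : 0 < e_ / gap by exact: divr_gt0.
  have k2 : 0 < 1 / (2 * gap) by apply: divr_gt0 => //; exact: mulr_gt0.
  by rewrite !lt_min k2 k3 k4 !andbT divr_gt0.
have main ep : 0 < ep -> ep <= K -> 0 <= ep * G + ep ^+ 2 * C.
  move=> e0; rewrite !le_min => /andP[/andP[e1 e2] /andP[e3 e4]].
  have {}e2 : gap * ep <= 1 / 2.
    have -> : gap * ep = ep * (2 * gap) / 2 by field.
    by rewrite ler_pM2r ?invr_gt0// -ler_pdivlMr// mulr_gt0// gap_gt0.
  have {}e3 : gap * ep <= e_ by move: e3; rewrite ler_pdivlMr ?gap_gt0// mulrC.
  have {}e4 : 4 * ep * (v - b) / I <= (1 / 2) ^+ 2 / r.
    have vb : 0 < 4 * (v - b) by lra.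
    rewrite ler_pdivrMr//; move: e4; rewrite ler_pdivlMr// => e4.
    by apply: le_trans e4; rewrite le_eqVlt; apply/orP; left; apply/eqP; ring.
  have [k qk] := q_lip e0 e1.
  have := hmin (q ep) k qk.
  have /[swap]/[apply] : forall s, ~ (b - z < s < v) -> q ep s = T s.
    move=> s hs; rewrite /q tent_out ?mul0r ?scale0r ?subr0.
      by apply: q0_out => /andP[? ?]; apply: hs; apply/andP; split; lra.
    by move=> /andP[? ?]; apply: hs; apply/andP; split; lra.
  have /[swap]/[apply] : forall s, normv (q ep s - T s) <= e_.
    by move=> s; exact: le_trans (q_close s e0 e1) e3.
  have /[swap]/[apply] := fun w => q_disp w e0 e1.
  have /[swap]/[apply] := q_curvature e0 e1 e2 e4.
  rewrite (integ_split _ _ b) => hlen.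
  have cq : coord_continuous_fun (q ep) := lipschitz_coord_continuous qk.
  have cnq := continuous_normv cq.
  have c0 := c_q0T e0 e1.
  have cD := D_small e0 e1.
  have De : dotv (D ep) e = integ (fun s => dotv (q0 ep s - T s) e) b v.
    by rewrite /D integv_dotv// ltW.
  have cc : continuous (fun _ : R => 1 : R) by move=> x; exact: cst_continuous.
  have left_len : integ (fun s => normv (q ep s)) (b - z) b <=
      z - dotv (D ep) e + z / I * dotv (D ep) (D ep) / 2.
    pose A := I^-1 * (dotv (D ep) e - z / I * dotv (D ep) (D ep) / 2).
    have up s : b - z <= s <= b -> normv (q ep s) <= 1 - A * tent (b - z) b s.
      move=> hs; rewrite q_left//.
      have ee : dotv e e = 1 by rewrite -(Te hs).
      apply: le_trans (normv_le_sqr_perturb _ _ ee) _.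
      have /andP[t0 t1] := tentI s; set t := _ / I in t0 t1 *.
      have : t ^+ 2 * dotv (D ep) (D ep) <= t * (z / I) * dotv (D ep) (D ep).
        by rewrite ler_wpM2r ?dotv_ge0// expr2 ler_wpM2l.
      have -> : A * tent (b - z) b s = t * (dotv (D ep) e - z / I * dotv (D ep) (D ep) / 2).
        by rewrite /A /t; ring.
      by rewrite (dotvC e); lra.
    have := integ_le bz cnq (contB cc (@contZ _ A _ ctent)) up.
    rewrite (integB bz cc (@contZ _ A _ ctent)) (integZ _ bz ctent) -/I integ_cst.
    have -> : A * I = dotv (D ep) e - z / I * dotv (D ep) (D ep) / 2.
      by rewrite /A mulrAC mulVf ?gt_eqF// mul1r.
    by lra.
  have right_len : integ (fun s => normv (q ep s)) b v - dotv (D ep) e <=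
      (v - b) + ep * G + 100 * ep ^+ 2 * (v - b).
    have cw : continuous (fun s => dotv (q0 ep s - T s) e).
      by apply: continuous_dotv => //; exact: coord_continuous_cst.
    have up s : b <= s <= v -> normv (q ep s) - dotv (q0 ep s - T s) e <=
        (1 + 100 * ep ^+ 2) + ep * comparison_density s.
      move=> /andP[bs _]; rewrite q_right// normv_q0//.
      have Np := normv_gt0 (Nneq0 s e0 e1).
      have e1' : dotv e e = 1.
        by rewrite -(@Te b)// ?lexx ?andbT.
      have bnd (u w : 'rV[R]_n) : dotv u u = 1 -> dotv w w = 1 -> -1 <= dotv u w <= 1.
        by move=> u1 w1; rewrite dotv_unit_le1 ?dotv_unit_geN1.
      have nE : normv (N ep s) ^+ 2 = 1 - 2 * ep * (1 - ep) * (1 - dotv (T s) (That s)).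
        by rewrite sqr_normv NN.
      have := inversion_estimate e0 e1 (defect_bound s) (bnd _ _ (T1 s) e1')
        (bnd _ _ (H1 s) e1') Np nE.
      have -> : dotv (q0 ep s - T s) e = normv (N ep s) ^- 2 *
          ((1 - ep) * dotv (T s) e + ep * dotv (That s) e) - dotv (T s) e.
        by rewrite /q0 /N dotvDl dotvNl dotvZl dotvDl !dotvZl.
      by rewrite /comparison_density; lra.
    have c1 : continuous (fun _ : R => 1 + 100 * ep ^+ 2 : R).
      by move=> x; exact: cst_continuous.
    have := integ_le (ltW bv) (contB cnq cw) (contD c1 (@contZ _ ep _ cg)) up.
    rewrite (integB (ltW bv) cnq cw) (integD (ltW bv) c1 (@contZ _ ep _ cg)).
    by rewrite (integZ _ (ltW bv) cg) integ_cst -De -/G; lra.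
  have DD : dotv (D ep) (D ep) <= (4 * ep * (v - b)) ^+ 2.
    rewrite -sqr_normv lerXn2r ?nnegrE ?normv_ge0//.
    by apply: le_trans cD; exact: normv_ge0.
  have zI : 0 <= z / I by rewrite divr_ge0// ltW.
  have : z / I * dotv (D ep) (D ep) <= z / I * (4 * ep * (v - b)) ^+ 2 by rewrite ler_wpM2l.
  by rewrite /C; lra.
rewrite leNgt; apply/negP => G0.
pose ep := Num.min K (- G / (2 * (C + 1))).
have C1 : 0 < 2 * (C + 1) by lra.
have ep0 : 0 < ep by rewrite lt_min K0 divr_gt0// oppr_gt0.
have epK : ep <= K by rewrite ge_min lexx.
have epG : ep * (2 * (C + 1)) <= - G by rewrite -ler_pdivlMr// ge_min lexx orbT.
have := main ep ep0 epK.
have -> : ep * G + ep ^+ 2 * C = ep * (G + ep * C) by ring.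
by rewrite pmulr_rge0//; lra.
Qed.

End ComparisonVariation.

(** * A straight piece is continued by a circular arc *)

Section GreatCircles.
Context {R : realType} {n : nat}.
Implicit Types (e f : 'rV[R]_n).

Definition great_circle e f (x : R) : 'rV[R]_n := cos x *: e + sin x *: f.

Lemma great_circle_dot e f x y : dotv e e = 1 -> dotv f f = 1 -> dotv e f = 0 ->
  dotv (great_circle e f x) (great_circle e f y) = cos (x - y).
Proof. by move=> e1 f1 ef; rewrite /great_circle !dotvE e1 f1 (dotvC f e) ef cosB; ring. Qed.

Lemma great_circle_dot0 e f x : dotv e e = 1 -> dotv e f = 0 ->
  dotv (great_circle e f x) e = cos x.
Proof. by move=> e1 ef; rewrite /great_circle !dotvE e1 (dotvC f) ef; ring. Qed.

Lemma great_circle_lip e f x y : dotv e e = 1 -> dotv f f = 1 -> dotv e f = 0 ->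
  normv (great_circle e f x - great_circle e f y) <= `|x - y|.
Proof.
move=> e1 f1 ef; apply: normv_le => //.
rewrite dotvB_unit ?great_circle_dot ?subrr ?cos0// real_normK ?num_real//.
by have := cos_ge_quad (x - y); lra.
Qed.

Lemma lip_glue (f g : R -> 'rV[R]_n) k b : f b = g b ->
  (forall s t, normv (f s - f t) <= k * `|s - t|) ->
  (forall s t, normv (g s - g t) <= k * `|s - t|) ->
  forall s t, normv ((if s <= b then f s else g s) - (if t <= b then f t else g t))
    <= k * `|s - t|.
Proof.
move=> fg fk gk; have main s t : s <= b -> b < t ->
    normv (f s - g t) <= k * `|s - t|.
  move=> sb bt; apply: le_trans (normv_dist _ (f b) _) _.
  have -> : k * `|s - t| = k * `|s - b| + k * `|b - t|.
    rewrite -mulrDr; congr (_ * _).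
    by rewrite !ler0_norm ?subr_le0 ?(le_trans sb) ?(ltW bt)//; ring.
  by apply: lerD => //; rewrite fg.
move=> s t; case: (leP s b) => sb; case: (leP t b) => tb //; first exact: main.
by rewrite normvC distrC main.
Qed.

End GreatCircles.

Section ComparisonArc.
Context {R : realType} {n : nat}.
Variables (T : R -> 'rV[R]_n) (r b v th : R) (e : 'rV[R]_n).
Hypotheses (r0 : 0 < r) (bv : b < v) (vpi : v - b < pi * r).
Hypotheses (T1 : forall s, dotv (T s) (T s) = 1).
Hypotheses (TL : forall s t, normv (T s - T t) <= r^-1 * `|s - t|).
Hypotheses (Tb : T b = e).
Hypotheses (th0 : 0 <= th) (thv : th <= (v - b) / r) (thE : cos th = dotv e (T v)).

(** Among the motions on the sphere from [e] to [T v] in the given time and of speed at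
    most [1 / r], the comparison arc stays at [e] as long as possible and then follows
    the great circle through [T v]; its inner product with [e] is pointwise the largest. *)
Definition delay : R := (v - b) / r - th.
Definition arc_normal : 'rV[R]_n := (sin th)^-1 *: (T v - cos th *: e).
Definition arc_angle s : R := Num.min th (Num.max 0 ((s - b) / r - delay)).
Definition circle_part s := great_circle e arc_normal (arc_angle s).
Definition comparison_arc s :=
  if s <= v then if s <= b then T s else circle_part s else T s.

Let e1 : dotv e e = 1. Proof. by rewrite -Tb. Qed.

Let thpi : th < pi.
Proof. by apply: le_lt_trans thv _; rewrite ltr_pdivrMr. Qed.

Let sinth_ge0 : 0 <= sin th.
Proof. by rewrite sin_ge0_pi// th0 ltW. Qed.

Let th_eq0 : sin th = 0 -> th = 0.
Proof.
move=> s0; apply/eqP; rewrite eq_le th0 andbT leNgt; apply/negP => h.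
by have := @sin_gt0_pi R th; rewrite h thpi s0 ltxx => /(_ isT).
Qed.

Let th0_end : th = 0 -> T v = e.
Proof.
move=> t0; move: thE; rewrite t0 cos0 => h; symmetry.
by apply: dotv_unit_eq1 => //; rewrite -h.
Qed.

Lemma arc_angle_lip s t : `|arc_angle s - arc_angle t| <= r^-1 * `|s - t|.
Proof.
have main x y : arc_angle x - arc_angle y <= r^-1 * `|x - y|.
  have h0 : 0 <= r^-1 * `|x - y| by rewrite mulr_ge0// invr_ge0 ltW.
  have h1 : (x - b) / r - (y - b) / r <= r^-1 * `|x - y|.
    rewrite -mulrBl mulrC ler_pM2l ?invr_gt0//.
    by have -> : x - b - (y - b) = x - y by [ring]; exact: ler_norm.
  rewrite lerBlDr /arc_angle ge_min.
  have [c|c] := leP th (Num.max 0 ((y - b) / r - delay)).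
    by apply/orP; left; rewrite lerDr.
  apply/orP; right; rewrite ge_max; apply/andP; split.
    by apply: addr_ge0 => //; rewrite le_max lexx.
  have : (y - b) / r - delay <= Num.max 0 ((y - b) / r - delay) by rewrite le_max lexx orbT.
  by lra.
rewrite ler_norml main andbT lerNl opprB.
by have := main t s; rewrite (distrC t s).
Qed.

Lemma arc_angle_start s : s <= b + r * delay -> arc_angle s = 0.
Proof.
move=> hs; have h : (s - b) / r - delay <= 0.
  by rewrite subr_le0 ler_pdivrMr// mulrC lerBlDl.
by rewrite /arc_angle (max_idPl h) (min_idPr th0).
Qed.

Lemma arc_angle_moving s : b + r * delay <= s -> s <= v ->
  [/\ arc_angle s = (s - b) / r - delay, 0 <= arc_angle s & th - arc_angle s = (v - s) / r].
Proof.
move=> hs sv; have h : 0 <= (s - b) / r - delay.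
  by rewrite subr_ge0 ler_pdivlMr// mulrC lerBrDl.
have h2 : (s - b) / r - delay <= th.
  rewrite /delay opprB addrCA -lerBrDl subrr subr_le0 ler_pM2r ?invr_gt0//; lra.
have E : arc_angle s = (s - b) / r - delay by rewrite /arc_angle (max_idPr h) (min_idPr h2).
by split=> //; rewrite E// /delay; field; rewrite gt_eqF.
Qed.

Lemma arc_normal_unit : sin th != 0 -> dotv arc_normal arc_normal = 1 /\ dotv e arc_normal = 0.
Proof.
move=> s0; have cs := cos2Dsin2 th.
rewrite /arc_normal !dotvE T1 e1 (dotvC (T v) e) -thE; split; last by ring.
by transitivity ((1 - cos th ^+ 2) / sin th ^+ 2); [field|rewrite -sin2cos2 divff// expf_neq0].
Qed.

Lemma circle_part_unit s : dotv (circle_part s) (circle_part s) = 1.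
Proof.
have [s0|s0] := eqVneq (sin th) 0.
  have t0 := th_eq0 s0.
  have -> : circle_part s = e; last exact: e1.
  rewrite /circle_part /arc_angle t0 min_l; last by rewrite le_max lexx.
  by rewrite /great_circle cos0 sin0 scale1r scale0r addr0.
by have [f1 ef] := arc_normal_unit s0; rewrite great_circle_dot// subrr cos0.
Qed.

Lemma circle_part_lip s t : normv (circle_part s - circle_part t) <= r^-1 * `|s - t|.
Proof.
have [s0|s0] := eqVneq (sin th) 0.
  have t0 := th_eq0 s0.
  have E x : arc_angle x = 0 by rewrite /arc_angle t0 min_l// le_max lexx.
  by rewrite /circle_part !E subrr normv0 mulr_ge0// invr_ge0 ltW.
have [f1 ef] := arc_normal_unit s0; apply: le_trans (great_circle_lip _ _ e1 f1 ef) _.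
exact: arc_angle_lip.
Qed.

Lemma circle_part_start s : s <= b + r * delay -> circle_part s = e.
Proof.
by move=> hs; rewrite /circle_part arc_angle_start// /great_circle cos0 sin0 scale1r scale0r addr0.
Qed.

Let rd0 : 0 <= r * delay. Proof. by rewrite mulr_ge0 ?(ltW r0)// subr_ge0. Qed.

Let rdv : b + r * delay <= v.
Proof.
have -> : b + r * delay = v - r * th by rewrite /delay; field; rewrite gt_eqF.
by rewrite gerBl mulr_ge0// ltW.
Qed.

Lemma circle_part_end : circle_part v = T v.
Proof.
have [E E0 E1] := arc_angle_moving rdv (lexx v).
have Eth : arc_angle v = th by move: E1; rewrite subrr mul0r; lra.
rewrite /circle_part Eth /great_circle /arc_normal.
have [s0|s0] := eqVneq (sin th) 0.
  by rewrite s0 scale0r addr0 (th_eq0 s0) cos0 scale1r th0_end// th_eq0.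
by rewrite scalerA divff// scale1r addrC subrK.
Qed.

Lemma comparison_arc_inside s : b <= s <= v -> comparison_arc s = circle_part s.
Proof.
move=> /andP[bs sv]; rewrite /comparison_arc sv; case: (leP s b) => // sb.
have -> : s = b by lra.
by rewrite Tb circle_part_start//; have := rd0; lra.
Qed.

Lemma comparison_arc_unit s : dotv (comparison_arc s) (comparison_arc s) = 1.
Proof. by rewrite /comparison_arc; do 2 case: ifP => // _; exact: circle_part_unit. Qed.

Lemma comparison_arc_lip s t :
  normv (comparison_arc s - comparison_arc t) <= r^-1 * `|s - t|.
Proof.
apply: (@lip_glue _ _ (fun s => if s <= b then T s else circle_part s) T) => //.
  by rewrite leNgt bv/= circle_part_end.
apply: lip_glue => //; last exact: circle_part_lip.
by rewrite circle_part_start//; have := rd0; lra.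
Qed.

Lemma comparison_arc_outside s : ~ (b < s < v) -> comparison_arc s = T s.
Proof.
move=> hs; rewrite /comparison_arc; case: (leP s v) => // sv; case: (leP s b) => // sb.
have -> : s = v; last exact: circle_part_end.
by apply/eqP; rewrite eq_le sv leNgt; apply/negP => h; apply: hs; rewrite sb.
Qed.

(** Spherical geometry of the triangle [e], [T s], [T v]: the distance between [T]
    and the comparison arc is controlled by the loss of inner product with [e]. *)
Lemma comparison_defect s : b + r * delay <= s -> s <= v ->
  sin th * (1 - dotv (T s) (circle_part s)) <=
  sin ((v - s) / r) * (cos (arc_angle s) - dotv (T s) e).
Proof.
move=> hs sv; have [E E0 E1] := arc_angle_moving hs sv.
have bs : b <= s by have := rd0; lra.
have sTv : cos ((v - s) / r) <= dotv (T s) (T v).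
  have h := lip_curvature_le r0 T1 TL (lexx s) sv (lexx v).
  rewrite /= !(unit_dirv T1) in h; apply: h.
  by have := vpi; lra.
have [s0|s0] := eqVneq (sin th) 0.
  have t0 := th_eq0 s0.
  have Ea : arc_angle s = 0 by rewrite /arc_angle t0 min_l// le_max lexx.
  have -> : (v - s) / r = 0 by rewrite -E1 t0 Ea subrr.
  by rewrite s0 sin0 !mul0r.
rewrite -E1 in sTv *.
set psi := arc_angle s in E E0 E1 sTv *.
have hc : sin th * dotv (T s) (circle_part s) =
    sin (th - psi) * dotv (T s) e + sin psi * dotv (T s) (T v).
  rewrite /circle_part -/psi /great_circle /arc_normal !dotvE sinB.
  by field.
have hsin : sin th = sin (th - psi) * cos psi + cos (th - psi) * sin psi.
  by rewrite -sinD subrK.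
have : 0 <= sin psi.
  rewrite sin_ge0_pi// E0/=; apply: le_trans (ltW thpi).
  have : 0 <= th - psi by rewrite E1 divr_ge0 ?subr_ge0// ltW.
  by lra.
move=> sp; have := ler_wpM2l sp sTv.
by rewrite mulrBr mulr1 hc {1}hsin; lra.
Qed.

Lemma circle_part_dot s : dotv (circle_part s) e = cos (arc_angle s).
Proof.
have [s0|s0] := eqVneq (sin th) 0.
  have t0 := th_eq0 s0.
  have Ea : arc_angle s = 0 by rewrite /arc_angle t0 min_l// le_max lexx.
  by rewrite /circle_part Ea /great_circle sin0 cos0 scale1r scale0r addr0.
have [f1 ef] := arc_normal_unit s0.
exact: great_circle_dot0.
Qed.

Lemma comparison_le s : b <= s <= v -> dotv (T s) e <= dotv (circle_part s) e.
Proof.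
move=> /andP[bs sv]; rewrite circle_part_dot.
have [h|/ltW h] := leP s (b + r * delay).
  by rewrite arc_angle_start// cos0 dotv_unit_le1.
have [->|nsv] := eqVneq s v.
  by rewrite -circle_part_end circle_part_dot.
have {nsv}sv' : s < v by rewrite lt_neqAle nsv.
have [E E0 E1] := arc_angle_moving h sv.
have p : 0 < sin ((v - s) / r).
  rewrite sin_gt0_pi// divr_gt0 ?subr_gt0//= ltr_pdivrMr//.
  by have := vpi; lra.
have := comparison_defect h sv.
have : 0 <= sin th * (1 - dotv (T s) (circle_part s)).
  by rewrite mulr_ge0// subr_ge0 dotv_unit_le1// circle_part_unit.
by move=> h1 /(le_trans h1); rewrite pmulr_rge0// subr_ge0.
Qed.

Lemma comparison_eq s : b <= s <= v -> dotv (circle_part s) e <= dotv (T s) e ->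
  T s = circle_part s.
Proof.
move=> /andP[bs sv]; rewrite circle_part_dot => hle.
have [h|/ltW h] := leP s (b + r * delay).
  move: hle; rewrite arc_angle_start// cos0 circle_part_start// => h1.
  exact: dotv_unit_eq1.
have [->|nsv] := eqVneq s v; first by rewrite circle_part_end.
have hp : 0 <= sin ((v - s) / r).
  rewrite sin_ge0_pi// divr_ge0 ?subr_ge0 ?(ltW r0)//= ler_pdivrMr//.
  by have := vpi; lra.
have hd := comparison_defect h sv.
have {}hd : sin th * (1 - dotv (T s) (circle_part s)) <= 0.
  by apply: le_trans hd _; rewrite mulr_ge0_le0// subr_le0.
have [s0|s0] := eqVneq (sin th) 0.
  have t0 := th_eq0 s0.
  have Ea : arc_angle s = 0 by rewrite /arc_angle t0 min_l// le_max lexx.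
  have -> : circle_part s = e by rewrite /circle_part Ea /great_circle sin0 cos0 scale1r scale0r addr0.
  by apply: dotv_unit_eq1 => //; move: hle; rewrite Ea cos0.
have sp : 0 < sin th by rewrite lt_def s0 sinth_ge0.
apply: dotv_unit_eq1 => //; first exact: circle_part_unit.
by move: hd; rewrite pmulr_rle0// subr_le0.
Qed.

End ComparisonArc.

Section Continuation.
Context {R : realType} {n : nat}.
Variables (T : R -> 'rV[R]_n) (r b z : R) (e : 'rV[R]_n).
Hypotheses (r0 : 0 < r) (z0 : 0 < z).
Hypotheses (T1 : forall s, dotv (T s) (T s) = 1).
Hypotheses (TL : forall s t, normv (T s - T t) <= r^-1 * `|s - t|).
Hypotheses (Te : forall s, b - z <= s <= b -> T s = e).

Let Tb : T b = e. Proof. by rewrite Te// lexx gerBl ltW. Qed.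
Let e1 : dotv e e = 1. Proof. by rewrite -Tb. Qed.

(** [T] runs along the great circle of initial velocity [f] during [[b, d]]. *)
Definition turns f d := [/\ dotv f f = 1, dotv e f = 0 &
  forall s, b <= s <= d -> T s = great_circle e f ((s - b) / r)].

Lemma cos_time_le s t : s <= t -> t - s <= pi * r -> cos ((t - s) / r) <= dotv (T s) (T t).
Proof.
move=> st h; have := lip_curvature_le r0 T1 TL (lexx s) st (lexx t) h.
by rewrite /= !(unit_dirv T1).
Qed.

Lemma acos_dot_le s t : s <= t -> t - s <= pi * r -> acos (dotv (T s) (T t)) <= (t - s) / r.
Proof.
move=> st tpi; have h : -1 <= dotv (T s) (T t) <= 1 by rewrite dotv_unit_geN1 ?dotv_unit_le1.
have E : cos (acos (dotv (T s) (T t))) = dotv (T s) (T t) by rewrite acosK// in_itv.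
have p0 : 0 <= (t - s) / r by rewrite divr_ge0 ?subr_ge0// ltW.
have p1 : (t - s) / r <= pi by rewrite ler_pdivrMr.
rewrite leNgt; apply/negP => c.
have := cos_time_le st tpi; rewrite -E leNgt => /negP; apply.
by rewrite ltr_cos// in_itv/= ?acos_ge0 ?acos_lepi ?p0 ?p1.
Qed.

Lemma acos_time_le v : b <= v -> v - b <= pi * r ->
  [/\ 0 <= acos (dotv e (T v)), acos (dotv e (T v)) <= (v - b) / r &
      cos (acos (dotv e (T v))) = dotv e (T v)].
Proof.
move=> bv vpi; have h : -1 <= dotv e (T v) <= 1 by rewrite dotv_unit_geN1 ?dotv_unit_le1.
split; [exact: acos_ge0|by rewrite -Tb acos_dot_le|by rewrite acosK// in_itv].
Qed.

Let comparison v th := comparison_arc T r b v th e.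

(** Without delay, the comparison arc is the circular arc of radius [r]. *)
Lemma turns_comparison v th : b < v -> v - b < pi * r -> 0 <= th ->
  cos th = dotv e (T v) -> th = (v - b) / r ->
  (forall s, b < s < v -> T s = circle_part T r b v th e s) ->
  turns (arc_normal T v th e) v.
Proof.
move=> bv vpi th0 thE thv TE.
have th_gt0 : 0 < th by rewrite thv divr_gt0 ?subr_gt0.
have thpi : th < pi by rewrite thv ltr_pdivrMr.
have s0 : sin th != 0 by rewrite gt_eqF// sin_gt0_pi// th_gt0.
have [f1 ef] := arc_normal_unit T1 Tb thE s0.
have d0 : delay r b v th = 0 by rewrite /delay thv subrr.
have thv' : th <= (v - b) / r by rewrite thv.
split=> // s /andP[bs sv].
have [E _ _] : [/\ arc_angle r b v th s = (s - b) / r - delay r b v th,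
    0 <= arc_angle r b v th s & th - arc_angle r b v th s = (v - s) / r].
  by apply: arc_angle_moving => //; rewrite d0 mulr0 addr0.
rewrite d0 subr0 in E; rewrite -E.
have [->|sb] := eqVneq s b.
  by rewrite Tb -[LHS](@circle_part_start _ _ T r b v th e r0 th0 b)// d0 mulr0 addr0.
have [->|nsv] := eqVneq s v; first by rewrite -[LHS](circle_part_end r0 vpi T1 Tb th0 thv' thE).
by apply: TE; rewrite !lt_def bs sv sb eq_sym nsv.
Qed.

Let density v th s := comparison_density T (comparison v th) e s.

Lemma comparison_integ_ge0 v th : b < v -> v - b < pi * r -> 0 <= th -> th <= (v - b) / r ->
  cos th = dotv e (T v) -> locally_shortest T r (b - z) v -> 0 <= integ (density v th) b v.
Proof.
move=> bv vpi th0 thv thE hls; apply: (comparison_variation r0 z0 bv T1 TL _ _ _ Te hls).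
- exact: comparison_arc_unit.
- exact: comparison_arc_lip.
- exact: comparison_arc_outside.
Qed.

Lemma continuous_density v th : b < v -> v - b < pi * r -> 0 <= th -> th <= (v - b) / r ->
  cos th = dotv e (T v) -> continuous (density v th).
Proof.
move=> bv vpi th0 thv thE; apply: (@continuous_comparison_density _ _ T (comparison v th) r e TL).
exact: comparison_arc_lip.
Qed.

Lemma densityE v th s : b < v -> v - b < pi * r -> 0 <= th -> th <= (v - b) / r ->
  b <= s <= v -> density v th s =
  (1 - dotv (T s) (circle_part T r b v th e s)) * (1 - 2 * dotv (T s) e) -
  (dotv (circle_part T r b v th e s) e - dotv (T s) e).
Proof.
by move=> bv vpi th0 thv hs; rewrite /density /comparison_density /comparison comparison_arc_inside.
Qed.

(** As long as [T] has turned by less than [pi / 3], both terms of the density are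
    nonpositive, so that [T] coincides with the comparison arc; the delay of the latter
    vanishes because [T] moves immediately after [b]. *)
Lemma first_turn v : b < v -> v - b <= r -> locally_shortest T r (b - z) v ->
  (forall t, b < t -> exists2 s, b < s <= t & T s != e) -> exists f, turns f v.
Proof.
move=> bv vr hls moves; have pi2 := pi_ge2 R; have rp := r0.
have vpi : v - b < pi * r.
  by apply: le_lt_trans vr _; rewrite ltr_pMl//; lra.
have [] := acos_time_le (ltW bv) (ltW vpi); set th := acos _ => th0 thv thE.
have x_ge s : b <= s <= v -> 1 / 2 <= dotv (T s) e.
  move=> /andP[bs sv]; have spi : s - b <= pi * r by lra.
  have := cos_time_le bs spi; rewrite Tb dotvC; apply: le_trans.
  have := cos_ge_quad ((s - b) / r).
  have : ((s - b) / r) ^+ 2 <= 1.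
    rewrite expr_le1// ?divr_ge0 ?subr_ge0 ?(ltW r0)// ler_pdivrMr//; lra.
  by lra.
have parts s : b <= s <= v ->
    (1 - dotv (T s) (circle_part T r b v th e s)) * (1 - 2 * dotv (T s) e) <= 0 /\
    0 <= dotv (circle_part T r b v th e s) e - dotv (T s) e.
  move=> hs; have xs := x_ge s hs.
  have le1 : dotv (T s) (circle_part T r b v th e s) <= 1.
    by rewrite dotv_unit_le1//; exact: circle_part_unit.
  rewrite subr_ge0; split; last exact: comparison_le.
  by rewrite mulr_ge0_le0 ?subr_ge0//; lra.
have cd := continuous_density bv vpi th0 thv thE.
have zero s : b < s < v -> -1 * density v th s = 0.
  apply: (integ_eq0 (ltW bv) (@contZ _ (-1) _ cd)) => [x hx|].
    by have [] := parts x hx; rewrite densityE//; lra.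
  rewrite (integZ _ (ltW bv) cd); have := comparison_integ_ge0 bv vpi th0 thv thE hls.
  by lra.
have TE s : b < s < v -> T s = circle_part T r b v th e s.
  move=> hs; have hs' : b <= s <= v by case/andP: hs => ? ?; rewrite !ltW.
  apply: comparison_eq => //; have [] := parts s hs'; have := zero s hs.
  by rewrite densityE//; lra.
have d0 : th = (v - b) / r.
  apply/eqP; rewrite eq_le thv/= leNgt; apply/negP => c.
  have dp : 0 < delay r b v th by rewrite subr_gt0.
  have bt : b < b + r * delay r b v th by rewrite ltrDl mulr_gt0.
  have tv : b + r * delay r b v th <= v.
    have -> : b + r * delay r b v th = v - r * th by rewrite /delay; field; rewrite gt_eqF.
    by rewrite gerBl mulr_ge0// ltW.
  have [s /andP[bs st] /eqP] := moves _ bt; apply.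
  have [sE|sv] := eqVneq s v.
    rewrite sE -(circle_part_end r0 vpi T1 Tb th0 thv thE).
    by apply: circle_part_start => //; rewrite -{1}sE.
  rewrite TE; first exact: circle_part_start.
  by rewrite bs lt_neqAle sv (le_trans st tv).
by exists (arc_normal T v th e); exact: turns_comparison.
Qed.

Lemma great_circle_dot2 f g x y : dotv e f = 0 -> dotv e g = 0 ->
  dotv (great_circle e f x) (great_circle e g y) =
  cos (x - y) - sin x * sin y * (1 - dotv f g).
Proof. by move=> ef eg; rewrite /great_circle !dotvE e1 (dotvC f e) ef eg cosB; ring. Qed.

(** The unit vector [T v] is at distance at most [eta] from the end of the turn, hence at
    distance at least [p - eta] from [e], by the spherical triangle inequality. *)
Lemma turn_delay f p eta v D : 0 < p -> turns f (b + r * p) -> 0 < eta -> eta <= p / 4 ->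
  p + eta < pi -> v = b + r * (p + eta) -> D = p + eta - acos (dotv e (T v)) ->
  0 <= D <= 2 * eta.
Proof.
move=> p0 [f1 ef Tf] h0 h1 ppi vE DE; have rp := r0.
have bv : b <= v by rewrite vE lerDl mulr_ge0//; lra.
have vr : (v - b) / r = p + eta by rewrite vE; field; rewrite gt_eqF.
have vpi : v - b <= pi * r by rewrite -ler_pdivrMr// vr ltW.
have [] := acos_time_le bv vpi; move: DE; set th := acos _ => DE th0; rewrite vr => thv thE.
have mv : b + r * p <= v by rewrite vE lerD2l ler_pM2l//; lra.
have mE : T (b + r * p) = great_circle e f p.
  rewrite Tf; last by rewrite lexx andbT lerDl mulr_ge0// ltW.
  by congr great_circle; field; rewrite gt_eqF.
have mT : cos eta <= dotv (T v) (T (b + r * p)).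
  have h : v - (b + r * p) = r * eta by rewrite vE; ring.
  have hpi : v - (b + r * p) <= pi * r by rewrite h mulrC ler_pM2r//; lra.
  have := cos_time_le mv hpi; rewrite h dotvC.
  by have -> : r * eta / r = eta by field; rewrite gt_eqF.
rewrite DE subr_ge0 thv/=; suff : p <= th + eta by lra.
rewrite leNgt; apply/negP => c.
have tpi : th + eta <= pi by lra.
have := spherical_triangle e1 (T1 v) (T1 (b + r * p)) th0 (ltW h0) tpi.
rewrite thE lexx => /(_ isT mT).
rewrite mE dotvC great_circle_dot0// leNgt => /negP; apply.
by rewrite ltr_cos// in_itv/=; apply/andP; split; lra.
Qed.

(** When the turn is prolonged by the angle [eta], the two great circles differ to
    second order only, in terms of [eta] and of the delay [D <= 2 eta]. *)
Lemma comparison_close f p eta v D th : 0 < p -> turns f (b + r * p) -> 0 < eta ->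
  eta <= p / 4 -> eta <= sin p / 2 -> p + eta < pi -> v = b + r * (p + eta) ->
  th = acos (dotv e (T v)) -> D = p + eta - th -> forall s, b <= s <= v ->
  1 - dotv (T s) (circle_part T r b v th e s) <=
    (1 + 2 / sin p ^+ 2 + 2 / sin p) * (D * eta).
Proof.
move=> p0 tf h0 h1 h2 ppi vE th_def DE s /andP[bs sv]; have rp := r0.
have [f1 ef Tf] := tf.
have /andP[D0 D2] : 0 <= D <= 2 * eta.
  by apply: (turn_delay p0 tf h0 h1 ppi vE); rewrite -th_def.
have bv : b < v by rewrite vE ltrDl mulr_gt0//; lra.
have vr : (v - b) / r = p + eta by rewrite vE; field; rewrite gt_eqF.
have vpi : v - b < pi * r by rewrite -ltr_pdivrMr// vr.
have [] := acos_time_le (ltW bv) (ltW vpi); rewrite -th_def => th0 thv thE.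
have dD : delay r b v th = D by rewrite /delay vr DE.
have S0 : 0 < sin p by rewrite sin_gt0_pi// p0/=; lra.
have St : sin p / 2 <= sin th.
  have := sin_lip p th; rewrite ler_norml => /andP[_].
  have : `|p - th| <= eta by rewrite ler_norml DE in D0 D2 *; lra.
  by lra.
have st0 : sin th != 0 by rewrite gt_eqF//; lra.
have [g1 eg] := arc_normal_unit T1 Tb thE st0.
set g := arc_normal _ _ _ _ in g1 eg.
have K1 : 0 <= 2 / sin p ^+ 2 by rewrite divr_ge0// sqr_ge0.
have K2 : 0 <= 2 / sin p by rewrite divr_ge0// ltW.
have De : 0 <= D * eta by rewrite mulr_ge0// ltW.
have K1D : 0 <= 2 / sin p ^+ 2 * (D * eta) by rewrite mulr_ge0.
have K2D : 0 <= 2 / sin p * (D * eta) by rewrite mulr_ge0.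
have DD : D ^+ 2 / 2 <= D * eta.
  have : D * D <= D * (2 * eta) by rewrite ler_wpM2l.
  by rewrite expr2; lra.
pose a := (s - b) / r.
have a0 : 0 <= a by rewrite divr_ge0 ?subr_ge0// ltW.
have sE : s = b + r * a by rewrite /a; field; rewrite gt_eqF.
have aend : a <= p + eta by rewrite -vr ler_pM2r ?invr_gt0// lerD2r.
have [aD|Da] := leP a D.
  have ap : a <= p by lra.
  rewrite circle_part_start//; last by rewrite dD {1}sE lerD2l ler_pM2l.
  rewrite Tf -/a; last by rewrite bs {1}sE lerD2l ler_pM2l.
  rewrite great_circle_dot0//; have := cos_ge_quad a.
  have : a ^+ 2 <= D ^+ 2 by rewrite lerXn2r ?nnegrE.
  by rewrite !mulrDl mul1r; lra.
have hs : b + r * delay r b v th <= s by rewrite dD {1}sE lerD2l ler_pM2l// ltW.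
have [aE aa0 a1] := arc_angle_moving r0 hs sv.
have [ap|pa] := leP a p.
  rewrite Tf -/a; last by rewrite bs {1}sE lerD2l ler_pM2l.
  rewrite /circle_part aE -/a dD -/g great_circle_dot2//.
  have -> : a - (a - D) = D by ring.
  have X1 : dotv f g <= 1 by rewrite dotv_unit_le1.
  have xx : (1 - dotv f g) <= 2 / sin p ^+ 2 * (D * eta).
    have mE : T (b + r * p) = great_circle e f p.
      rewrite Tf; last by rewrite lexx andbT lerDl mulr_ge0// ltW.
      by congr great_circle; field; rewrite gt_eqF.
    have vE2 : T v = great_circle e g th.
      rewrite /g /arc_normal /great_circle scalerA divff// scale1r.
      by rewrite addrC subrK.
    have mv : b + r * p <= v by rewrite vE lerD2l ler_pM2l//; lra.
    have h : v - (b + r * p) = r * eta by rewrite vE; ring.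
    have hpi : v - (b + r * p) <= pi * r by rewrite h mulrC ler_pM2r//; lra.
    have := cos_time_le mv hpi; rewrite h mE vE2 great_circle_dot2//.
    have -> : r * eta / r = eta by field; rewrite gt_eqF.
    have -> : p - th = D - eta by rewrite DE; ring.
    rewrite cosB.
    have ce : 0 <= cos eta by rewrite cos_ge0_pihalf//; lra.
    have : (1 - cos D) * cos eta >= 0 by rewrite mulr_ge0// subr_ge0 cos_le1.
    have : sin D * sin eta <= D * eta.
      by apply: ler_pM; rewrite ?sin_le_id ?sin_ge0_pi ?(ltW h0)//=; clear -Tb e1 density D0 D2 h0 h1 ppi p0; lra.
    have : sin p * (sin p / 2) * (1 - dotv f g) <= sin p * sin th * (1 - dotv f g).
      by rewrite ler_wpM2r ?subr_ge0// ler_pM2l.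
    have -> : 2 / sin p ^+ 2 * (D * eta) = (D * eta) / (sin p ^+ 2 / 2).
      by field; rewrite gt_eqF.
    by rewrite ler_pdivlMr ?divr_gt0 ?exprn_gt0//; clear -Tb e1 density; lra.
  have sa : 0 <= sin a by rewrite sin_ge0_pi//; lra.
  have sb : 0 <= sin (a - D) by rewrite sin_ge0_pi//; lra.
  have : sin a * sin (a - D) * (1 - dotv f g) <= 1 - dotv f g.
    by rewrite ler_piMl ?subr_ge0// mulr_ile1// sin_le1.
  by have := cos_ge_quad D; rewrite !mulrDl mul1r; clear -Tb e1 density DD xx K2D; lra.
have := comparison_defect e r0 vpi T1 TL th0 thv hs sv.
rewrite aE -/a dD => hd.
have vs : (v - s) / r = p + eta - a by rewrite -vr /a; field; rewrite gt_eqF.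
have sv0 : 0 <= sin ((v - s) / r) by rewrite vs sin_ge0_pi//; clear -Tb e1 density aend a0 ppi; lra.
have sv1 : sin ((v - s) / r) <= eta.
  by apply: le_trans (sin_le_id _) _; rewrite vs; clear -Tb e1 density aend pa; lra.
have cx : cos (a - D) - dotv (T s) e <= D.
  have spi : s - b <= pi * r by lra.
  have := cos_time_le bs spi; rewrite Tb -/a dotvC.
  have := cos_lip (a - D) a; rewrite ler_norml => /andP[_].
  have -> : a - D - a = - D by ring.
  by rewrite normrN ger0_norm//; lra.
have le1 : 0 <= 1 - dotv (T s) (circle_part T r b v th e s).
  by rewrite subr_ge0 dotv_unit_le1//; exact: circle_part_unit.
have fin : sin ((v - s) / r) * (cos (a - D) - dotv (T s) e) <= D * eta.
  have : sin ((v - s) / r) * (cos (a - D) - dotv (T s) e) <= sin ((v - s) / r) * D.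
    by rewrite ler_wpM2l.
  have : sin ((v - s) / r) * D <= eta * D by rewrite ler_wpM2r.
  by clear -Tb e1 density; lra.
have : sin p / 2 * (1 - dotv (T s) (circle_part T r b v th e s)) <=
    sin th * (1 - dotv (T s) (circle_part T r b v th e s)) by rewrite ler_wpM2r.
move=> q1; have : 1 - dotv (T s) (circle_part T r b v th e s) <= 2 / sin p * (D * eta).
  have -> : 2 / sin p * (D * eta) = (D * eta) / (sin p / 2) by field; rewrite gt_eqF.
  by rewrite ler_pdivlMr ?divr_gt0//; clear -Tb e1 density q1 hd fin; lra.
by rewrite !mulrDl mul1r; clear -Tb e1 density De K1D; lra.
Qed.

(** The integral is [r (sin (p - D) - sin p + sin D)]. *)
Lemma cos_delay_gain D p : 0 <= D -> D <= p / 2 -> p <= pi ->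
  r * (D / 4 * (1 - cos (p / 2))) <=
  integ (fun s => cos ((s - b) / r - D) - cos ((s - b) / r)) (b + r * D) (b + r * p).
Proof.
move=> D0 Dp ppi; have rp := r0.
have lin (x k : R) : is_derive x 1 (fun s => (s - b) / r - k) r^-1.
  apply: (der_eq (derB (derM (derB (der_id x) (der_cst b x)) (der_cst r^-1 x)) (der_cst k x))).
  by ring.
have dsin (x k : R) : is_derive x 1 (fun s => r * sin ((s - b) / r - k)) (cos ((x - b) / r - k)).
  have ds := @is_derive_sin R ((x - b) / r - k).
  apply: (der_eq (derZ r (der_comp (g := fun s : R => (s - b) / r - k) ds (lin x k)))).
  by field; rewrite gt_eqF.
have ccos k : continuous (fun s : R => cos ((s - b) / r - k)).
  have := is_derive_continuous (fun x => der_comp (g := fun s : R => (s - b) / r - k)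
    (@is_derive_cos R ((x - b) / r - k)) (lin x k)).
  exact.
have E0 : (fun s : R => cos ((s - b) / r - D) - cos ((s - b) / r)) =
    (fun s : R => cos ((s - b) / r - D) - cos ((s - b) / r - 0)).
  by apply/funext => s; rewrite subr0.
rewrite E0 (@integE _ (fun s => r * sin ((s - b) / r - D) - r * sin ((s - b) / r - 0))).
- have -> : (b + r * p - b) / r - D = p - D by field; rewrite gt_eqF.
  have -> : (b + r * p - b) / r - 0 = p by field; rewrite gt_eqF.
  have -> : (b + r * D - b) / r - D = 0 by field; rewrite gt_eqF.
  have -> : (b + r * D - b) / r - 0 = D by field; rewrite gt_eqF.
  rewrite sin0 -!mulrBr ler_pM2l//.
  have Ep : sin p = sin (p - D) * cos D + cos (p - D) * sin D by rewrite -sinD subrK.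
  have s1 : 0 <= sin (p - D) * (1 - cos D).
    by rewrite mulr_ge0 ?subr_ge0 ?cos_le1// sin_ge0_pi//; lra.
  have s2 : D / 4 <= sin D by apply: sin_ge_quarter; lra.
  have s3 : cos (p - D) <= cos (p / 2) by apply: cos_le_mono; lra.
  have : D / 4 * (1 - cos (p / 2)) <= sin D * (1 - cos (p - D)).
    by apply: ler_pM => //; rewrite ?divr_ge0 ?subr_ge0 ?cos_le1//; lra.
  by lra.
- by rewrite lerD2l ler_pM2l//; lra.
- exact: contB.
Qed.

(** Prolonging a turn by a small angle [eta], the comparison arc loses at most
    [O(D eta)] in the first term of the density but gains a fixed multiple of its
    delay [D] in the second one. *)
Lemma turn_further f p : 0 < p -> p < pi -> turns f (b + r * p) -> exists2 eta0, 0 < eta0 &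
  forall eta, 0 < eta -> eta <= eta0 -> locally_shortest T r (b - z) (b + r * (p + eta)) ->
  turns f (b + r * (p + eta)).
Proof.
move=> p0 ppi tf; have [f1 ef Tf] := tf; have rp := r0.
have S0 : 0 < sin p by rewrite sin_gt0_pi// p0 ppi.
pose K := 1 + 2 / sin p ^+ 2 + 2 / sin p.
have K0 : 0 < K by rewrite !addr_gt0// divr_gt0// exprn_gt0.
have pi0 := pi_gt0 R.
pose m := 1 - cos (p / 2).
have m0 : 0 < m.
  have : cos (p / 2) < cos 0 by rewrite ltr_cos ?in_itv/=; first [lra|apply/andP; split; lra].
  by rewrite cos0 subr_gt0.
pose eta0 := Num.min (Num.min (p / 4) (sin p / 2)) (Num.min ((pi - p) / 2) (m / (24 * K * pi))).
have h24 : 0 < 24 * K * pi by rewrite !mulr_gt0.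
have pp : 0 < pi - p by rewrite subr_gt0.
exists eta0; first by rewrite !lt_min !divr_gt0.
move=> eta h0; rewrite !le_min => /andP[/andP[h1 h2] /andP[h3 h4]] hls.
have {}h4 : 24 * K * pi * eta <= m by rewrite mulrC -ler_pdivlMr.
have {}h3 : p + eta < pi by lra.
move: hls; have [v vE] : exists v, v = b + r * (p + eta) by exists (b + r * (p + eta)).
rewrite -vE => hls.
have [th th_def] : exists th, th = acos (dotv e (T v)) by exists (acos (dotv e (T v))).
have [D DE] : exists D, D = p + eta - th by exists (p + eta - th).
have /andP[D0 D2] : 0 <= D <= 2 * eta.
  by apply: (turn_delay p0 tf h0 h1 h3 vE); rewrite -th_def.
have close := comparison_close p0 tf h0 h1 h2 h3 vE th_def DE.
rewrite -/K in close.
have bv : b < v by rewrite vE ltrDl mulr_gt0//; lra.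
have vr : (v - b) / r = p + eta by rewrite vE; field; rewrite gt_eqF.
have vpi : v - b < pi * r by rewrite -ltr_pdivrMr// vr.
have [] := acos_time_le (ltW bv) (ltW vpi); rewrite -th_def => th0 thv thE.
have dD : delay r b v th = D by rewrite /delay vr DE.
have le1 s : 0 <= 1 - dotv (T s) (circle_part T r b v th e s).
  by rewrite subr_ge0 dotv_unit_le1//; exact: circle_part_unit.
have D00 : D = 0.
  apply/eqP; rewrite eq_le D0 andbT leNgt; apply/negP => Dp.
  pose B := 3 * (K * (D * eta)).
  have cd := continuous_density bv vpi th0 thv thE.
  have up s : b <= s <= v -> density v th s <= B -
      (dotv (circle_part T r b v th e s) e - dotv (T s) e).
    move=> hs; rewrite densityE// lerD2r.
    have x1 : 1 - 2 * dotv (T s) e <= 3 by have := dotv_unit_geN1 (T1 s) e1; lra.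
    have := close s hs; have := le1 s.
    move: (1 - dotv _ (circle_part _ _ _ _ _ _ _)) => c c0 cK.
    have : c * (1 - 2 * dotv (T s) e) <= c * 3 by rewrite ler_wpM2l.
    by rewrite /B; lra.
  have c1 : continuous (fun _ : R => B) by move=> x; exact: cst_continuous.
  have up' s : b <= s <= v -> density v th s <= B.
    move=> hs; apply: le_trans (up s hs) _.
    by rewrite gerBl subr_ge0; exact: comparison_le.
  pose b1 := b + r * D; pose b2 := b + r * p.
  have bb1 : b <= b1 by rewrite lerDl mulr_ge0// ltW.
  have b12 : b1 <= b2 by rewrite lerD2l ler_pM2l//; lra.
  have b2v : b2 <= v by rewrite vE lerD2l ler_pM2l//; lra.
  have I1 : integ (density v th) b b1 <= B * (b1 - b).
    rewrite -integ_cst; apply: (integ_le bb1 cd c1) => s /andP[h5 h6].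
    by apply: up'; clear -Tb e1 density b12 b2v h5 h6; apply/andP; split; lra.
  have I3 : integ (density v th) b2 v <= B * (v - b2).
    rewrite -integ_cst; apply: (integ_le b2v cd c1) => s /andP[h5 h6].
    by apply: up'; clear -Tb e1 density bb1 b12 h5 h6; apply/andP; split; lra.
  pose g s := cos ((s - b) / r - D) - cos ((s - b) / r).
  have cg : continuous g.
    have lip s t : `|g s - g t| <= (2 / r) * `|s - t|.
      have -> : g s - g t = (cos ((s - b) / r - D) - cos ((t - b) / r - D)) -
          (cos ((s - b) / r) - cos ((t - b) / r)) by rewrite /g; ring.
      apply: le_trans (ler_normB _ _) _.
      have := cos_lip ((s - b) / r - D) ((t - b) / r - D).
      have := cos_lip ((s - b) / r) ((t - b) / r).
      have -> : (s - b) / r - D - ((t - b) / r - D) = (s - t) / r by ring.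
      have -> : (s - b) / r - (t - b) / r = (s - t) / r by ring.
      by rewrite normrM (gtr0_norm (_ : 0 < r^-1)) ?invr_gt0//; lra.
    exact: lipschitz_continuous lip.
  have I2 : integ (density v th) b1 b2 <= B * (b2 - b1) - integ g b1 b2.
    rewrite -integ_cst -(integB b12 c1 cg).
    apply: (integ_le b12 cd (contB c1 cg)) => s /andP[s1 s2].
    have bs : b <= s by lra.
    have sv : s <= v by lra.
    apply: le_trans (up s _) _; first by rewrite bs.
    have hs : b + r * delay r b v th <= s by rewrite dD.
    have [aE _ _] := arc_angle_moving r0 hs sv.
    rewrite circle_part_dot// aE dD Tf ?bs// great_circle_dot0//.
  have gain := cos_delay_gain D0 (_ : D <= p / 2) (ltW ppi).
  have {}gain : r * (D / 4 * m) <= integ g b1 b2 by apply: gain; lra.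
  have := comparison_integ_ge0 bv vpi th0 thv thE hls.
  rewrite (integ_split _ _ b1) (integ_split _ b1 b2) => total.
  have : r * (D / 4 * m) <= B * (v - b) by clear -Tb e1 density I1 I2 I3 gain total; lra.
  have -> : v - b = r * (p + eta) by rewrite vE; ring.
  have -> : B * (r * (p + eta)) = r * (D * (3 * K * eta * (p + eta))) by rewrite /B; ring.
  rewrite ler_pM2l// -mulrA ler_pM2l// leNgt => /negP; apply.
  have : 3 * K * eta * (p + eta) <= 3 * K * eta * pi.
    by rewrite ler_pM2l ?ltW// !mulr_gt0.
  by clear -Tb e1 density h4 m0; lra.
have TE s : b <= s <= v -> T s = circle_part T r b v th e s.
  move=> hs; apply: dotv_unit_eq1 => //; first exact: circle_part_unit.
  by have := close s hs; rewrite D00 mul0r mulr0 subr_le0.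
have tv : turns (arc_normal T v th e) v.
  apply: turns_comparison => //; first by rewrite vr; lra.
  by move=> s /andP[bs sv]; rewrite TE// !ltW.
move: tv; move: (arc_normal T v th e) => g tv.
have [g1 eg Tg] := tv; suff -> : f = g by [].
have mb : b <= b + r * p by rewrite lerDl mulr_ge0// ltW.
have mv : b + r * p <= v by rewrite vE lerD2l ler_pM2l//; lra.
have := Tf (b + r * p); rewrite mb lexx => /(_ isT).
have := Tg (b + r * p); rewrite mb mv => /(_ isT) ->.
have -> : (b + r * p - b) / r = p by field; rewrite gt_eqF.
rewrite /great_circle => /addrI /(congr1 (fun w => (sin p)^-1 *: w)).
by rewrite !scalerA mulVf ?gt_eqF// !scale1r => ->.
Qed.

End Continuation.

(** * Segment and arc to the right of a straight point *)

Lemma sup_point {R : realType} (P : R -> Prop) a M : P a -> (forall t, P t -> t <= M) ->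
  exists2 p, a <= p <= M & (forall t, t < p -> exists2 t', t < t' & P t') /\
    forall t, P t -> t <= p.
Proof.
move=> Pa PM; have hs : has_sup [set t | P t] by split; [exists a|exists M].
exists (sup [set t | P t]).
  apply/andP; split; first exact: (sup_upper_bound hs).
  by apply: ge_sup => //; exists a.
split=> [t tp|t Pt]; last exact: (sup_upper_bound hs).
have tp' : 0 < sup [set t | P t] - t by rewrite subr_gt0.
have [t' Pt'] := sup_adherent tp' hs; rewrite opprB addrC subrK => tt'.
by exists t'.
Qed.

Section SegmentThenTurn.
Context {R : realType} {n : nat}.
Variables (T : R -> 'rV[R]_n) (C : R -> Prop) (r L : R).
Hypotheses (r0 : 0 < r) (L0 : 2 * (pi * r) <= L).
Hypotheses (T1 : forall s, dotv (T s) (T s) = 1).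
Hypotheses (TL : forall s t, normv (T s - T t) <= r^-1 * `|s - t|).
Hypotheses (pT : forall s, T (s + L) = T s) (nT : forall e, exists s, T s != e).
Hypothesis C_closed : forall s, ~ C s -> exists2 e, 0 < e & forall t, `|t - s| <= e -> ~ C t.
Hypothesis hls : forall u v, u < v -> v - u < L -> (forall s, u <= s <= v -> ~ C s) ->
  locally_shortest T r u v.

Lemma lip_eq_closed (g : R -> 'rV[R]_n) k a p : a < p ->
  (forall s t, normv (g s - g t) <= k * `|s - t|) ->
  (forall s, a <= s < p -> T s = g s) -> T p = g p.
Proof.
move=> ap gL Tg; apply/eqP; rewrite -subr_eq0; apply/eqP/normv_eq0/eqP.
rewrite eq_le normv_ge0 andbT leNgt; apply/negP => N0; have rp := r0.
have k0 : 0 <= k.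
  by have := le_trans (normv_ge0 _) (gL (a + 1) a); rewrite addrAC subrr add0r normr1 mulr1.
have K0 : 0 < r^-1 + k + 1 by have : 0 < r^-1 by [rewrite invr_gt0]; lra.
pose N := normv (T p - g p).
pose t := Num.max a (p - N / (r^-1 + k + 1)).
have tp : t < p by rewrite gt_max ap gtrBl divr_gt0.
have at_ : a <= t by rewrite le_max lexx.
have tN : (r^-1 + k + 1) * (p - t) <= N.
  rewrite mulrC -ler_pdivlMr//.
  have : p - N / (r^-1 + k + 1) <= t by rewrite le_max lexx orbT.
  by lra.
have : N <= (r^-1 + k) * (p - t).
  have -> : N = normv ((T p - T t) - (g p - g t)).
    by rewrite /N (Tg t) ?at_//; congr normv; apply/rowP => i; rewrite !mxE; ring.
  apply: le_trans (normv_triangleB _ _) _; rewrite mulrDl.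
  have pt : `|p - t| = p - t by rewrite gtr0_norm// subr_gt0.
  by have := TL p t; have := gL p t; rewrite pt; lra.
by lra.
Qed.

Lemma last_straight s0 e delta : 0 < delta ->
  (forall s, s0 <= s <= s0 + delta -> T s = e) ->
  exists2 b, s0 < b & (forall s, s0 <= s <= b -> T s = e) /\
    forall t, b < t -> exists2 s, b < s <= t & T s != e.
Proof.
move=> d0 Te; have [x xe] := nT e; have rp := r0.
have Lp : 0 < L by apply: lt_le_trans L0; rewrite !mulr_gt0 ?pi_gt0.
have [k /andP[k0 k1]] := periodic_window s0 x Lp.
have kT : T (x + L *~ k) = T x by exact: periodicz.
have P0 : forall s, s0 <= s <= s0 + delta -> T s = e by [].
pose P t := s0 <= t /\ forall s, s0 <= s <= t -> T s = e.
have PM t : P t -> t <= x + L *~ k.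
  move=> [_ Pt]; rewrite leNgt; apply/negP => c; move/eqP: xe; apply.
  by rewrite -kT; apply: Pt; rewrite k0 ltW.
have Pa : P (s0 + delta) by split=> //; rewrite lerDl ltW.
have [b /andP[b0 _] [b1 b2]] := sup_point Pa PM.
have sb : s0 < b by apply: lt_le_trans b0; rewrite ltrDl.
exists b => //.
have Tb s : s0 <= s < b -> T s = e.
  by move=> /andP[s1 s2]; have [t st [_ Pt]] := b1 s s2; apply: Pt; rewrite s1 ltW.
have Tb' s : s0 <= s <= b -> T s = e.
  move=> /andP[s1]; rewrite le_eqVlt => /orP[/eqP->|s2]; last by apply: Tb; rewrite s1.
  apply: (@lip_eq_closed (fun=> e) 0 s0) => // s' t; first by rewrite subrr normv0 mul0r.
split=> // t bt; apply: contrapT => h.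
have : P t.
  split; first by apply: ltW; exact: lt_trans bt.
  move=> s /andP[s1 s2]; have [sb'|bs] := leP s b; first by apply: Tb'; rewrite s1.
  by apply/eqP; apply: contrapT => /negP se; apply: h; exists s => //; rewrite bs.
by move/b2; rewrite leNgt bt.
Qed.

(** The turn following the segment can be prolonged until it is a half circle or
    meets a contact. *)
Lemma segment_then_turn s0 e delta : 0 < delta ->
  (forall s, s0 <= s <= s0 + delta -> T s = e) ->
  exists b d, [/\ s0 < b, b <= d, d - b <= pi * r, forall s, s0 <= s <= b -> T s = e &
    (d = b \/ exists f, turns T r b e f d) /\ (d - b = pi * r \/ C d)].
Proof.
move=> d0 Te; have [b sb [Tb moves]] := last_straight d0 Te; have rp := r0.
exists b; have [Cb|nCb] := pselect (C b).
  by exists b; rewrite subrr; split=> //; [rewrite mulr_ge0 ?pi_ge0 ?ltW|split; [left|right]].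
have [c c0 Cc] := C_closed nCb; have pi0 := pi_gt0 R; have pir : 0 < pi * r by rewrite mulr_gt0.
have LL := L0.
pose z := Num.min (Num.min c (b - s0)) (pi * r / 2).
have z0 : 0 < z by rewrite !lt_min c0 subr_gt0 sb divr_gt0.
have [zc zb zr] : [/\ z <= c, z <= b - s0 & z <= pi * r / 2] by rewrite !ge_min !lexx !orbT.
clearbody z; have Tz s : b - z <= s <= b -> T s = e.
  by move=> /andP[s1 s2]; apply: Tb; rewrite s2 andbT; lra.
have zC s : b - z <= s <= b + z -> ~ C s.
  by move=> /andP[s1 s2]; apply: Cc; rewrite ler_norml; apply/andP; split; lra.
pose p1 := Num.min 1 (z / r).
have p10 : 0 < p1 by rewrite lt_min ltr01 divr_gt0.
have p1z : r * p1 <= z by rewrite mulrC -ler_pdivlMr// ge_min lexx orbT.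
have p1r : r * p1 <= r by rewrite ger_pMr// ge_min lexx.
have ls v : b < v -> v - b <= pi * r -> (forall s, b <= s <= v -> ~ C s) ->
    locally_shortest T r (b - z) v.
  move=> bv vr vC; apply: hls; [lra|lra|move=> s /andP[s1 s2]].
  have [sb'|bs] := leP s b; last by apply: vC; rewrite s2 ltW.
  by apply: zC; rewrite s1/=; lra.
have pi2 := pi_ge2 R.
have bv1 : b < b + r * p1 by rewrite ltrDl mulr_gt0.
have p1pi : p1 <= pi by apply: le_trans (_ : 1 <= _); [rewrite ge_min lexx|lra].
have vb1 : b + r * p1 - b <= r by lra.
have C1 s : b <= s <= b + r * p1 -> ~ C s.
  by move=> /andP[s1 s2]; apply: zC; apply/andP; split; lra.
have ls1 : locally_shortest T r (b - z) (b + r * p1).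
  by apply: ls => //; rewrite addrAC subrr add0r mulrC ler_pM2r.
have [f tf] := first_turn r0 z0 T1 TL Tz bv1 vb1 ls1 moves.
pose P p := [/\ p <= pi, turns T r b e f (b + r * p) &
  forall s, b <= s <= b + r * p -> ~ C s].
have P1 : P p1 by [].
have Ppi t : P t -> t <= pi by case.
have [p /andP[p1p ppi] [pa pb]] := sup_point P1 Ppi.
have p0 : 0 < p by lra.
have [f1 ef _] := tf.
have bd : b < b + r * p by rewrite ltrDl mulr_gt0.
have below s : b <= s < b + r * p -> T s = great_circle e f ((s - b) / r) /\ ~ C s.
  move=> /andP[s1 s2]; have sp : (s - b) / r < p by rewrite ltr_pdivrMr// mulrC; lra.
  have [t st [_ [_ _ tT] tC]] := pa _ sp.
  have sr : b <= s <= b + r * t.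
    rewrite s1/=; have : s - b < t * r by rewrite -ltr_pdivrMr.
    by lra.
  by split; [exact: tT|exact: tC].
have tp : turns T r b e f (b + r * p).
  split=> // s /andP[s1]; rewrite le_eqVlt => /orP[/eqP sE|s2]; last first.
    by have [] := below s; rewrite ?s1.
  apply: (@lip_eq_closed (fun s => great_circle e f ((s - b) / r)) r^-1 b).
  - by rewrite sE.
  - move=> s' t; have e1 : dotv e e = 1 by rewrite -(Tb b) ?T1// lexx ltW.
    apply: le_trans (great_circle_lip _ _ e1 f1 ef) _.
    have -> : (s' - b) / r - (t - b) / r = r^-1 * (s' - t) by ring.
    by rewrite normrM gtr0_norm ?invr_gt0.
  - by move=> t ht; have [] := below t; rewrite -?sE.
exists (b + r * p); split=> //.
- exact: ltW.
- by rewrite addrAC subrr add0r mulrC ler_pM2r.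
split; first by right; exists f.
have [->|npi] := eqVneq p pi; first by left; ring.
have {npi}ppi' : p < pi by rewrite lt_neqAle npi.
right; apply: contrapT => nC.
have [c2 c20 Cc2] := C_closed nC.
have [eta0 eta00 further] := turn_further r0 z0 T1 TL Tz p0 ppi' tp.
pose eta := Num.min (Num.min eta0 (c2 / r)) (pi - p).
have eta_gt0 : 0 < eta by rewrite !lt_min eta00 divr_gt0// subr_gt0.
have [h1 h2 h3] : [/\ eta <= eta0, eta <= c2 / r & eta <= pi - p].
  by rewrite !ge_min !lexx !orbT.
clearbody eta; have {}h2 : r * eta <= c2 by rewrite mulrC -ler_pdivlMr.
have reta : 0 < r * eta by rewrite mulr_gt0.
have noC s : b <= s <= b + r * (p + eta) -> ~ C s.
  move=> /andP[s1 s2]; have [sp|ps] := ltP s (b + r * p).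
    by have [] := below s; rewrite ?s1.
  by apply: Cc2; rewrite ger0_norm ?subr_ge0//; lra.
have : P (p + eta).
  split=> //; first by lra.
  apply: further => //; apply: ls => //; first by rewrite mulrDr; lra.
  have -> : b + r * (p + eta) - b = (p + eta) * r by ring.
  by rewrite ler_pM2r//; lra.
by move/pb; lra.
Qed.

End SegmentThenTurn.

(** * The minimal double critical points are the contacts *)

Section Contacts.
Context {R : realType} {n : nat}.
Variables (gamma : R -> 'rV[R]_n) (r : R).
Local Notation T := (derive1 gamma).
Hypotheses (r0 : 0 < r) (otb : outside_tangent_balls gamma T r).

Lemma normal_chord_le s t w : dotv w (T s) = 0 ->
  2 * r * dotv (gamma t - gamma s) w <= normv w * normv (gamma t - gamma s) ^+ 2.
Proof.
move=> ws; rewrite sqr_normv; have [->|w0] := eqVneq w 0.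
  by rewrite dotv0 mulr0 normv0 mul0r.
have hz : dotv (dirv w) (T s) = 0 by rewrite dirvE dotvZl ws mulr0.
have := otb t (dirv_unit w0) hz; rewrite -(ler_pM2l (normv_gt0 w0)); apply: le_trans.
by rewrite -{1}(normv_dirv w) dotvZr le_eqVlt; apply/orP; left; apply/eqP; ring.
Qed.

Lemma double_critical_ge x y : double_critical gamma x y -> 2 * r <= normv (x - y).
Proof.
move=> [xy [s /= [xE h]] [t /= [yE _]]]; rewrite xE yE in h xy *.
have := normal_chord_le t h; rewrite -sqr_normv (normvC (gamma t)).
have N0 : 0 < normv (gamma s - gamma t) by rewrite normv_gt0// subr_eq0.
by rewrite ler_pM2r// exprn_gt0.
Qed.

Lemma contact_double_critical s : contact gamma T r s ->
  exists2 t, normv (gamma s - gamma t) = 2 * r & double_critical gamma (gamma s) (gamma t).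
Proof.
move=> [t [st hs ht]]; exists t => //; split.
- apply/eqP => E; move: st; rewrite E subrr normv0 => /eqP.
  by rewrite eq_sym mulf_eq0 (gt_eqF r0) pnatr_eq0.
- by exists s; split; [|rewrite /= -opprB dotvNl hs oppr0].
- by exists t; split.
Qed.

Lemma MDC_contact s : contact gamma T r s -> MDC gamma = (2 * r)%:E.
Proof.
move=> /contact_double_critical[t st dc]; apply/eqP; rewrite eq_le; apply/andP; split.
  by apply: ereal_inf_lbound; exists (gamma s, gamma t) => //=; rewrite st.
by apply: le_ereal_inf_tmp => _ [[x y] /= xy <-]; rewrite lee_fin double_critical_ge.
Qed.

Lemma min_critical_contact : (exists s, contact gamma T r s) ->
  min_critical gamma = [set s | contact gamma T r s].
Proof.
move=> [s0 /MDC_contact h]; apply/seteqP; split=> s [t []].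
  by rewrite h => -[st] ? ?; exists t.
by move=> st ? ?; exists t; split=> //; rewrite st h.
Qed.

(** Two normal discs of radius less than [r] with a common point [p] are based at the
    same point, as each base point is the only one nearest to [p]. *)
Lemma normal_exp_inj :
  set_inj (normal_bundle gamma `&` [set xz | normv xz.2 < r]) normal_exp.
Proof.
move=> [x1 z1] [x2 z2]; rewrite !inE => -[[s /= [-> h1]] l1] [[t /= [-> h2]] l2].
rewrite /normal_exp/= in l1 l2 * => E.
have D : gamma t - gamma s = z1 - z2.
  by apply/eqP; rewrite subr_eq addrAC eq_sym subr_eq -E addrC.
have k1 := normal_chord_le t h1; have k2 := normal_chord_le s h2.
have D' : gamma s - gamma t = z2 - z1 by rewrite -opprB D opprB.
rewrite D in k1; rewrite D' in k2.
have N : normv (z2 - z1) ^+ 2 = normv (z1 - z2) ^+ 2 by rewrite normvC.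
rewrite N in k2; move: k1 k2.
have : dotv (z1 - z2) z1 + dotv (z2 - z1) z2 = normv (z1 - z2) ^+ 2.
  by rewrite sqr_normv !dotvE (dotvC z2 z1); ring.
move=> /(congr1 (fun x => 2 * r * x)); rewrite mulrDr => dE k1 k2.
have p : 0 < 2 * r - normv z1 - normv z2.
  by move: l1 l2; move: (normv z1) (normv z2) => x y; lra.
have : (2 * r - normv z1 - normv z2) * normv (z1 - z2) ^+ 2 <= 0.
  move: dE k1 k2; clear; move: (normv z1) (normv z2) (normv (z1 - z2)) => x y w.
  by move: (dotv (z1 - z2) z1) (dotv (z2 - z1) z2) => c d; lra.
rewrite pmulr_rle0// sqr_normv => w2.
have /eqP : z1 - z2 = 0 by apply: dotv_eq0; apply/eqP; rewrite eq_le w2 dotv_ge0.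
rewrite subr_eq0 => /eqP zE; congr pair => //.
by apply/eqP; rewrite eq_sym -subr_eq0 D zE subrr.
Qed.

(** The midpoint of a contact pair is the end of two normal vectors of length [r]. *)
Lemma injectivity_radius_contact s : contact gamma T r s -> injectivity_radius gamma = r%:E.
Proof.
move=> /contact_double_critical[t st [xy nx ny]]; apply/eqP; rewrite eq_le; apply/andP; split.
  apply: ge_ereal_sup => _ [->|[r' [r'0 inj] <-]]; first by rewrite lee_fin ltW.
  rewrite lee_fin leNgt; apply/negP => rr'; move/eqP: xy; apply.
  pose m x y : 'rV[R]_n * 'rV[R]_n := (x, 2^-1 *: (y - x)).
  have half (x y : 'rV[R]_n) : normv (x - y) = 2 * r -> normv (m x y).2 < r'.
    by rewrite /m/= normvZ ger0_norm ?invr_ge0// normvC => ->; lra.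
  have hm (x y : 'rV[R]_n) : normal_bundle gamma (x, y - x) -> normal_bundle gamma (m x y).
    by move=> [s' [/= -> h]]; exists s'; split=> //=; rewrite dotvZl h mulr0.
  suff /(congr1 fst) : m (gamma s) (gamma t) = m (gamma t) (gamma s) by [].
  apply: inj; rewrite ?inE.
  - by split; [exact: hm|exact: half].
  - by split; [exact: hm|rewrite /=; apply: half; rewrite normvC].
  - by rewrite /normal_exp/=; apply/rowP => i; rewrite !mxE; field.
apply: ereal_sup_ubound; right; exists r => //; split=> //; exact: normal_exp_inj.
Qed.

End Contacts.

(** * Curvature of the extremal curve *)

Section Curvature.
Context {R : realType} {n : nat}.
Variables (gamma : R -> 'rV[R]_n) (r : R).
Local Notation T := (derive1 gamma).
Hypotheses (r0 : 0 < r) (T1 : forall s, dotv (T s) (T s) = 1).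
Hypotheses (TL : forall s t, normv (T s - T t) <= r^-1 * `|s - t|).

Definition curvature_ratio (p : R * R) : R := acos (dotv (T p.1) (T p.2)) / `|p.1 - p.2|.

Lemma curvature_ratioE p :
  anglev (T p.1) (T p.2) / arclength gamma (Num.min p.1 p.2) (Num.max p.1 p.2) =
  curvature_ratio p.
Proof.
have cT : coord_continuous_fun T := lipschitz_coord_continuous TL.
have mm : Num.min p.1 p.2 <= Num.max p.1 p.2 by rewrite ge_min !le_max lexx.
rewrite /anglev !(unit_normv T1) mulr1 divr1 (arclengthE mm cT).
rewrite (_ : (fun s => normv (T s)) = fun=> 1); last by apply/funext => s; rewrite unit_normv.
rewrite integ_cst mul1r /curvature_ratio; congr (_ / _).
have [h|h] := leP p.1 p.2; last by rewrite gtr0_norm// subr_gt0.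
by rewrite ler0_norm ?subr_le0// opprB.
Qed.

Lemma curvatureE s : curvature gamma s = limf_esup (EFin \o curvature_ratio)
  (within [set p : R * R | p.1 != p.2] (nbhs (s, s))).
Proof.
rewrite /curvature; congr limf_esup; apply/funext => p /=.
by rewrite curvature_ratioE.
Qed.

Lemma curvature_ratio_ge0 p : 0 <= curvature_ratio p.
Proof. by rewrite divr_ge0// acos_ge0// dotv_unit_geN1 ?dotv_unit_le1. Qed.

Lemma curvature_ratio_le p : p.1 != p.2 -> `|p.1 - p.2| <= pi * r -> curvature_ratio p <= r^-1.
Proof.
move=> p12 pr; have p0 : 0 < `|p.1 - p.2| by rewrite normr_gt0 subr_eq0.
rewrite /curvature_ratio ler_pdivrMr// mulrC.
have [h|/ltW h] := leP p.1 p.2.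
  have E : `|p.1 - p.2| = p.2 - p.1 by rewrite ler0_norm ?subr_le0// opprB.
  by rewrite E in pr *; exact: acos_dot_le.
have E : `|p.1 - p.2| = p.1 - p.2 by rewrite ger0_norm ?subr_ge0.
by rewrite E dotvC in pr *; exact: acos_dot_le.
Qed.

Lemma near_diagonal (s d : R) : 0 < d ->
  nbhs (s, s) [set p : R * R | `|p.1 - s| < d /\ `|p.2 - s| < d].
Proof.
move=> d0; exists ([set x | `|x - s| < d], [set x | `|x - s| < d]); last by move=> [x y] /= [].
by split; apply/nbhs_ballP; exists d => // x /=; rewrite distrC.
Qed.

Lemma curvature_le_inv s : (curvature gamma s <= (r^-1)%:E)%E.
Proof.
rewrite curvatureE; have rp := r0; have pi0 := pi_gt0 R.
have d0 : 0 < pi * r / 2 by rewrite divr_gt0// mulr_gt0.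
pose A := [set p : R * R | p.1 != p.2 /\ `|p.1 - p.2| <= pi * r].
apply: (@le_trans _ _ (ereal_sup ((EFin \o curvature_ratio) @` A))).
  apply: ereal_inf_lbound; exists A => //.
  apply: filterS (near_diagonal s d0) => -[x y] /= [h1 h2] xy; split=> //=.
  have -> : x - y = (x - s) - (y - s) by ring.
  by apply: le_trans (ler_normB _ _) _; lra.
apply: ge_ereal_sup => _ [p [p12 pr] <-]; rewrite lee_fin; exact: curvature_ratio_le.
Qed.

Lemma sup_curvature_le : (sup_curvature gamma <= (r^-1)%:E)%E.
Proof. by apply: ge_ereal_sup => _ [s _ <-]; exact: curvature_le_inv. Qed.

Lemma near_diagonal_exists (s : R) (A : set (R * R)) :
  within [set p : R * R | p.1 != p.2] (nbhs (s, s)) A ->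
  forall d, 0 < d -> exists p, [/\ A p, p.1 != p.2, `|p.1 - s| < d & `|p.2 - s| < d].
Proof.
move=> [[B1 B2] /= [/nbhs_ballP[e1 /= e10 b1] /nbhs_ballP[e2 /= e20 b2]] B12] d d0.
pose m := Num.min e2 d / 2.
have m0 : 0 < m by rewrite divr_gt0// lt_min e20.
have m2 : m < Num.min e2 d by rewrite ltr_pdivrMr// ltr_pMr ?lt_min ?e20// ltr1n.
have [me md] : m < e2 /\ m < d by move: m2; rewrite lt_min => /andP[].
have ms : s != s + m by rewrite -subr_eq0 opprD addrA subrr add0r oppr_eq0 gt_eqF.
have mm : `|s + m - s| = m by rewrite addrAC subrr add0r gtr0_norm.
exists (s, s + m); split=> //=; last 2 first.
- by rewrite subrr normr0.
- by rewrite mm.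
apply: (B12 (s, s + m)) => //; split=> /=.
  by apply: b1; rewrite /ball/= subrr normr0.
by apply: b2; rewrite /ball/= distrC mm.
Qed.

Lemma curvature_ge0 s : (0 <= curvature gamma s)%E.
Proof.
rewrite curvatureE; apply: le_ereal_inf_tmp => _ [A /near_diagonal_exists hA <-].
have [p [Ap _ _ _]] := hA 1 ltr01.
by apply: le_ereal_sup_tmp; exists (curvature_ratio p)%:E; rewrite ?lee_fin ?curvature_ratio_ge0//; exists p.
Qed.

(** A curvature below [1 / r] at one point means a Lipschitz constant of the tangent
    below [1 / r] in a neighbourhood, since a chord of the sphere is shorter than its arc. *)
Lemma slack_near s : (curvature gamma s < (r^-1)%:E)%E -> exists k d,
  [/\ 0 <= k, k < r^-1, 0 < d & forall t u, `|t - s| < d -> `|u - s| < d ->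
    normv (T t - T u) <= k * `|t - u|].
Proof.
rewrite curvatureE => /ereal_inf_lt[_ [A nA <-] hA].
have bnd p : A p -> ((curvature_ratio p)%:E <= ereal_sup ((EFin \o curvature_ratio) @` A))%E.
  by move=> Ap; apply: ereal_sup_ubound; exists p.
have [p0 [Ap0 _ _ _]] := near_diagonal_exists nA ltr01.
have := bnd p0 Ap0; move: hA bnd; case: (ereal_sup _) => [k|//|] hk bnd; last first.
  by rewrite leeNy_eq.
rewrite lee_fin => k0; rewrite lte_fin in hk.
have {}k0 : 0 <= k by apply: le_trans k0; exact: curvature_ratio_ge0.
move: nA => [[B1 B2] /= [/nbhs_ballP[e1 /= e10 b1] /nbhs_ballP[e2 /= e20 b2]] B12].
exists k, (Num.min e1 e2); split=> //; first by rewrite lt_min e10.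
move=> t u; rewrite !lt_min => /andP[t1 t2] /andP[u1 u2].
have [->|tu] := eqVneq t u; first by rewrite !subrr normv0 normr0 mulr0.
have tu0 : 0 < `|t - u| by rewrite normr_gt0 subr_eq0.
have : curvature_ratio (t, u) <= k.
  rewrite -lee_fin; apply: bnd; apply: (B12 (t, u)) => //; split=> /=.
    by apply: b1; rewrite /ball/= distrC.
  by apply: b2; rewrite /ball/= distrC.
rewrite /curvature_ratio/= ler_pdivrMr//; apply: le_trans.
have h : -1 <= dotv (T t) (T u) <= 1 by rewrite dotv_unit_geN1 ?dotv_unit_le1.
apply: normv_le; first exact: acos_ge0.
rewrite dotvB_unit//; have := cos_ge_quad (acos (dotv (T t) (T u))).
by rewrite acosK ?in_itv//; lra.
Qed.

Lemma curvature_turn b d s : b < s -> s < d -> d - b <= pi * r ->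
  (forall x y, b <= x <= d -> b <= y <= d -> dotv (T x) (T y) = cos ((x - y) / r)) ->
  ((r^-1)%:E <= curvature gamma s)%E.
Proof.
move=> bs sd dpi Tc; have rp := r0; have ri : 0 < r^-1 by rewrite invr_gt0.
rewrite curvatureE; apply: le_ereal_inf_tmp => _ [A /near_diagonal_exists hA <-].
have m0 : 0 < Num.min (s - b) (d - s) by rewrite lt_min !subr_gt0 bs.
have [[x y] [/= Ap xy]] := hA _ m0; rewrite !lt_min !ltr_norml => /andP[/andP[x1 _] /andP[_ x2]].
move=> /andP[/andP[y1 _] /andP[_ y2]].
apply: le_ereal_sup_tmp; exists (curvature_ratio (x, y))%:E; first by exists (x, y).
have xy0 : 0 < `|x - y| by rewrite normr_gt0 subr_eq0.
rewrite lee_fin /curvature_ratio/= Tc; [|lra|lra].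
have -> : cos ((x - y) / r) = cos (`|x - y| / r).
  by have [h|h] := leP 0 (x - y); rewrite ?(ger0_norm h)// (ltr0_norm h) mulNr cosN.
rewrite cosK.
  by rewrite mulrAC divff ?mul1r// gt_eqF.
rewrite in_itv/= mulr_ge0//= ?(ltW ri)// ler_pdivrMr// ler_norml; apply/andP; split; lra.
Qed.

End Curvature.

(** * Shapes of the pieces *)

Section Shapes.
Context {R : realType} {n : nat}.
Implicit Types (gamma T : R -> 'rV[R]_n).

Lemma same_velocity_position gamma T eta q b d : has_velocity gamma T -> has_velocity eta q ->
  b <= d -> (forall s, b <= s <= d -> T s = q s) -> gamma d - gamma b = eta d - eta b.
Proof.
move=> gT etaq bd Tq.
have vel : has_velocity (fun s => gamma s - eta s) (fun s => T s - q s).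
  move=> u s; have -> : (fun x => dotv (gamma x - eta x) u) =
      (fun x => dotv (gamma x) u - dotv (eta x) u).
    by apply/funext => x; rewrite dotvDl dotvNl.
  by rewrite dotvDl dotvNl; exact: derB.
have := has_velocity_lip vel bd (lexx 0) => h.
have {}h : normv (gamma d - eta d - (gamma b - eta b)) <= 0.
  by rewrite -[leRHS](mul0r (d - b)); apply: h => s hs; rewrite Tq// subrr normv0.
have /eqP : gamma d - eta d - (gamma b - eta b) = 0.
  by apply: normv_eq0; apply/eqP; rewrite eq_le h normv_ge0.
rewrite subr_eq0 => /eqP E; have -> : gamma d = (gamma b - eta b) + eta d by rewrite -E subrK.
by apply/rowP => i; rewrite !mxE; ring.
Qed.

Lemma straight_position gamma T e b d : has_velocity gamma T -> b <= d ->
  (forall s, b <= s <= d -> T s = e) -> gamma d = gamma b + (d - b) *: e.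
Proof.
move=> gT bd Te; have vel : has_velocity (fun s => s *: e) (fun=> e).
  move=> u s; have -> : (fun x => dotv (x *: e) u) = (fun x => x * dotv e u).
    by apply/funext => x; rewrite dotvZl.
  by apply: (der_eq (derM (der_id s) (der_cst _ s))); ring.
have := same_velocity_position gT vel bd Te.
by rewrite scalerBl => <-; rewrite addrC subrK.
Qed.

Lemma turn_position gamma T r b e f d s : 0 < r -> has_velocity gamma T ->
  turns T r b e f d -> b <= s <= d ->
  gamma s = gamma b + r *: f + (r * cos ((s - b) / r)) *: (- f) + (r * sin ((s - b) / r)) *: e.
Proof.
move=> r0 gT [_ _ Tf] /andP[bs sd].
pose a (x : R) := (x - b) / r.
have da (x : R) : is_derive x 1 a r^-1.
  apply: (der_eq (derM (derB (der_id x) (der_cst b x)) (der_cst r^-1 x))); by ring.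
have vel : has_velocity (fun x => (r * sin (a x)) *: e - (r * cos (a x)) *: f)
    (fun x => great_circle e f (a x)).
  move=> u x; have -> : (fun x => dotv ((r * sin (a x)) *: e - (r * cos (a x)) *: f) u) =
      (fun x => dotv e u * (r * sin (a x)) - dotv f u * (r * cos (a x))).
    by apply/funext => y; rewrite dotvDl dotvNl !dotvZl; ring.
  have d1 := derZ (dotv e u) (derZ r (der_comp (g := a) (@is_derive_sin R (a x)) (da x))).
  have d2 := derZ (dotv f u) (derZ r (der_comp (g := a) (@is_derive_cos R (a x)) (da x))).
  apply: (der_eq (derB d1 d2)).
  by rewrite /great_circle dotvDl !dotvZl; field; rewrite gt_eqF.
have Ts x : b <= x <= s -> T x = great_circle e f (a x).
  by move=> /andP[h1 h2]; apply: Tf; rewrite h1 (le_trans h2).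
have := same_velocity_position gT vel bs Ts.
rewrite {3 4}/a subrr mul0r sin0 cos0 => /eqP; rewrite subr_eq => /eqP ->.
by rewrite /a; apply/rowP => i; rewrite !mxE; ring.
Qed.

Lemma straight_segment gamma T e a b : has_velocity gamma T -> a < b ->
  (forall s, a <= s <= b -> T s = e) -> gamma @` `[a, b] = segment (gamma a) (gamma b).
Proof.
move=> gT ab Te; have ba0 : 0 < b - a by rewrite subr_gt0.
have pos s : a <= s <= b -> gamma s = gamma a + (s - a) *: e.
  move=> /andP[h1 h2]; apply: straight_position gT h1 _ => x /andP[x1 x2].
  by apply: Te; rewrite x1 (le_trans x2).
have comb t : (1 - t) *: gamma a + t *: gamma b = gamma a + (t * (b - a)) *: e.
  rewrite (pos b) ?lexx ?ltW//; apply/rowP => i; rewrite !mxE; ring.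
apply/seteqP; split=> _ [s /= hs <-].
  rewrite in_itv/= in hs; exists ((s - a) / (b - a)).
    move: hs => /andP[h1 h2]; rewrite /= in_itv/= divr_ge0 ?subr_ge0 ?(ltW ab)//=.
    by rewrite ler_pdivrMr// mul1r lerD2r.
  by rewrite comb (pos s hs) divfK// gt_eqF.
rewrite in_itv/= in hs; move: hs => /andP[h1 h2].
have p1 : 0 <= s * (b - a) by rewrite mulr_ge0// ltW.
have p2 : s * (b - a) <= b - a by rewrite ger_pMl.
exists (a + s * (b - a)); first by rewrite /= in_itv/=; apply/andP; split; lra.
rewrite comb pos; last by apply/andP; split; lra.
by congr (_ + _ *: _); ring.
Qed.

Lemma turn_arc gamma T r b e f d : 0 < r -> has_velocity gamma T -> dotv e e = 1 -> b <= d ->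
  d - b <= pi * r -> turns T r b e f d -> is_circular_arc (gamma @` `[b, d]) r.
Proof.
move=> r0 gT e1 bd dpi tf; have [f1 ef _] := tf.
exists (gamma b + r *: f), (- f), e, ((d - b) / r); split=> //.
- by rewrite dotvNl dotvNr opprK.
- by rewrite dotvNl dotvC ef oppr0.
- rewrite divr_ge0 ?subr_ge0 ?(ltW r0)//= ler_pdivrMr//.
  have : 0 < pi * r by rewrite mulr_gt0 ?pi_gt0.
  by lra.
apply/seteqP; split=> _ [s /= hs <-]; rewrite in_itv/= in hs.
  exists ((s - b) / r); last by rewrite -(turn_position r0 gT tf hs).
  move: hs => /andP[h1 h2]; rewrite /= in_itv/= divr_ge0 ?subr_ge0 ?(ltW r0)//=.
  by rewrite ler_pM2r ?invr_gt0// lerD2r.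
move: hs => /andP[h1 h2]; rewrite ler_pdivlMr// in h2.
have p1 : 0 <= r * s by rewrite mulr_ge0// ltW.
have hs : b <= b + r * s <= d by apply/andP; split; lra.
exists (b + r * s); first by rewrite /= in_itv.
rewrite (turn_position r0 gT tf hs).
by have -> : (b + r * s - b) / r = s by field; rewrite gt_eqF.
Qed.

(** A point is a degenerate arc of any radius; the plane of the circle exists because
    the dimension is at least two. *)
Lemma point_arc gamma (b r : R) : (2 <= n)%N -> is_circular_arc (gamma @` `[b, b]) r.
Proof.
move=> hn; pose i := Ordinal (ltnW hn); pose j := Ordinal hn.
pose u : 'rV[R]_n := delta_mx 0 i; pose v : 'rV[R]_n := delta_mx 0 j.
have dd k l : dotv (delta_mx 0 k : 'rV[R]_n) (delta_mx 0 l) = (k == l)%:R.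
  by rewrite dotvC dotv_delta mxE eqxx.
exists (gamma b - r *: u), u, v, 0; split; rewrite ?dd ?eqxx//.
  by rewrite lexx/= mulr_ge0// pi_ge0.
have E : gamma b - r *: u + (r * cos 0) *: u + (r * sin 0) *: v = gamma b.
  by rewrite cos0 sin0 mulr0 scale0r addr0 mulr1 subrK.
apply/seteqP; split=> _ [s /= hs <-]; move: hs; rewrite in_itv/= -eq_le => /eqP h.
  by exists 0; [rewrite /= in_itv/= lexx|rewrite E h].
by exists b; [rewrite /= in_itv/= lexx|rewrite -h E].
Qed.

End Shapes.

(** * Relatively extremal knots *)

Section ExtremalKnot.
Context {R : realType} {n : nat}.
Variables (L : R) (gamma : R -> 'rV[R]_n) (r : R).
Local Notation T := (derive1 gamma).
Local Notation T' := (fun s => - T (- s)).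
Hypotheses (L0 : 0 < L) (ext : relatively_extremal L gamma) (unit : unit_speed gamma).
Hypotheses (r0 : 0 < r) (hr : ball_radius gamma = r%:E).

Let knot : simple_C11_closed L gamma := ext.1.
Let gT := knot_has_velocity knot.
Let T1 := knot_unit unit.
Let pg := knot_periodic knot.
Let pT := knot_velocity_periodic knot.
Let inj := knot_injective L0 knot.
Let otbTL : outside_tangent_balls gamma T r /\
  forall s t, normv (T s - T t) <= r^-1 * `|s - t|.
Proof. by apply: (knot_ball_radius_lip knot) => //; rewrite hr. Qed.
Let otb := otbTL.1.
Let TL := otbTL.2.
Let LL : 2 * (pi * r) <= L := closed_length_ge r0 L0 gT T1 pg TL.
Let C_closed := contact_free_open r0 L0 gT T1 pg pT TL otb inj.
Let shortest := extremal_locally_shortest L0 ext unit r0 hr.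
Local Notation C := (contact gamma T r).

Let not_constant e : exists s, T s != e.
Proof.
apply: contrapT => h; have Te s : T s = e.
  by apply/eqP; apply: contrapT => /negP hs; apply: h; exists s.
have := straight_position gT (ltW L0) (fun s _ => Te s).
rewrite subr0 -(pg 0) add0r => /eqP; rewrite -subr_eq0 opprD addrA subrr add0r oppr_eq0.
rewrite scaler_eq0 gt_eqF//= => /eqP e0.
by have := T1 0; rewrite Te e0 dotv0 => /esym/eqP; rewrite oner_eq0.
Qed.

Lemma extremal_right s0 e delta : 0 < delta -> (forall s, s0 <= s <= s0 + delta -> T s = e) ->
  exists b d, [/\ s0 < b, b <= d, d - b <= pi * r, forall s, s0 <= s <= b -> T s = e &
    (d = b \/ exists f, turns T r b e f d) /\ (d - b = pi * r \/ C d)].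
Proof. exact: (segment_then_turn r0 LL T1 TL pT not_constant C_closed shortest). Qed.

(** Reversing the orientation turns this into [extremal_right]. *)
Lemma extremal_left s0 e delta : 0 < delta -> (forall s, s0 - delta <= s <= s0 -> T s = e) ->
  exists a c, [/\ a < s0, c <= a, a - c <= pi * r, forall s, a <= s <= s0 -> T s = e &
    (c = a \/ exists f, turns T' r (- a) (- e) f (- c)) /\ (a - c = pi * r \/ C c)].
Proof.
move=> d0 Te.
have T1' s : dotv (T' s) (T' s) = 1 by rewrite dotvNl dotvNr opprK.
have TL' s t : normv (T' s - T' t) <= r^-1 * `|s - t|.
  rewrite -opprD normvN; apply: le_trans (TL _ _) _.
  by rewrite opprK addrC distrC.
have pT' s : T' (s + L) = T' s.
  by rewrite /= -(pT (- (s + L))); congr (- T _); ring.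
have nT' e' : exists s, T' s != e'.
  by have [s hs] := not_constant (- e'); exists (- s); rewrite opprK eqr_oppLR.
have C' s : ~ C (- s) -> exists2 e, 0 < e & forall t, `|t - s| <= e -> ~ C (- t).
  move=> /C_closed[d d1 hd]; exists d => // t ts; apply: hd.
  by rewrite opprK addrC distrC.
have ls u v : u < v -> v - u < L -> (forall s, u <= s <= v -> ~ C (- s)) ->
    locally_shortest T' r u v.
  move=> uv vL noC; have cT : coord_continuous_fun T := lipschitz_coord_continuous TL.
  have vu : - v < - u by rewrite ltrN2.
  have := locally_shortest_rev vu cT (r := r); rewrite !opprK; apply.
  apply: shortest => // [|s /andP[h1 h2]]; first by rewrite opprK addrC.
  by rewrite -(opprK s); apply: noC; apply/andP; split; lra.
have Te' s : - s0 <= s <= - s0 + delta -> T' s = - e.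
  by move=> /andP[h1 h2]; rewrite /= Te//; apply/andP; split; lra.
have [b [d [sb bd dpi Tb [hd hC]]]] :=
  segment_then_turn r0 LL T1' TL' pT' nT' C' ls d0 Te'.
exists (- b), (- d); split; [lra|lra|lra| |].
  move=> s /andP[h1 h2]; apply: oppr_inj; rewrite -(Tb (- s)) ?opprK//.
  by apply/andP; split; lra.
split; last by case: hC => [h|h]; [left; lra|right].
by case: hd => [->|[f tf]]; [left|right; exists f; rewrite !opprK].
Qed.

(** Half a circle of radius [r] joins points at distance [2 r], and antipodal points at
    this distance form a contact. *)
Lemma extremal_contact s0 e delta : 0 < delta ->
  (forall s, s0 <= s <= s0 + delta -> T s = e) -> exists s, C s.
Proof.
move=> d0 Te; have [b [d [sb bd dpi Tb [hd hC]]]] := extremal_right d0 Te.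
have pi0 := pi_gt0 R; have pir : 0 < pi * r by rewrite mulr_gt0.
case: hC => [dE|Cd]; last by exists d.
case: hd => [db|[f tf]]; first by rewrite db subrr in dE; rewrite -dE ltxx in pir.
exists d; have := contact_of_antipodal r0 L0 gT T1 pg pT TL otb inj (s := b) (t := d).
have l := LL; move=> h; have [] // := h _ _ _; [lra|lra|].
have hs : b <= d <= d by rewrite bd lexx.
rewrite (turn_position r0 gT tf hs) dE mulfK ?gt_eqF// cospi sinpi mulr0 scale0r addr0.
have -> : gamma b + r *: f + (r * -1) *: - f - gamma b = (2 * r) *: f.
  by apply/rowP => i; rewrite !mxE; ring.
have [f1 _ _] := tf; rewrite normvZ gtr0_norm ?mulr_gt0//.
by rewrite ((normv_unit f).2 f1) mulr1.
Qed.

(** A curvature below its maximum [1 / r] leaves the slack that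
    [locally_shortest_straight] needs. *)
Lemma straight_near s0 : (curvature gamma s0 < (r^-1)%:E)%E -> ~ C s0 ->
  exists e delta, 0 < delta /\ forall s, s0 - delta <= s <= s0 + delta -> T s = e.
Proof.
move=> /(slack_near T1 TL)[k [d1 [k0 kr d10 Tk]]] /C_closed[d2 d20 noC].
have pi0 := pi_gt0 R; have pir : 0 < pi * r by rewrite mulr_gt0.
pose d := Num.min (Num.min (d1 / 2) d2) (pi * r / 2).
have d0 : 0 < d by rewrite !lt_min !divr_gt0// d20.
have [h1 h2 h3] : [/\ d <= d1 / 2, d <= d2 & d <= pi * r / 2] by rewrite !ge_min !lexx !orbT.
have ll := LL.
have uv : s0 - d < s0 + d by lra.
have ls : locally_shortest T r (s0 - d) (s0 + d).
  apply: shortest => //; first by lra.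
  by move=> s /andP[s1 s2]; apply: noC; rewrite ler_norml; apply/andP; split; lra.
have lip s t : s0 - d <= s -> s <= t -> t <= s0 + d -> normv (T s - T t) <= k * (t - s).
  move=> s1 st t2; have -> : t - s = `|s - t| by rewrite ler0_norm ?subr_le0// opprB.
  by apply: Tk; rewrite ltr_norml; apply/andP; split; lra.
have [e Te] := locally_shortest_straight r0 T1 TL uv ls lip k0 kr.
exists e, (d / 2); split; first by rewrite divr_gt0.
by move=> s /andP[s1 s2]; apply: Te; apply/andP; split; lra.
Qed.

Lemma sup_curvature_turn b e f d : b < d -> d - b <= pi * r -> dotv e e = 1 ->
  turns T r b e f d -> sup_curvature gamma = (r^-1)%:E.
Proof.
move=> bd dpi e1 [f1 ef Tf]; apply/eqP; rewrite eq_le sup_curvature_le//=.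
apply: le_trans (_ : curvature gamma ((b + d) / 2) <= _)%E.
  apply: (curvature_turn r0 T1 TL (b := b) (d := d)) => //; [lra|lra|].
  by move=> x y hx hy; rewrite !Tf// great_circle_dot//; congr cos; ring.
by apply: ereal_sup_ubound; exists ((b + d) / 2).
Qed.

Lemma sup_curvature_turn_rev a e f c : c < a -> a - c <= pi * r -> dotv e e = 1 ->
  turns T' r (- a) e f (- c) -> sup_curvature gamma = (r^-1)%:E.
Proof.
move=> ca api e1 [f1 ef Tf]; apply/eqP; rewrite eq_le sup_curvature_le//=.
apply: le_trans (_ : curvature gamma ((c + a) / 2) <= _)%E.
  apply: (curvature_turn r0 T1 TL (b := c) (d := a)) => //; [lra|lra|].
  move=> x y hx hy; have hN z : c <= z <= a -> T z = - great_circle e f ((- z - - a) / r).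
    by move=> hz; rewrite -Tf ?opprK// !lerN2 andbC.
  rewrite !hN// dotvNl dotvNr opprK great_circle_dot// -cosN; congr cos; ring.
by apply: ereal_sup_ubound; exists ((c + a) / 2).
Qed.

Lemma turn_arc_rev a e f c : dotv e e = 1 -> c <= a -> a - c <= pi * r ->
  turns T' r (- a) e f (- c) -> is_circular_arc (gamma @` `[c, a]) r.
Proof.
move=> e1 ca api tf.
have gT' : has_velocity (fun s => gamma (- s)) T'.
  move=> u s.
  by apply: (der_eq (der_comp (gT u (- s)) (derN (der_id s)))); rewrite dotvNl; ring.
have -> : gamma @` `[c, a] = (fun s => gamma (- s)) @` `[- a, - c].
  apply/seteqP; split=> _ [s /= hs <-]; exists (- s); rewrite ?opprK//.
    by move: hs; rewrite !in_itv/= !lerN2 andbC.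
  by move: hs; rewrite !in_itv/= lerNl lerNr andbC.
by apply: (turn_arc r0 gT' e1 _ _ tf); lra.
Qed.

End ExtremalKnot.

Theorem theorem2 (R : realType) (n : nat) (hn : (2 <= n)%N) (L : R)
    (hL : 0 < L) (gamma : R -> 'rV[R]_n)
    (hext : relatively_extremal L gamma) (hunit : unit_speed gamma)
    (s0 : R) (hs0 : (curvature gamma s0 < sup_curvature gamma)%E) :
  (injectivity_radius gamma = ball_radius gamma /\
   ball_radius gamma = ((2^-1)%:E * MDC gamma)%E) /\
  (~ min_critical gamma s0 ->
   exists c a b d r : R,
     [/\ [/\ c <= a, a < s0, s0 < b & b <= d],
         focal_distance gamma = r%:E,
         gamma @` `[a, b] = segment (gamma a) (gamma b),
         is_circular_arc (gamma @` `[c, a]) r /\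
         is_circular_arc (gamma @` `[b, d]) r &
         (pi * r <= a - c \/ min_critical gamma c) /\
         (pi * r <= d - b \/ min_critical gamma d)]).
Proof.
have knot := hext.1; have [r r0 hr] := knot_ball_radius hL knot hunit.
have T1 := knot_unit hunit; have gT := knot_has_velocity knot.
have [otb TL] : outside_tangent_balls gamma (derive1 gamma) r /\
    forall s t, normv (derive1 gamma s - derive1 gamma t) <= r^-1 * `|s - t|.
  by apply: (knot_ball_radius_lip knot) => //; rewrite hr.
have k0 : (curvature gamma s0 < (r^-1)%:E)%E.
  by apply: lt_le_trans hs0 _; exact: sup_curvature_le.
have [s1 Cs1] : exists s, contact gamma (derive1 gamma) r s.
  have [Cs0|nC] := pselect (contact gamma (derive1 gamma) r s0); first by exists s0.
  have [e [d [d0 Te]]] := straight_near hL hext hunit r0 hr k0 nC.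
  apply: (extremal_contact hL hext hunit r0 hr d0 (s0 := s0) (e := e)) => s /andP[h1 h2].
  by apply: Te; apply/andP; split; lra.
have mc := min_critical_contact r0 otb (ex_intro _ s1 Cs1).
split.
  rewrite (injectivity_radius_contact r0 otb Cs1) hr (MDC_contact r0 otb Cs1).
  by split=> //; rewrite -EFinM; congr EFin; field.
rewrite mc => nC.
have [e [dl [dl0 Te]]] := straight_near hL hext hunit r0 hr k0 nC.
have Te1 s : s0 <= s <= s0 + dl -> derive1 gamma s = e.
  by move=> /andP[h1 h2]; apply: Te; apply/andP; split; lra.
have Te2 s : s0 - dl <= s <= s0 -> derive1 gamma s = e.
  by move=> /andP[h1 h2]; apply: Te; apply/andP; split; lra.
have [b [d [sb bd dpi Tb [hd hCd]]]] := extremal_right hL hext hunit r0 hr dl0 Te1.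
have [a [c [as0 ca cpi Ta [hc hCc]]]] := extremal_left hL hext hunit r0 hr dl0 Te2.
have e1 : dotv e e = 1 by rewrite -(Te s0) ?T1//; apply/andP; split; lra.
have Ne1 : dotv (- e) (- e) = 1 by rewrite dotvNl dotvNr opprK.
have pir : 0 < pi * r by rewrite mulr_gt0 ?pi_gt0.
have seg : gamma @` `[a, b] = segment (gamma a) (gamma b).
  apply: (straight_segment gT); first exact: lt_trans sb.
  move=> s /andP[h1 h2]; have [ss|ss] := leP s s0; first by apply: Ta; rewrite h1.
  by apply: Tb; rewrite h2 ltW.
suff [rho [hF arcL arcR hL' hR']] : exists rho : R, [/\ focal_distance gamma = rho%:E,
    is_circular_arc (gamma @` `[c, a]) rho, is_circular_arc (gamma @` `[b, d]) rho,
    pi * rho <= a - c \/ contact gamma (derive1 gamma) r c &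
    pi * rho <= d - b \/ contact gamma (derive1 gamma) r d].
  by exists c, a, b, d, rho.
have [[cE dE]|turning] := pselect (c = a /\ d = b).
  (* Both arcs are reduced to a point and [F_k] need not be the radius [r]. *)
  have [k kE kp] : exists2 k : R, sup_curvature gamma = k%:E & 0 < k.
    have sp := le_lt_trans (curvature_ge0 T1 TL s0) hs0.
    have sl := sup_curvature_le r0 T1 TL.
    move: sp sl; case: (sup_curvature gamma) => [k|//|//]; rewrite lte_fin => kp _.
    by exists k.
  exists k^-1; rewrite cE dE !subrr; split; try exact: point_arc.
  - by rewrite /focal_distance kE inver gt_eqF.
  - by right; case: hCc; rewrite cE// subrr => h; rewrite -h ltxx in pir.
  - by right; case: hCd; rewrite dE// subrr => h; rewrite -h ltxx in pir.
have supE : sup_curvature gamma = (r^-1)%:E.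
  have [cE|ca'] := eqVneq c a.
    have [dE|db'] := eqVneq d b; first by exfalso; apply: turning.
    case: hd => [dE|[f tf]]; first by rewrite dE eqxx in db'.
    have lt_bd : b < d by rewrite lt_neqAle eq_sym db'.
    exact: (sup_curvature_turn hext hunit r0 hr lt_bd dpi e1 tf).
  case: hc => [cE|[f tf]]; first by rewrite cE eqxx in ca'.
  have lt_ca : c < a by rewrite lt_neqAle ca'.
  exact: (sup_curvature_turn_rev hext hunit r0 hr lt_ca cpi Ne1 tf).
exists r; split.
- by rewrite /focal_distance supE inver invr_eq0 gt_eqF// invrK.
- case: hc => [->|[f tf]]; first exact: point_arc.
  exact: (turn_arc_rev hext r0 Ne1 ca cpi tf).
- case: hd => [->|[f tf]]; first exact: point_arc.
  exact: (turn_arc r0 gT e1 bd dpi tf).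
- by case: hCc => [->|h]; [left|right].
- by case: hCd => [->|h]; [left|right].
Qed.
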